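(* Let $x$ be a complex number with $0<|x|<1$, and set $z={}_2F_1\left(\frac12,\frac12;1;x\right)$, $y=\pi\,\frac{{}_2F_1\left(\frac12,\frac12;1;1-x\right)}{{}_2F_1\left(\frac12,\frac12;1;x\right)}$ and $q=e^{-y}$. Then $$\mathcal{P}_{0,2}(q)=\frac1{16}\Big(-2+(2-3x)z^2+8x(1-x)z\frac{dz}{dx}\Big),$$ $$\mathcal{P}_{1,2}(q)=\frac1{16}xz^2,$$ $$\mathcal{E}_{0,2}(q)=\frac1{48}\big(-2+(2-x)z^2\big),$$ $$\mathcal{E}_{1,2}(q)=\frac1{16}xz^2,$$ $$\mathcal{Q}_{0,2}(q)=\frac1{32}\big(2-(2-2x+x^2)z^4\big),$$ $$\mathcal{Q}_{1,2}(q)=\frac1{32}x(2-x)z^4.$$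
   Context: For $s,n\in\mathbb{N}$ (positive integers), $\widetilde{\sigma}_s(n)=\sum_{d\mid n}(-1)^{d-1}d^s$ and $\widehat{\sigma}_s(n)=\sum_{d\mid n}(-1)^{\frac nd-1}d^s$; write $\widetilde{\sigma}=\widetilde{\sigma}_1$, $\widehat{\sigma}=\widehat{\sigma}_1$, and set $\widetilde{\sigma}_s(n)=\widehat{\sigma}_s(n)=0$ if $n$ is not a positive integer (in particular at $n=0$). For $|q|<1$ and $r\in\{0,1\}$, $$\mathcal{P}_{r,2}(q)=\sum_{n=0}^\infty\widetilde{\sigma}(2n+r)q^{2n+r},\quad \mathcal{E}_{r,2}(q)=\sum_{n=0}^\infty\widehat{\sigma}(2n+r)q^{2n+r},\quad \mathcal{Q}_{r,2}(q)=\sum_{n=0}^\infty\widetilde{\sigma}_3(2n+r)q^{2n+r}.$$ ${}_2F_1$ is the Gaussian hypergeometric function, with ${}_2F_1\left(\frac12,\frac12;1;1-x\right)$ given by the principal branch of its analytic continuation; for real $x\in(-1,0)$, where $1-x$ lies on the branch cut, either boundary value may be used, since they change $y$ only by an integer multiple of $2\pi i$ and leave $q$ unchanged. $z$ is regarded as a function of $x$, and $dz/dx$ is its derivative. *)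

(* Defs.v *)
From Stdlib Require Import Reals ZArith List.
From Coquelicot Require Import Coquelicot.

Open Scope C_scope.

Definition Cexp (z : C) : C :=
  (exp (Re z) * cos (Im z), exp (Re z) * sin (Im z))%R.

Definition divisors (n : nat) : list nat :=
  filter (fun d => Nat.eqb (Nat.modulo n d) 0) (seq 1 n).

Definition Zsum (l : list Z) : Z := fold_right Z.add 0%Z l.

(* [divisors 0] is empty, so both functions vanish at 0. *)
Definition sigma_tilde (s n : nat) : Z :=
  Zsum (map (fun d => (-1) ^ Z.of_nat (d - 1) * Z.of_nat d ^ Z.of_nat s)%Z
            (divisors n)).

Definition sigma_hat (s n : nat) : Z :=
  Zsum (map (fun d => (-1) ^ Z.of_nat (n / d - 1) * Z.of_nat d ^ Z.of_nat s)%Z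
            (divisors n)).

(* [l] is the sum of the convergent series
   a(r) q^r + a(r+2) q^(r+2) + a(r+4) q^(r+4) + ... *)
Definition is_dissected_sum (a : nat -> Z) (r : nat) (q l : C) : Prop :=
  @is_series C_AbsRing C_NormedModule
    (fun n : nat => RtoC (IZR (a (2 * n + r)%nat)) * q ^ (2 * n + r)) l.

Definition is_P (r : nat) : C -> C -> Prop := is_dissected_sum (sigma_tilde 1) r.
Definition is_E (r : nat) : C -> C -> Prop := is_dissected_sum (sigma_hat 1) r.
Definition is_Q (r : nat) : C -> C -> Prop := is_dissected_sum (sigma_tilde 3) r.

Fixpoint pochhammer (a : C) (n : nat) : C :=
  match n with
  | O => 1
  | S k => pochhammer a k * (a + INR k)
  end.

Definition hyp2F1_coeff (a b c : C) (n : nat) : C :=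
  pochhammer a n * pochhammer b n / (pochhammer c n * INR (fact n)).

Definition analytic_at (f : C -> C) (w : C) : Prop :=
  exists (a : nat -> C) (r : R), (0 < r)%R /\
    forall h : C, (Cmod h < r)%R ->
      @is_pseries C_AbsRing C_NormedModule a h (f (w + h)).

(* The complement of the branch cut [1, +oo). *)
Definition slit_plane (w : C) : Prop := Im w <> 0%R \/ (Re w < 1)%R.

(* [F] is 2F1(a, b; c; .) on the slit plane: the sum of the Gauss series on the
   unit disc, continued analytically.  This determines [F] on the slit plane,
   which is connected; the values of [F] on the cut are unconstrained. *)
Definition is_hyp2F1 (a b c : C) (F : C -> C) : Prop :=
  (forall w : C, (Cmod w < 1)%R ->
     @is_pseries C_AbsRing C_NormedModule (hyp2F1_coeff a b c) w (F w)) /\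
  (forall w : C, slit_plane w -> analytic_at F w).

(* On the cut, either of the two boundary values is a value of the branch. *)
Definition is_branch_value (F : C -> C) (w v : C) : Prop :=
  (slit_plane w /\ v = F w) \/
  (~ slit_plane w /\
   (filterlim F (within (fun u : C => (0 < Im u)%R) (locally w)) (locally v) \/
    filterlim F (within (fun u : C => (Im u < 0)%R) (locally w)) (locally v))).

(* Main.v *)
(* Let z = F(x) with F = 2F1(1/2, 1/2; 1; .), and let D be q d/dq.

   Dependence of q on x. By the Wronskian, pi F(1 - x) / F(x) has derivative
   -1 / (x (1 - x) z^2); comparing with the Frobenius solution F(x) log x + M(x) and with
   the asymptotics at 0 and 1 on the real interval (Wallis and the alternating harmonic
   series provide the constants pi and log 16) gives q = (x / 16) exp(M(x) / F(x)) on the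
   slit disc, and on the cut by passing to the limit.  The series p = sqrt(1 - x) F(x) has
   p_0 = 1 and p_n <= 0 for n >= 1, because n^2 p_n = -1/4 (c_0 + ... + c_(n-1)) where c_n are
   the nonnegative coefficients of F(x) / sqrt(1 - x).  Hence F has no zero, and
   |x q'/q - 1| = |1 / p(x)^2 - 1| <= 1 / p(|x|)^2 - 1, which yields |q(x)| <= q(|x|) < 1.

   Eisenstein series. With Phi = sum sigma(n) q^n, Liouville's identity evaluates the squares
   of Phi and of its alternating analogue.  At q, -q, q^2 and q^4 these are linear relations
   between all the quadratic monomials in Phi(q), Phi(q^2), Phi(q^4); they express the cubic
   divisor sums as quadratic polynomials in A = theta_2^4 and S = theta_3^4, and show that,
   with U = D(S) / (2 S),
     D A = A (S - A) + 2 A U,   D S = 2 S U,   D U = U^2 + A (S - A) / 4.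

   By the hypergeometric equation and D = x (1 - x) z^2 d/dx, the functions A = x z^2,
   S = z^2, U = x (1 - x) z z' satisfy the same system.  Both solutions have the same first
   order expansion at x = 0, so a Gronwall estimate on rays makes them equal. *)

Require Import Defs.
From Stdlib Require Import Reals Lra Lia ZArith Bool List Factorial.
From Coquelicot Require Import Coquelicot.

Open Scope C_scope.

(** * Complex power series *)

(** The statement starts from x, so theta functions are never inverted and everything lives on the
    unit disc in x. [F (1 - x)] has a logarithm at x = 0 and a cut along (-1, 0), yet the two
    systems must be compared at x = 0. The closed form [nome] resolves this: it has neither cut nor
    singularity, and it turns Eisenstein series in q into holomorphic functions of x as soon as F
    has no zero and |q| < 1. Neither fact is apparent for complex x; the sign pattern of sqrt(1 - x)
    F reduces both to real positive x, where q = exp(-pi F(1 - x) / F(x)) < 1 is visible.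

    A, S, U are closed under D with quadratic right-hand sides, so the difference of two solutions
    satisfies a linear system x f' = C(x) f with C holomorphic. The matrix C(0) has eigenvalues 1,
    0, 0: because of the eigenvalue 1, equal values at 0 would not determine the solution (rescaling
    q changes it), whereas first-order agreement does. This is why the constant 16 must be known
    exactly. *)

Notation is_Cseries := (@is_series C_AbsRing C_NormedModule).
Definition is_Cderive (f : C -> C) (z l : C) : Prop :=
  @is_derive C_AbsRing C_NormedModule f z l.

Lemma Re_sum_n (u : nat -> C) (n : nat) :
  Re (@sum_n C_AbelianMonoid u n) = sum_n (fun k => Re (u k)) n.
Proof.
  induction n as [|n IH]; [now rewrite !sum_O|].
  rewrite !sum_Sn, <- IH; reflexivity.
Qed.

Lemma Im_sum_n (u : nat -> C) (n : nat) :
  Im (@sum_n C_AbelianMonoid u n) = sum_n (fun k => Im (u k)) n.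
Proof.
  induction n as [|n IH]; [now rewrite !sum_O|].
  rewrite !sum_Sn, <- IH; reflexivity.
Qed.

Lemma is_Cseries_Re_Im (u : nat -> C) (l : C) :
  is_Cseries u l <->
  is_series (fun n => Re (u n)) (Re l) /\ is_series (fun n => Im (u n)) (Im l).
Proof.
  split.
  - intros H; split; apply filterlim_locally; intros eps;
      destruct (proj1 (filterlim_locally _ _) H eps) as [N HN]; exists N; intros n Hn;
      specialize (HN n Hn); destruct HN as [H1 H2].
    + rewrite <- Re_sum_n. exact H1.
    + rewrite <- Im_sum_n. exact H2.
  - intros [H1 H2]. apply filterlim_locally; intros eps.
    destruct (proj1 (filterlim_locally _ _) H1 eps) as [N1 HN1].
    destruct (proj1 (filterlim_locally _ _) H2 eps) as [N2 HN2].
    exists (max N1 N2); intros n Hn; split.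
    + generalize (HN1 n ltac:(lia)). rewrite <- Re_sum_n. exact (fun H => H).
    + generalize (HN2 n ltac:(lia)). rewrite <- Im_sum_n. exact (fun H => H).
Qed.

(** Total, through real and imaginary parts, so that a power series becomes a plain function of the
    point; the value is meaningful only under convergence. *)
Definition Csum (u : nat -> C) : C :=
  (Series (fun n => Re (u n)), Series (fun n => Im (u n))).

Lemma is_Cseries_unique (u : nat -> C) (l : C) : is_Cseries u l -> Csum u = l.
Proof.
  intros H. apply is_Cseries_Re_Im in H. destruct H as [H1 H2].
  unfold Csum. rewrite (is_series_unique _ _ H1), (is_series_unique _ _ H2).
  now destruct l.
Qed.

Lemma im_le_Cmod (c : C) : (Rabs (Im c) <= Cmod c)%R.
Proof.
  eapply Rle_trans; [|apply Rmax_Cmod]. apply Rmax_r.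
Qed.

Lemma ex_series_Re (u : nat -> C) :
  ex_series (fun n => Cmod (u n)) -> ex_series (fun n => Rabs (Re (u n))).
Proof.
  apply (@ex_series_le R_AbsRing R_CompleteNormedModule).
  intros n. change (Rabs (Rabs (Re (u n))) <= Cmod (u n))%R.
  rewrite Rabs_Rabsolu. apply re_le_Cmod.
Qed.

Lemma ex_series_Im (u : nat -> C) :
  ex_series (fun n => Cmod (u n)) -> ex_series (fun n => Rabs (Im (u n))).
Proof.
  apply (@ex_series_le R_AbsRing R_CompleteNormedModule).
  intros n. change (Rabs (Rabs (Im (u n))) <= Cmod (u n))%R.
  rewrite Rabs_Rabsolu. apply im_le_Cmod.
Qed.

Lemma Csum_correct (u : nat -> C) :
  ex_series (fun n => Cmod (u n)) -> is_Cseries u (Csum u).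
Proof.
  intros H. apply is_Cseries_Re_Im; split; apply Series_correct, ex_series_Rabs.
  - now apply ex_series_Re.
  - now apply ex_series_Im.
Qed.

Lemma Cmod_sum_n_le (u : nat -> C) (n : nat) :
  (Cmod (@sum_n C_AbelianMonoid u n) <= sum_n (fun k => Cmod (u k)) n)%R.
Proof.
  induction n as [|n IH]; [rewrite !sum_O; lra|].
  rewrite !sum_Sn. eapply Rle_trans; [apply Cmod_triangle|].
  apply Rplus_le_compat_r, IH.
Qed.

Lemma is_Cseries_eps (u : nat -> C) (l : C) (eps : R) :
  is_Cseries u l -> (0 < eps)%R ->
  exists N, forall n, (N <= n)%nat ->
    (Cmod (@sum_n C_AbelianMonoid u n - l) < eps)%R.
Proof.
  intros H He.
  destruct (proj1 (filterlim_locally_ball_norm _ _) H (mkposreal _ He)) as [N HN].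
  exists N; intros n Hn. exact (HN n Hn).
Qed.

Lemma Cmod_series_le (u : nat -> C) (v : nat -> R) (l : C) (s : R) :
  is_Cseries u l -> is_series v s -> (forall n, Cmod (u n) <= v n)%R ->
  (Cmod l <= s)%R.
Proof.
  intros Hu Hv Hle. apply Rnot_lt_le; intros Hlt.
  assert (He : (0 < (Cmod l - s) / 2)%R) by lra.
  destruct (is_Cseries_eps u l _ Hu He) as [N HN].
  destruct (proj1 (filterlim_locally _ _) Hv (mkposreal _ He)) as [N' HN'].
  set (n := max N N').
  specialize (HN n ltac:(unfold n; lia)). specialize (HN' n ltac:(unfold n; lia)).
  change (Rabs (sum_n v n - s) < (Cmod l - s) / 2)%R in HN'.
  apply Rabs_def2 in HN'.
  assert (H1 : (Cmod l <= Cmod (@sum_n C_AbelianMonoid u n) +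
                 Cmod (@sum_n C_AbelianMonoid u n - l))%R).
  { replace l with (@sum_n C_AbelianMonoid u n + - (@sum_n C_AbelianMonoid u n - l)) at 1
      by ring.
    eapply Rle_trans; [apply Cmod_triangle|]. rewrite Cmod_opp. lra. }
  assert (H2 : (Cmod (@sum_n C_AbelianMonoid u n) <= sum_n v n)%R).
  { eapply Rle_trans; [apply Cmod_sum_n_le|]. apply sum_n_m_le. exact Hle. }
  lra.
Qed.

(** Radius of convergence at least [rho]. Absolute convergence at all smaller radii is the form that
    Cauchy products and termwise bounds consume directly. *)
Definition conv_disc (a : nat -> C) (rho : R) : Prop :=
  forall r : R, (0 <= r < rho)%R -> ex_series (fun n => Cmod (a n) * r ^ n)%R.

Definition CPS (a : nat -> C) (z : C) : C := Csum (fun n => a n * z ^ n).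

Lemma CPS_correct (a : nat -> C) (rho : R) (z : C) :
  conv_disc a rho -> (Cmod z < rho)%R -> is_Cseries (fun n => a n * z ^ n) (CPS a z).
Proof.
  intros H Hz. apply Csum_correct.
  eapply ex_series_ext; [|apply (H (Cmod z))].
  - intros n. simpl. now rewrite Cmod_mult, Cmod_pow.
  - split; [apply Cmod_ge_0|exact Hz].
Qed.

Lemma CPS_unique (a : nat -> C) (z l : C) :
  is_Cseries (fun n => a n * z ^ n) l -> CPS a z = l.
Proof. apply is_Cseries_unique. Qed.

Lemma pow_n_C (z : C) (n : nat) : @pow_n C_Ring z n = z ^ n.
Proof.
  induction n as [|n IH]; [reflexivity|]. simpl. now rewrite IH.
Qed.

Lemma is_pseries_C (a : nat -> C) (z l : C) :
  @is_pseries C_AbsRing C_NormedModule a z l <-> is_Cseries (fun n => a n * z ^ n) l.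
Proof.
  assert (E : forall n, @scal C_AbsRing C_NormedModule (pow_n z n) (a n) = a n * z ^ n).
  { intros n. transitivity (@pow_n C_Ring z n * a n); [reflexivity|].
    rewrite pow_n_C. apply Cmult_comm. }
  split; apply is_series_ext; intros n; [|symmetry]; apply E.
Qed.

Lemma is_Cseries_bounded (u : nat -> C) (l : C) :
  is_Cseries u l -> exists B, (0 <= B)%R /\ forall n, (Cmod (u n) <= B)%R.
Proof.
  intros H. apply is_Cseries_Re_Im in H. destruct H as [H1 H2].
  assert (bnd : forall v : nat -> R, ex_series v -> exists B, forall n, (Rabs (v n) <= B)%R).
  { intros v Hv. apply ex_series_lim_0 in Hv.
    destruct (filterlim_bounded v) as [M HM]; [now exists 0%R|].
    exists M; exact HM. }
  destruct (bnd _ (ex_intro _ _ H1)) as [B1 HB1].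
  destruct (bnd _ (ex_intro _ _ H2)) as [B2 HB2].
  exists (B1 + B2)%R; split.
  - generalize (HB1 0%nat) (HB2 0%nat) (Rabs_pos (Re (u 0%nat))) (Rabs_pos (Im (u 0%nat))).
    lra.
  - intros n. replace (u n) with (RtoC (Re (u n)) + RtoC (Im (u n)) * Ci).
    + eapply Rle_trans; [apply Cmod_triangle|].
      rewrite Cmod_mult, Cmod_Ci, !Cmod_R, Rmult_1_r.
      generalize (HB1 n) (HB2 n). lra.
    + unfold Ci, RtoC, Cplus, Cmult, Re, Im; simpl. destruct (u n); simpl. f_equal; ring.
Qed.

(** Abel's lemma: convergence at a real point s between r and [rho] bounds the terms there, and the
    terms at r are then dominated by a geometric series of ratio r / s. *)
Lemma conv_disc_of_pointwise (a : nat -> C) (rho : R) :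
  (forall z, (Cmod z < rho)%R -> exists l, is_Cseries (fun n => a n * z ^ n) l) ->
  conv_disc a rho.
Proof.
  intros H r [Hr0 Hr1].
  set (s := ((r + rho) / 2)%R).
  assert (Hs : (r < s < rho)%R) by (unfold s; lra).
  destruct (H (RtoC s)) as [l Hl].
  { rewrite Cmod_R, Rabs_right; lra. }
  destruct (is_Cseries_bounded _ _ Hl) as [B [HB0 HB]].
  apply (@ex_series_le R_AbsRing R_CompleteNormedModule _ (fun n => B * (r / s) ^ n)%R).
  - intros n. change (Rabs (Cmod (a n) * r ^ n) <= B * (r / s) ^ n)%R.
    rewrite Rabs_right.
    2:{ apply Rle_ge, Rmult_le_pos; [apply Cmod_ge_0|now apply pow_le]. }
    specialize (HB n). rewrite Cmod_mult, Cmod_pow, Cmod_R, (Rabs_right s) in HB by lra.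
    replace (r ^ n)%R with (s ^ n * (r / s) ^ n)%R.
    + rewrite <- Rmult_assoc. apply Rmult_le_compat_r; [|exact HB].
      apply pow_le, Rdiv_le_0_compat; lra.
    + rewrite <- Rpow_mult_distr. f_equal. field. lra.
  - apply ex_series_scal_l with (c := B) (a := (fun n => (r / s) ^ n)%R).
    apply ex_series_geom. rewrite Rabs_right.
    + apply Rmult_lt_reg_r with s; [lra|]. unfold Rdiv. rewrite Rmult_assoc, Rinv_l; lra.
    + apply Rle_ge, Rdiv_le_0_compat; lra.
Qed.

(** n x^n <= 1 + x + ... + x^(n-1), since x^n is below each of these powers. The bound absorbs the
    factor n produced by differentiation at the price of a smaller radius. *)
Lemma n_pow_le (x : R) (n : nat) : (0 <= x < 1)%R -> (INR n * x ^ n <= / (1 - x))%R.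
Proof.
  intros Hx.
  assert (H : (INR n * x ^ n * (1 - x) <= 1 - x ^ n)%R).
  { induction n as [|n IH]; [simpl; lra|].
    rewrite S_INR. simpl pow.
    assert (0 <= x ^ n)%R by (apply pow_le; lra).
    assert (x ^ n <= 1)%R.
    { rewrite <- (pow1 n). apply pow_incr; lra. }
    assert (H1 : (x * (INR n * x ^ n * (1 - x)) <= x * (1 - x ^ n))%R)
      by (apply Rmult_le_compat_l; lra).
    assert (H2 : (0 <= (1 - x) * (1 - x * x ^ n))%R)
      by (apply Rmult_le_pos; nra).
    lra. }
  apply Rmult_le_reg_r with (1 - x)%R; [lra|]. rewrite Rinv_l by lra.
  assert (0 <= x ^ n)%R by (apply pow_le; lra). lra.
Qed.

Lemma conv_disc_le (a b : nat -> C) (rho : R) :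
  (forall n, Cmod (b n) <= Cmod (a n))%R -> conv_disc a rho -> conv_disc b rho.
Proof.
  intros Hle H r Hr.
  apply (@ex_series_le R_AbsRing R_CompleteNormedModule _ (fun n => Cmod (a n) * r ^ n)%R);
    [|now apply H].
  intros n. change (Rabs (Cmod (b n) * r ^ n) <= Cmod (a n) * r ^ n)%R.
  assert (0 <= r ^ n)%R by (apply pow_le; lra).
  rewrite Rabs_right.
  - now apply Rmult_le_compat_r.
  - apply Rle_ge, Rmult_le_pos; [apply Cmod_ge_0|assumption].
Qed.

Lemma conv_disc_INR (a : nat -> C) (rho : R) :
  conv_disc a rho -> conv_disc (fun n => RtoC (INR n) * a n) rho.
Proof.
  intros H r Hr.
  set (s := ((r + rho) / 2)%R).
  assert (Hs : (r < s < rho)%R) by (unfold s; lra).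
  assert (Hx : (0 <= r / s < 1)%R).
  { split; [apply Rdiv_le_0_compat; lra|].
    apply Rmult_lt_reg_r with s; [lra|]. unfold Rdiv. rewrite Rmult_assoc, Rinv_l; lra. }
  apply (@ex_series_le R_AbsRing R_CompleteNormedModule _
           (fun n => / (1 - r / s) * (Cmod (a n) * s ^ n))%R).
  - intros n. change (Rabs (Cmod (RtoC (INR n) * a n) * r ^ n) <=
                      / (1 - r / s) * (Cmod (a n) * s ^ n))%R.
    assert (Hn : (0 <= INR n)%R) by apply pos_INR.
    assert (0 <= r ^ n)%R by (apply pow_le; lra).
    assert (0 <= s ^ n)%R by (apply pow_le; lra).
    assert (0 <= Cmod (a n))%R by apply Cmod_ge_0.
    rewrite Cmod_mult, Cmod_R, !(Rabs_right (INR n)) by lra.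
    rewrite Rabs_right by (apply Rle_ge; repeat apply Rmult_le_pos; assumption).
    replace (r ^ n)%R with ((r / s) ^ n * s ^ n)%R.
    2:{ rewrite <- Rpow_mult_distr. f_equal. field. lra. }
    replace (INR n * Cmod (a n) * ((r / s) ^ n * s ^ n))%R
      with ((INR n * (r / s) ^ n) * (Cmod (a n) * s ^ n))%R by ring.
    apply Rmult_le_compat_r; [now apply Rmult_le_pos|]. now apply n_pow_le.
  - apply ex_series_scal_l with (c := (/ (1 - r / s))%R) (a := (fun n => Cmod (a n) * s ^ n)%R).
    apply H; lra.
Qed.

Definition shift_coeff (a : nat -> C) (n : nat) : C := a (S n).

Lemma conv_disc_shift (a : nat -> C) (rho : R) :
  conv_disc a rho -> conv_disc (shift_coeff a) rho.
Proof.
  intros H r Hr. destruct (Rle_lt_or_eq_dec 0 r (proj1 Hr)) as [Hpos|<-].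
  - apply ex_series_ext with (fun n => / r * (Cmod (a (S n)) * r ^ S n))%R.
    + intros n. unfold shift_coeff. simpl. field. lra.
    + apply ex_series_scal_l with (c := (/ r)%R) (a := (fun n => Cmod (a (S n)) * r ^ S n)%R).
      apply (ex_series_incr_1 (fun n => Cmod (a n) * r ^ n)%R). now apply H.
  - apply ex_series_incr_1. exists 0%R.
    apply (is_series_ext (fun _ => 0%R)).
    + intros n. simpl. ring.
    + apply filterlim_ext with (fun _ => 0%R); [|apply filterlim_const].
      intros n. induction n as [|n IH]; [now rewrite sum_O|].
      rewrite sum_Sn, <- IH. unfold plus; simpl. ring.
Qed.

Definition deriv_coeff (a : nat -> C) (n : nat) : C := RtoC (INR (S n)) * a (S n).

Lemma conv_disc_deriv (a : nat -> C) (rho : R) :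
  conv_disc a rho -> conv_disc (deriv_coeff a) rho.
Proof.
  intros H. apply (conv_disc_shift (fun n => RtoC (INR n) * a n)). now apply conv_disc_INR.
Qed.

(** * Complex differentiability *)

Lemma is_Cderive_eps (f : C -> C) (z l : C) :
  is_Cderive f z l <->
  forall eps : R, (0 < eps)%R -> exists d : R, (0 < d)%R /\
    forall h : C, (Cmod h < d)%R -> (Cmod (f (z + h)%C - f z - l * h) <= eps * Cmod h)%R.
Proof.
  split.
  - intros [_ H] eps He.
    destruct (H z (fun P HP => HP) (mkposreal _ He)) as [d Hd].
    exists d; split; [apply cond_pos|]. intros h Hh.
    assert (Hb : @ball (AbsRing_UniformSpace C_AbsRing) z d (z + h)).
    { change (Cmod (minus (z + h)%C z) < d)%R.
      replace (minus (z + h)%C z) with h; [exact Hh|].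
      unfold minus, plus, opp; simpl. ring. }
    specialize (Hd _ Hb).
    change (Cmod (minus (minus (f (z + h)%C) (f z)) (scal (minus (z + h)%C z) l)) <=
            eps * Cmod (minus (z + h)%C z))%R in Hd.
    replace (minus (z + h)%C z) with h in Hd by (unfold minus, plus, opp; simpl; ring).
    replace (f (z + h) - f z - l * h)
      with (minus (minus (f (z + h)) (f z)) (scal h l)); [exact Hd|].
    unfold minus, plus, opp, scal; simpl. unfold mult; simpl. ring.
  - intros H. split; [apply is_linear_scal_l|].
    intros x Hx eps.
    apply (@is_filter_lim_locally_unique C_AbsRing (AbsRing_NormedModule C_AbsRing)) in Hx.
    subst x.
    destruct (H eps (cond_pos eps)) as [d [Hd0 Hd]].
    exists (mkposreal _ Hd0). refine (fun (y : C) Hy => _).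
    change (Cmod (minus y z) < d)%R in Hy.
    specialize (Hd (minus y z) Hy).
    change (Cmod (minus (minus (f y) (f z)) (scal (minus y z) l)) <=
            eps * Cmod (minus y z))%R.
    replace (z + minus y z) with y in Hd by (unfold minus, plus, opp; simpl; ring).
    replace (minus (minus (f y) (f z)) (scal (minus y z) l))
      with (f y - f z - l * minus y z); [exact Hd|].
    unfold minus, plus, opp, scal; simpl. unfold mult; simpl. ring.
Qed.

(** The remainder e_n satisfies e_(n+1) = (z + h) e_n + n z^(n-1) h^2. The expected bound n^2
    r^(n-2) |h|^2 is multiplied by r^2 because the exponent n - 2 would be truncated. *)
Lemma Cpow_taylor_le (z h : C) (r : R) (n : nat) :
  (0 < r)%R -> (Cmod z <= r)%R -> (Cmod (z + h) <= r)%R ->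
  (Cmod ((z + h) ^ n - z ^ n - RtoC (INR n) * z ^ (n - 1) * h) * r ^ 2 <=
   INR n ^ 2 * r ^ n * Cmod h ^ 2)%R.
Proof.
  intros Hr Hz Hzh. induction n as [|n IH].
  - replace ((z + h) ^ 0 - z ^ 0 - RtoC (INR 0) * z ^ (0 - 1) * h) with (RtoC 0)
      by (simpl; ring).
    rewrite Cmod_0. simpl. lra.
  - set (e := (z + h) ^ n - z ^ n - RtoC (INR n) * z ^ (n - 1) * h) in *.
    replace ((z + h) ^ S n - z ^ S n - RtoC (INR (S n)) * z ^ (S n - 1) * h)
      with ((z + h) * e + RtoC (INR n) * z ^ (n - 1) * h ^ 2).
    2:{ unfold e. rewrite S_INR, RtoC_plus, !Cpow_S. replace (S n - 1)%nat with n by lia.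
        destruct n as [|n]; [simpl; ring|].
        replace (S n - 1)%nat with n by lia. rewrite !Cpow_S. simpl. ring. }
    assert (He : (0 <= Cmod e)%R) by apply Cmod_ge_0.
    assert (Hn : (0 <= INR n)%R) by apply pos_INR.
    assert (Hh : (0 <= Cmod h ^ 2)%R) by (apply pow_le, Cmod_ge_0).
    assert (H1 : (Cmod ((z + h) * e + RtoC (INR n) * z ^ (n - 1) * h ^ 2) <=
                  r * Cmod e + INR n * Cmod z ^ (n - 1) * Cmod h ^ 2)%R).
    { eapply Rle_trans; [apply Cmod_triangle|].
      rewrite !Cmod_mult, !Cmod_pow, Cmod_R, (Rabs_right (INR n)) by lra.
      apply Rplus_le_compat_r, Rmult_le_compat_r; assumption. }
    assert (Hrn : (0 <= r ^ n)%R) by (apply pow_le; lra).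
    assert (H2 : (INR n * Cmod z ^ (n - 1) * r ^ 2 <= INR n * r ^ S n)%R).
    { destruct n as [|n]; [simpl; lra|].
      replace (S n - 1)%nat with n by lia.
      rewrite Rmult_assoc. apply Rmult_le_compat_l; [exact Hn|].
      replace (r ^ S (S n))%R with (r ^ n * r ^ 2)%R by (simpl; ring).
      apply Rmult_le_compat_r; [apply pow_le; lra|].
      apply pow_incr. split; [apply Cmod_ge_0|exact Hz]. }
    apply Rmult_le_compat_r with (r := (r ^ 2)%R) in H1; [|apply pow_le; lra].
    apply Rmult_le_compat_l with (r := r) in IH; [|lra].
    apply Rmult_le_compat_r with (r := (Cmod h ^ 2)%R) in H2; [|exact Hh].
    assert (H3 : (0 <= (1 + INR n) * (r * r ^ n) * Cmod h ^ 2)%R)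
      by (apply Rmult_le_pos; [apply Rmult_le_pos; [|apply Rmult_le_pos]|]; lra).
    rewrite S_INR. simpl pow in *. lra.
Qed.

(** The second-order remainders sum to at most |h|^2 K / r^2, where K, the sum of n^2 |a_n| r^n at a
    radius r strictly between |z| and [rho], is finite by [conv_disc_INR] used twice. *)
Lemma CPS_derive (a : nat -> C) (rho : R) (z : C) :
  conv_disc a rho -> (Cmod z < rho)%R -> is_Cderive (CPS a) z (CPS (deriv_coeff a) z).
Proof.
  intros Ha Hz. apply is_Cderive_eps; intros eps Heps.
  set (r := ((Cmod z + rho) / 2)%R).
  assert (Hz0 : (0 <= Cmod z)%R) by apply Cmod_ge_0.
  assert (Hr : (Cmod z < r < rho)%R) by (unfold r; lra).
  assert (Hr2 : (0 < r ^ 2)%R) by (apply pow_lt; lra).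
  assert (HK : ex_series (fun n => INR n ^ 2 * Cmod (a n) * r ^ n)%R).
  { eapply ex_series_ext;
      [|apply (conv_disc_INR _ _ (conv_disc_INR _ _ Ha)); split; [|exact (proj2 Hr)]; lra].
    intros n. simpl. rewrite !Cmod_mult, !Cmod_R, !(Rabs_right (INR n)).
    - ring.
    - apply Rle_ge, pos_INR. }
  destruct HK as [K HK].
  assert (HK0 : (0 <= K)%R).
  { rewrite <- (is_series_unique _ _ HK).
    rewrite <- (is_series_unique (fun _ => 0%R) 0%R).
    - apply Series_le; [|now exists K]. intros n; split; [lra|].
      apply Rmult_le_pos; [apply Rmult_le_pos|].
      + apply pow_le, pos_INR.
      + apply Cmod_ge_0.
      + apply pow_le; lra.
    - apply filterlim_ext with (fun _ => 0%R); [|apply filterlim_const].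
      intros n. induction n as [|n IH]; [now rewrite sum_O|].
      rewrite sum_Sn, <- IH. unfold plus; simpl. ring. }
  (* The first bound keeps z + h in the disc of radius r, the second makes K |h| / r^2 at most eps;
     K + 1 avoids a division by zero. *)
  exists (Rmin (r - Cmod z) (eps * r ^ 2 / (K + 1)))%R. split.
  { apply Rmin_glb_lt; [lra|]. apply Rdiv_lt_0_compat; [|lra]. now apply Rmult_lt_0_compat. }
  intros h Hh.
  assert (Hh1 : (Cmod h < r - Cmod z)%R) by (eapply Rlt_le_trans; [exact Hh|apply Rmin_l]).
  assert (Hh2 : (Cmod h < eps * r ^ 2 / (K + 1))%R)
    by (eapply Rlt_le_trans; [exact Hh|apply Rmin_r]).
  assert (Hzh : (Cmod (z + h) <= r)%R).
  { eapply Rle_trans; [apply Cmod_triangle|]. lra. }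
  assert (HS : is_Cseries
    (fun n => a n * ((z + h) ^ n - z ^ n - RtoC (INR n) * z ^ (n - 1) * h))
    (CPS a (z + h)%C - CPS a z - CPS (deriv_coeff a) z * h)).
  { assert (H1 : is_Cseries (fun n => a n * (z + h) ^ n) (CPS a (z + h)))
      by (apply (CPS_correct a rho); [exact Ha|lra]).
    assert (H2 : is_Cseries (fun n => a n * z ^ n) (CPS a z))
      by (apply (CPS_correct a rho); [exact Ha|lra]).
    assert (H3 : is_Cseries (fun n => RtoC (INR n) * a n * z ^ (n - 1)) (CPS (deriv_coeff a) z)).
    { apply is_series_decr_1.
      match goal with |- is_series _ ?l => replace l with (CPS (deriv_coeff a) z) end.
      - eapply is_series_ext; [|apply (CPS_correct (deriv_coeff a) rho)].
        + intros n. unfold deriv_coeff. simpl Nat.sub. rewrite Nat.sub_0_r. reflexivity.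
        + now apply conv_disc_deriv.
        + exact Hz.
      - unfold plus, opp; simpl. ring. }
    generalize (is_series_minus _ _ _ _ (is_series_minus _ _ _ _ H1 H2)
                  (is_series_scal_l h _ _ H3)).
    intros H4.
    match type of H4 with is_series _ ?l =>
      replace l with (CPS a (z + h)%C - CPS a z - CPS (deriv_coeff a) z * h) in H4 end.
    - eapply is_series_ext; [|exact H4]. intros n.
      unfold plus, opp, scal; simpl. unfold mult; simpl. ring.
    - unfold plus, opp, scal; simpl. unfold mult; simpl. ring. }
  assert (Hle : (Cmod (CPS a (z + h)%C - CPS a z - CPS (deriv_coeff a) z * h) <=
                 Cmod h ^ 2 / r ^ 2 * K)%R).
  { eapply Cmod_series_le; [exact HS| |].
    { exact (@is_series_scal_l R_AbsRing R_NormedModule (Cmod h ^ 2 / r ^ 2)%R _ _ HK). }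
    intros n.
    change (Cmod (a n * ((z + h) ^ n - z ^ n - RtoC (INR n) * z ^ (n - 1) * h)) <=
            (Cmod h ^ 2 / r ^ 2) * (INR n ^ 2 * Cmod (a n) * r ^ n))%R.
    rewrite Cmod_mult. apply Rmult_le_reg_r with (r ^ 2)%R; [exact Hr2|].
    replace ((Cmod h ^ 2 / r ^ 2) * (INR n ^ 2 * Cmod (a n) * r ^ n) * r ^ 2)%R
      with (Cmod (a n) * (INR n ^ 2 * r ^ n * Cmod h ^ 2))%R by (field; lra).
    rewrite Rmult_assoc. apply Rmult_le_compat_l; [apply Cmod_ge_0|].
    apply Cpow_taylor_le; lra. }
  eapply Rle_trans; [exact Hle|].
  assert (Hh0 : (0 <= Cmod h)%R) by apply Cmod_ge_0.
  replace (Cmod h ^ 2 / r ^ 2 * K)%R with ((Cmod h * K / r ^ 2) * Cmod h)%R by (field; lra).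
  apply Rmult_le_compat_r; [exact Hh0|].
  apply Rmult_le_reg_r with (r ^ 2)%R; [exact Hr2|].
  unfold Rdiv. rewrite Rmult_assoc, Rinv_l, Rmult_1_r by lra.
  assert (Hh3 : (Cmod h * (K + 1) < eps * r ^ 2)%R).
  { apply Rmult_lt_reg_r with (/ (K + 1))%R; [apply Rinv_0_lt_compat; lra|].
    rewrite Rmult_assoc, Rinv_r by lra. unfold Rdiv in Hh2. lra. }
  nra.
Qed.

Lemma is_Cderive_lipschitz (f : C -> C) (z l : C) :
  is_Cderive f z l -> exists d : R, (0 < d)%R /\
    forall h : C, (Cmod h < d)%R -> (Cmod (f (z + h)%C - f z) <= (Cmod l + 1) * Cmod h)%R.
Proof.
  intros H. destruct (proj1 (is_Cderive_eps f z l) H 1%R Rlt_0_1) as [d [Hd Hf]].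
  exists d; split; [exact Hd|]. intros h Hh. specialize (Hf h Hh).
  replace (f (z + h) - f z) with ((f (z + h) - f z - l * h) + l * h) by ring.
  eapply Rle_trans; [apply Cmod_triangle|]. rewrite Cmod_mult. lra.
Qed.

Lemma is_Cderive_eq (f : C -> C) (z l l' : C) :
  is_Cderive f z l -> l = l' -> is_Cderive f z l'.
Proof. now intros H <-. Qed.

Lemma is_Cderive_local (f g : C -> C) (z l : C) (d : R) :
  (0 < d)%R -> (forall h, (Cmod h < d)%R -> f (z + h) = g (z + h)) ->
  is_Cderive f z l -> is_Cderive g z l.
Proof.
  intros Hd Hfg Hf. apply is_Cderive_eps; intros eps He.
  destruct (proj1 (is_Cderive_eps f z l) Hf eps He) as [d' [Hd' H]].
  exists (Rmin d d'); split; [now apply Rmin_glb_lt|]. intros h Hh.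
  assert (H1 : (Cmod h < d)%R) by (eapply Rlt_le_trans; [exact Hh|apply Rmin_l]).
  assert (H2 : (Cmod h < d')%R) by (eapply Rlt_le_trans; [exact Hh|apply Rmin_r]).
  rewrite <- (Hfg h H1). replace (g z) with (f z); [now apply H|].
  generalize (Hfg 0). rewrite !Cplus_0_r, Cmod_0. auto.
Qed.

(* The codomain norm of [C_NormedModule] is that of [C_AbsRing], but not convertibly so. *)
Lemma is_Cderive_AbsRing (f : C -> C) (z l : C) :
  is_Cderive f z l <-> @is_derive C_AbsRing (AbsRing_NormedModule C_AbsRing) f z l.
Proof.
  split; intros [[H1 H2 H3] H4]; (split; [constructor; [exact H1|exact H2|exact H3]|exact H4]).
Qed.

Lemma is_Cderive_const (c z : C) : is_Cderive (fun _ => c) z 0.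
Proof. exact (is_derive_const c z). Qed.

Lemma is_Cderive_id (z : C) : is_Cderive (fun x => x) z 1.
Proof. apply is_Cderive_AbsRing. exact (is_derive_id z). Qed.

Lemma is_Cderive_plus (f g : C -> C) (z lf lg : C) :
  is_Cderive f z lf -> is_Cderive g z lg ->
  is_Cderive (fun x => f x + g x) z (lf + lg).
Proof. intros Hf Hg. exact (is_derive_plus f g z lf lg Hf Hg). Qed.

Lemma is_Cderive_minus (f g : C -> C) (z lf lg : C) :
  is_Cderive f z lf -> is_Cderive g z lg ->
  is_Cderive (fun x => f x - g x) z (lf - lg).
Proof. intros Hf Hg. exact (is_derive_minus f g z lf lg Hf Hg). Qed.

Lemma is_Cderive_opp (f : C -> C) (z lf : C) :
  is_Cderive f z lf -> is_Cderive (fun x => - f x) z (- lf).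
Proof. intros Hf. exact (is_derive_opp f z lf Hf). Qed.

Lemma is_Cderive_mult (f g : C -> C) (z lf lg : C) :
  is_Cderive f z lf -> is_Cderive g z lg ->
  is_Cderive (fun x => f x * g x) z (lf * g z + f z * lg).
Proof.
  rewrite !is_Cderive_AbsRing. intros Hf Hg.
  exact (is_derive_mult f g z lf lg Hf Hg Cmult_comm).
Qed.

Lemma is_Cderive_comp (f g : C -> C) (z lf lg : C) :
  is_Cderive f (g z) lf -> is_Cderive g z lg ->
  is_Cderive (fun x => f (g x)) z (lf * lg).
Proof.
  rewrite (is_Cderive_AbsRing g), Cmult_comm. apply (is_derive_comp f g).
Qed.

Lemma Cmod_minus_ge (x y : C) : (Cmod x - Cmod y <= Cmod (x + y))%R.
Proof.
  assert (H := Cmod_triangle (x + y) (- y)). rewrite Cmod_opp in H.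
  replace (x + y + - y) with x in H by ring. lra.
Qed.

Lemma is_Cderive_Cinv (z : C) : z <> 0 -> is_Cderive Cinv z (- / (z * z)).
Proof.
  intros Hz. apply is_Cderive_eps; intros eps He.
  assert (Hz0 : (0 < Cmod z)%R) by now apply Cmod_gt_0.
  (* The first bound gives |z + h| >= |z| / 2, and the second then makes |h| / (|z|^2 |z + h|) at
     most eps. *)
  exists (Rmin (Cmod z / 2) (eps * Cmod z ^ 3 / 2))%R. split.
  { apply Rmin_glb_lt; [lra|]. assert (0 < Cmod z ^ 3)%R by now apply pow_lt. nra. }
  intros h Hh.
  assert (A := Rmin_l (Cmod z / 2) (eps * Cmod z ^ 3 / 2)).
  assert (B := Rmin_r (Cmod z / 2) (eps * Cmod z ^ 3 / 2)).
  assert (Hzh : (Cmod z / 2 <= Cmod (z + h))%R)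
    by (generalize (Cmod_minus_ge z h); lra).
  assert (Hn : z + h <> 0) by (apply Cmod_gt_0; lra).
  replace (/ (z + h) - / z - - / (z * z) * h) with (h * h / (z * z * (z + h)))
    by (field; auto).
  rewrite Cmod_div by (repeat apply Cmult_neq_0; assumption).
  rewrite !Cmod_mult.
  assert (Hh0 := Cmod_ge_0 h).
  apply Rmult_le_reg_r with (Cmod z * Cmod z * Cmod (z + h))%R.
  { repeat apply Rmult_lt_0_compat; lra. }
  unfold Rdiv. rewrite Rmult_assoc, Rinv_l, Rmult_1_r.
  2:{ apply Rgt_not_eq. repeat apply Rmult_lt_0_compat; lra. }
  assert (H1 : (eps * Cmod z ^ 3 / 2 <= eps * (Cmod z * Cmod z * Cmod (z + h)))%R).
  { replace (eps * Cmod z ^ 3 / 2)%R with (eps * (Cmod z * Cmod z * (Cmod z / 2)))%R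
      by (simpl; field).
    apply Rmult_le_compat_l; [lra|]. apply Rmult_le_compat_l; [|exact Hzh].
    apply Rmult_le_pos; lra. }
  replace (eps * Cmod h * (Cmod z * Cmod z * Cmod (z + h)))%R
    with (Cmod h * (eps * (Cmod z * Cmod z * Cmod (z + h))))%R by ring.
  apply Rmult_le_compat_l; [exact Hh0|]. lra.
Qed.

Lemma is_Cderive_div (f g : C -> C) (z lf lg : C) :
  g z <> 0 -> is_Cderive f z lf -> is_Cderive g z lg ->
  is_Cderive (fun x => f x / g x) z ((lf * g z - f z * lg) / (g z * g z)).
Proof.
  intros Hz Hf Hg. unfold Cdiv.
  eapply is_Cderive_eq.
  - apply is_Cderive_mult; [exact Hf|].
    apply (is_Cderive_comp Cinv g); [|exact Hg]. now apply is_Cderive_Cinv.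
  - simpl. field. exact Hz.
Qed.

Lemma is_Cderive_unique (f : C -> C) (z l l' : C) :
  is_Cderive f z l -> is_Cderive f z l' -> l = l'.
Proof.
  intros H H'. rewrite <- (is_C_derive_unique f z l H). now apply is_C_derive_unique.
Qed.

(** * The complex exponential *)

Lemma Cexp_plus (z w : C) : Cexp (z + w) = Cexp z * Cexp w.
Proof.
  unfold Cexp. rewrite re_plus, im_plus, exp_plus, cos_plus, sin_plus.
  unfold Cmult; simpl. f_equal; ring.
Qed.

Lemma Cexp_0 : Cexp 0 = 1.
Proof.
  unfold Cexp. simpl. rewrite exp_0, cos_0, sin_0. unfold RtoC. f_equal; ring.
Qed.

Lemma Cmod_Cexp (z : C) : Cmod (Cexp z) = exp (Re z).
Proof.
  unfold Cexp, Cmod; simpl fst; simpl snd.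
  replace ((exp (Re z) * cos (Im z)) ^ 2 + (exp (Re z) * sin (Im z)) ^ 2)%R
    with (exp (Re z) ^ 2)%R.
  - rewrite sqrt_pow2; [reflexivity|]. left; apply exp_pos.
  - generalize (sin2_cos2 (Im z)). unfold Rsqr. intros H.
    replace (exp (Re z) ^ 2)%R
      with (exp (Re z) ^ 2 * (sin (Im z) * sin (Im z) + cos (Im z) * cos (Im z)))%R
      by (rewrite H; ring). ring.
Qed.

Lemma Cexp_RtoC (r : R) : Cexp (RtoC r) = RtoC (exp r).
Proof.
  unfold Cexp. simpl. rewrite cos_0, sin_0. unfold RtoC. f_equal; ring.
Qed.

Lemma Cmod_le_Re_Im (z : C) : (Cmod z <= Rabs (Re z) + Rabs (Im z))%R.
Proof.
  replace z with (RtoC (Re z) + RtoC (Im z) * Ci) at 1.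
  - eapply Rle_trans; [apply Cmod_triangle|].
    rewrite Cmod_mult, Cmod_Ci, !Cmod_R. lra.
  - unfold Ci, RtoC, Cplus, Cmult, Re, Im; simpl. destruct z; simpl. f_equal; ring.
Qed.

Lemma is_derive_eps_R (f : R -> R) (x l eps : R) :
  is_derive f x l -> (0 < eps)%R -> exists d : R, (0 < d)%R /\
    forall h : R, (Rabs h < d -> Rabs (f (x + h) - f x - l * h) <= eps * Rabs h)%R.
Proof.
  intros [_ H] He. destruct (H x (fun P HP => HP) (mkposreal _ He)) as [d Hd].
  exists d; split; [apply cond_pos|]. intros h Hh.
  specialize (Hd (x + h)%R).
  assert (E : minus (x + h)%R x = h) by (unfold minus, plus, opp; simpl; ring).
  assert (Hb : ball x d (x + h)%R).
  { change (Rabs (minus (x + h)%R x) < d)%R. now rewrite E. }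
  specialize (Hd Hb).
  change (Rabs (f (x + h) - f x - minus (x + h)%R x * l) <= eps * Rabs (minus (x + h)%R x))%R
    in Hd.
  now rewrite E, (Rmult_comm h l) in Hd.
Qed.

(** By the addition formula only the derivative at 0 matters, and there it is read off from the real
    derivatives of [exp], [cos] and [sin]. *)
Lemma is_Cderive_Cexp (z : C) : is_Cderive Cexp z (Cexp z).
Proof.
  assert (H0 : is_Cderive Cexp 0 1).
  { apply is_Cderive_eps; intros eps He.
    (* The estimates [T1] and [T2] of the real and imaginary parts total 9 e |h|; the bound e <= 1
       serves for exp a <= 3. *)
    set (e := Rmin (eps / 10) 1).
    assert (He0 : (0 < e)%R) by (apply Rmin_glb_lt; lra).
    assert (He1 : (e <= eps / 10)%R) by apply Rmin_l.
    assert (He2 : (e <= 1)%R) by apply Rmin_r.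
    destruct (is_derive_eps_R exp 0 1 e) as [d1 [Hd1 H1]]; [|exact He0|].
    { generalize (is_derive_exp 0). now rewrite exp_0. }
    destruct (is_derive_eps_R cos 0 0 e) as [d2 [Hd2 H2]]; [|exact He0|].
    { generalize (is_derive_cos 0). now rewrite sin_0, Ropp_0. }
    destruct (is_derive_eps_R sin 0 1 e) as [d3 [Hd3 H3]]; [|exact He0|].
    { generalize (is_derive_sin 0). now rewrite cos_0. }
    exists (Rmin (Rmin d1 d2) (Rmin d3 e)). split.
    { repeat apply Rmin_glb_lt; lra. }
    intros h Hh.
    assert (A := Rmin_l (Rmin d1 d2) (Rmin d3 e)).
    assert (B := Rmin_r (Rmin d1 d2) (Rmin d3 e)).
    assert (A1 := Rmin_l d1 d2). assert (A2 := Rmin_r d1 d2).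
    assert (B1 := Rmin_l d3 e). assert (B2 := Rmin_r d3 e).
    assert (Ha := re_le_Cmod h). assert (Hb := im_le_Cmod h).
    set (a := Re h) in *. set (b := Im h) in *. set (m := Cmod h) in *.
    specialize (H1 a ltac:(lra)). specialize (H2 b ltac:(lra)). specialize (H3 b ltac:(lra)).
    rewrite Rplus_0_l, exp_0 in H1. rewrite Rplus_0_l, cos_0 in H2.
    rewrite Rplus_0_l, sin_0 in H3.
    rewrite Cplus_0_l, Cexp_0.
    eapply Rle_trans; [apply Cmod_le_Re_Im|].
    replace (Re (Cexp h - 1 - 1 * h))
      with ((exp a - 1 - 1 * a) + exp a * (cos b - 1 - 0 * b))%R
      by (unfold a, b, Cexp, Re, Im; simpl; ring).
    replace (Im (Cexp h - 1 - 1 * h))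
      with (exp a * (sin b - 0 - 1 * b) + (exp a - 1 - 1 * a) * b + a * b)%R
      by (unfold a, b, Cexp, Re, Im; simpl; ring).
    assert (Hm0 : (0 <= m)%R) by apply Cmod_ge_0.
    assert (Ha0 := Rabs_pos a). assert (Hb0 := Rabs_pos b).
    assert (Hea : (0 <= exp a <= 3)%R).
    { split; [left; apply exp_pos|]. eapply Rle_trans; [|apply exp_le_3].
      destruct (Rle_lt_or_eq_dec a 1) as [Hlt|Heq].
      - eapply Rle_trans; [apply Rle_abs|]; lra.
      - left; now apply exp_increasing.
      - right; now rewrite Heq. }
    assert (T1 : (Rabs ((exp a - 1 - 1 * a) + exp a * (cos b - 1 - 0 * b)) <= e * m + 3 * (e * m))%R).
    { eapply Rle_trans; [apply Rabs_triang|]. rewrite Rabs_mult, (Rabs_right (exp a)) by lra.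
      apply Rplus_le_compat.
      - eapply Rle_trans; [exact H1|]. apply Rmult_le_compat_l; lra.
      - apply Rmult_le_compat; try lra; [apply Rabs_pos|].
        eapply Rle_trans; [exact H2|]. apply Rmult_le_compat_l; lra. }
    assert (T2 : (Rabs (exp a * (sin b - 0 - 1 * b) + (exp a - 1 - 1 * a) * b + a * b) <=
                  3 * (e * m) + e * m + e * m)%R).
    { eapply Rle_trans; [apply Rabs_triang|].
      eapply Rle_trans; [apply Rplus_le_compat_r, Rabs_triang|].
      rewrite !Rabs_mult, (Rabs_right (exp a)) by lra.
      apply Rplus_le_compat; [apply Rplus_le_compat|].
      - apply Rmult_le_compat; try lra; [apply Rabs_pos|].
        eapply Rle_trans; [exact H3|]. apply Rmult_le_compat_l; lra.
      - assert (Rabs (exp a - 1 - 1 * a) <= 1)%R.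
        { eapply Rle_trans; [exact H1|]. nra. }
        assert (Rabs (exp a - 1 - 1 * a) <= e)%R by nra.
        apply Rmult_le_compat; try lra; apply Rabs_pos.
      - apply Rmult_le_compat; lra. }
    assert (e * m <= eps / 10 * m)%R by (apply Rmult_le_compat_r; lra).
    assert (0 <= eps * m)%R by (apply Rmult_le_pos; lra).
    lra. }
  apply (is_Cderive_local (fun w => Cexp z * Cexp (w - z)) Cexp z _ 1 Rlt_0_1).
  { intros h _. rewrite <- Cexp_plus. f_equal. ring. }
  eapply is_Cderive_eq.
  - apply is_Cderive_mult; [apply is_Cderive_const|].
    apply (is_Cderive_comp Cexp (fun w => w - z)).
    + replace (z - z) with (RtoC 0) by ring. exact H0.
    + apply is_Cderive_minus; [apply is_Cderive_id|apply is_Cderive_const].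
  - simpl. ring.
Qed.

(** Differentiation by syntax: nonvanishing denominators are left as side goals, and atoms are
    closed by derivatives present in the context. The derivative found is not simplified, hence its
    use below [is_Cderive_eq] with an unknown value. *)
Ltac Cderive_rules :=
  lazymatch goal with
  | |- is_Cderive (fun x => x) _ _ => apply is_Cderive_id
  | |- is_Cderive (fun _ => ?c) _ _ => apply is_Cderive_const
  | |- is_Cderive (fun x => @?f x + @?g x) _ _ => apply (is_Cderive_plus f g); Cderive_rules
  | |- is_Cderive (fun x => @?f x - @?g x) _ _ => apply (is_Cderive_minus f g); Cderive_rules
  | |- is_Cderive (fun x => - @?f x) _ _ => apply (is_Cderive_opp f); Cderive_rules
  | |- is_Cderive (fun x => @?f x * @?g x) _ _ => apply (is_Cderive_mult f g); Cderive_rules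
  | |- is_Cderive (fun x => @?f x / @?g x) _ _ =>
      apply (is_Cderive_div f g); [ | Cderive_rules | Cderive_rules]
  | |- is_Cderive (fun x => Cexp (@?f x)) _ _ =>
      apply (is_Cderive_comp Cexp f); [apply is_Cderive_Cexp | Cderive_rules]
  | |- _ => try eassumption
  end.

(** Brings the real mean value theorem to holomorphic functions: the constancy and growth arguments
    below run along straight lines. *)
Lemma is_derive_Re_line (f : C -> C) (a b l : C) (t : R) :
  is_Cderive f (a + RtoC t * b) l ->
  is_derive (fun s : R => Re (f (a + RtoC s * b))) t (Re (l * b)) /\
  is_derive (fun s : R => Im (f (a + RtoC s * b))) t (Im (l * b)).
Proof.
  intros H.
  assert (Hb := Cmod_ge_0 b).
  assert (K : forall eps : R, (0 < eps)%R -> exists d : posreal, forall h : R, h <> 0%R ->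
    (Rabs h < d)%R -> (Cmod (f (a + RtoC (t + h) * b)%C - f (a + RtoC t * b)%C -
                             RtoC h * (l * b)) < eps * Rabs h)%R).
  { intros eps He.
    destruct (proj1 (is_Cderive_eps _ _ _) H (eps / (2 * (Cmod b + 1)))%R) as [d [Hd Hf]].
    { apply Rdiv_lt_0_compat; lra. }
    assert (Hd' : (0 < d / (Cmod b + 1))%R) by (apply Rdiv_lt_0_compat; lra).
    exists (mkposreal _ Hd'). intros h Hh0 Hh. simpl in Hh.
    assert (Hhp := Rabs_pos_lt h Hh0).
    specialize (Hf (RtoC h * b)).
    rewrite Cmod_mult, Cmod_R in Hf.
    replace (a + RtoC t * b + RtoC h * b) with (a + RtoC (t + h) * b) in Hf
      by (rewrite RtoC_plus; ring).
    replace (l * (RtoC h * b)) with (RtoC h * (l * b)) in Hf by ring.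
    eapply Rle_lt_trans; [apply Hf|].
    - apply Rle_lt_trans with (Rabs h * (Cmod b + 1))%R.
      + apply Rmult_le_compat_l; lra.
      + apply Rmult_lt_reg_r with (/ (Cmod b + 1))%R; [apply Rinv_0_lt_compat; lra|].
        replace (Rabs h * (Cmod b + 1) * / (Cmod b + 1))%R with (Rabs h) by (field; lra).
        exact Hh.
    - replace (eps * Rabs h)%R
        with (eps / (2 * (Cmod b + 1)) * (Rabs h * (2 * (Cmod b + 1))))%R by (field; lra).
      apply Rmult_lt_compat_l; [apply Rdiv_lt_0_compat; lra|].
      apply Rmult_lt_compat_l; lra. }
  split; apply is_derive_Reals; intros eps He; destruct (K eps He) as [d Hd];
    exists d; intros h Hh0 Hh; specialize (Hd h Hh0 Hh);
    assert (Hhp := Rabs_pos_lt h Hh0).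
  - apply Rmult_lt_reg_r with (Rabs h); [exact Hhp|].
    rewrite <- Rabs_mult. eapply Rle_lt_trans; [|exact Hd].
    eapply Rle_trans; [|apply re_le_Cmod]. right. f_equal.
    set (X := f (a + RtoC (t + h) * b)). set (Y := f (a + RtoC t * b)). set (Z := l * b).
    clearbody X Y Z. destruct X, Y, Z. simpl. field. exact Hh0.
  - apply Rmult_lt_reg_r with (Rabs h); [exact Hhp|].
    rewrite <- Rabs_mult. eapply Rle_lt_trans; [|exact Hd].
    eapply Rle_trans; [|apply im_le_Cmod]. right. f_equal.
    set (X := f (a + RtoC (t + h) * b)). set (Y := f (a + RtoC t * b)). set (Z := l * b).
    clearbody X Y Z. destruct X, Y, Z. simpl. field. exact Hh0.
Qed.

Lemma C_ext (z w : C) : Re z = Re w -> Im z = Im w -> z = w.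
Proof. destruct z, w; simpl. now intros -> ->. Qed.

Lemma is_derive_0_eq (f : R -> R) (a b : R) :
  (a <= b)%R -> (forall t, (a <= t <= b)%R -> is_derive f t 0) -> f a = f b.
Proof.
  intros Hab H.
  destruct (MVT_gen f a b (fun _ => 0%R)) as [c [_ Hc]].
  - intros t Ht. rewrite Rmin_left, Rmax_right in Ht by exact Hab. apply H; lra.
  - intros t Ht. rewrite Rmin_left, Rmax_right in Ht by exact Hab.
    apply derivable_continuous_pt. exists 0%R. apply is_derive_Reals, H; lra.
  - lra.
Qed.

(** Stands in for connectedness. The domains below are star-shaped about the base point in use, so
    constancy of a Wronskian or a similar invariant needs only the segment to that point. *)
Lemma Cderive_0_segment (f : C -> C) (a b : C) :
  (forall t : R, (0 <= t <= 1)%R -> is_Cderive f (a + RtoC t * b) 0) -> f (a + b) = f a.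
Proof.
  intros H.
  replace (f (a + b)) with (f (a + RtoC 1 * b)) by (f_equal; ring).
  replace (f a) with (f (a + RtoC 0 * b)) by (f_equal; ring).
  apply C_ext; symmetry.
  - apply (is_derive_0_eq (fun s => Re (f (a + RtoC s * b)))); [lra|].
    intros t Ht. replace 0%R with (Re (0 * b)) by (simpl; ring).
    now apply is_derive_Re_line, H.
  - apply (is_derive_0_eq (fun s => Im (f (a + RtoC s * b)))); [lra|].
    intros t Ht. replace 0%R with (Im (0 * b)) by (simpl; ring).
    now apply is_derive_Re_line, H.
Qed.

(** * Products, uniqueness of coefficients, analytic functions *)

Lemma is_Cseries_plus (u v : nat -> C) (l m : C) :
  is_Cseries u l -> is_Cseries v m -> is_Cseries (fun n => u n + v n) (l + m).
Proof. intros Hu Hv. exact (is_series_plus u v l m Hu Hv). Qed.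

Lemma is_Cseries_scal (c : C) (u : nat -> C) (l : C) :
  is_Cseries u l -> is_Cseries (fun n => c * u n) (c * l).
Proof. intros Hu. exact (is_series_scal_l c u l Hu). Qed.

Lemma is_Cseries_ext (u v : nat -> C) (l : C) :
  (forall n, u n = v n) -> is_Cseries u l -> is_Cseries v l.
Proof. apply is_series_ext. Qed.

Lemma is_Cseries_cons (u : nat -> C) (l m : C) :
  is_Cseries (fun n => u (S n)) m -> l = u 0%nat + m -> is_Cseries u l.
Proof.
  intros H ->. apply is_series_decr_1.
  match goal with |- is_series _ ?l => replace l with m; [exact H|] end.
  unfold plus, opp; simpl. ring.
Qed.

Lemma CPS_ext (a b : nat -> C) (z : C) : (forall n, a n = b n) -> CPS a z = CPS b z.
Proof.
  intros H. unfold CPS, Csum. f_equal; apply Series_ext; intros n; now rewrite H.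
Qed.

Lemma conv_disc_ext (a b : nat -> C) (rho : R) :
  (forall n, a n = b n) -> conv_disc a rho -> conv_disc b rho.
Proof.
  intros H. apply conv_disc_le. intros n. rewrite H. lra.
Qed.

Lemma conv_disc_radius_le (a : nat -> C) (rho rho' : R) :
  (rho' <= rho)%R -> conv_disc a rho -> conv_disc a rho'.
Proof. intros H Ha r Hr. apply Ha. lra. Qed.

Lemma conv_disc_plus (a b : nat -> C) (rho : R) :
  conv_disc a rho -> conv_disc b rho -> conv_disc (fun n => a n + b n) rho.
Proof.
  intros Ha Hb r Hr.
  apply (@ex_series_le R_AbsRing R_CompleteNormedModule _
           (fun n => Cmod (a n) * r ^ n + Cmod (b n) * r ^ n)%R).
  - intros n. change (Rabs (Cmod (a n + b n)%C * r ^ n) <=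
                      Cmod (a n) * r ^ n + Cmod (b n) * r ^ n)%R.
    assert (0 <= r ^ n)%R by (apply pow_le; lra).
    rewrite Rabs_right by (apply Rle_ge, Rmult_le_pos; [apply Cmod_ge_0|assumption]).
    rewrite <- Rmult_plus_distr_r. apply Rmult_le_compat_r; [assumption|apply Cmod_triangle].
  - exact (ex_series_plus _ _ (Ha r Hr) (Hb r Hr)).
Qed.

Lemma conv_disc_scal (c : C) (a : nat -> C) (rho : R) :
  conv_disc a rho -> conv_disc (fun n => c * a n) rho.
Proof.
  intros Ha r Hr. apply ex_series_ext with (fun n => Cmod c * (Cmod (a n) * r ^ n))%R.
  - intros n. rewrite Cmod_mult. simpl. ring.
  - apply (ex_series_scal_l (Cmod c) (fun n => Cmod (a n) * r ^ n)%R), (Ha r Hr).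
Qed.

Lemma CPS_plus (a b : nat -> C) (rho : R) (z : C) :
  conv_disc a rho -> conv_disc b rho -> (Cmod z < rho)%R ->
  CPS (fun n => a n + b n) z = CPS a z + CPS b z.
Proof.
  intros Ha Hb Hz. apply CPS_unique.
  apply is_Cseries_ext with (fun n => a n * z ^ n + b n * z ^ n); [intros n; ring|].
  apply is_Cseries_plus; now apply (CPS_correct _ rho).
Qed.

Lemma CPS_scal (c : C) (a : nat -> C) (rho : R) (z : C) :
  conv_disc a rho -> (Cmod z < rho)%R -> CPS (fun n => c * a n) z = c * CPS a z.
Proof.
  intros Ha Hz. apply CPS_unique.
  apply is_Cseries_ext with (fun n => c * (a n * z ^ n)); [intros n; ring|].
  apply is_Cseries_scal; now apply (CPS_correct _ rho).
Qed.

Lemma CPS_shift (a : nat -> C) (rho : R) (z : C) :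
  conv_disc a rho -> (Cmod z < rho)%R -> CPS a z = a 0%nat + z * CPS (shift_coeff a) z.
Proof.
  intros Ha Hz. apply CPS_unique.
  apply (is_Cseries_cons _ _ (z * CPS (shift_coeff a) z)); [|simpl; ring].
  apply is_Cseries_ext with (fun n => z * (shift_coeff a n * z ^ n)).
  - intros n. unfold shift_coeff. rewrite Cpow_S. ring.
  - apply is_Cseries_scal, (CPS_correct _ rho); [now apply conv_disc_shift|exact Hz].
Qed.

Lemma is_Cseries_zero : is_Cseries (fun _ => RtoC 0) (RtoC 0).
Proof.
  apply is_Cseries_Re_Im. split; simpl;
    (apply filterlim_ext with (fun _ => 0%R); [|apply filterlim_const];
     intros n; induction n as [|n IH];
     [now rewrite sum_O|rewrite sum_Sn, <- IH; unfold plus; simpl; ring]).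
Qed.

Lemma CPS_at_0 (a : nat -> C) : CPS a 0 = a 0%nat.
Proof.
  apply CPS_unique.
  apply (is_Cseries_cons _ _ 0); [|simpl; ring].
  apply is_Cseries_ext with (fun _ => RtoC 0); [|apply is_Cseries_zero].
  intros n. rewrite Cpow_S. ring.
Qed.

Definition incr_coeff (a : nat -> C) (n : nat) : C :=
  match n with O => 0 | S k => a k end.

Lemma conv_disc_incr (a : nat -> C) (rho : R) :
  conv_disc a rho -> conv_disc (incr_coeff a) rho.
Proof.
  intros Ha r Hr. apply ex_series_incr_1.
  apply ex_series_ext with (fun n => r * (Cmod (a n) * r ^ n))%R.
  - intros n. simpl. ring.
  - apply (ex_series_scal_l r (fun n => Cmod (a n) * r ^ n)%R), (Ha r Hr).
Qed.

Lemma CPS_incr (a : nat -> C) (rho : R) (z : C) :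
  conv_disc a rho -> (Cmod z < rho)%R -> CPS (incr_coeff a) z = z * CPS a z.
Proof.
  intros Ha Hz. rewrite (CPS_shift _ rho z (conv_disc_incr _ _ Ha) Hz).
  simpl. rewrite Cplus_0_l. f_equal.
Qed.

Definition Cconv (u v : nat -> C) (n : nat) : C :=
  @sum_n C_AbelianMonoid (fun k => u k * v (n - k)%nat) n.

(** Real and imaginary parts reduce the sum to four real Cauchy products; absolute convergence comes
    from the Cauchy product of the series of moduli. *)
Lemma Cseries_mult (u v : nat -> C) :
  ex_series (fun n => Cmod (u n)) -> ex_series (fun n => Cmod (v n)) ->
  is_Cseries (Cconv u v) (Csum u * Csum v) /\ ex_series (fun n => Cmod (Cconv u v n)).
Proof.
  intros Hu Hv. split.
  - assert (HuR := ex_series_Re u Hu). assert (HuI := ex_series_Im u Hu).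
    assert (HvR := ex_series_Re v Hv). assert (HvI := ex_series_Im v Hv).
    assert (P : forall a b : nat -> R,
      ex_series (fun n => Rabs (a n)) -> ex_series (fun n => Rabs (b n)) ->
      is_series (fun n => sum_n (fun k => a k * b (n - k)%nat)%R n) (Series a * Series b)%R).
    { intros a b Ha Hb.
      apply is_series_ext with (fun n => sum_f_R0 (fun k => a k * b (n - k)%nat)%R n).
      - intros n. symmetry. apply sum_n_Reals.
      - apply is_series_mult; try assumption; now apply Series_correct, ex_series_Rabs. }
    apply is_Cseries_Re_Im; split.
    + generalize (is_series_minus _ _ _ _ (P _ _ HuR HvR) (P _ _ HuI HvI)).
      apply is_series_ext. intros n. unfold Cconv. rewrite Re_sum_n.
      change (plus ?x (opp ?y)) with (minus x y).
      symmetry. transitivity (sum_n (fun k => minus (Re (u k) * Re (v (n - k)%nat))%R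
        (Im (u k) * Im (v (n - k)%nat))%R) n).
      * apply sum_n_ext. intros k. reflexivity.
      * unfold minus. rewrite sum_n_plus. f_equal.
        rewrite <- (sum_n_ext (fun k => mult (-1)%R (Im (u k) * Im (v (n - k)%nat))%R)).
        -- rewrite sum_n_mult_l.
           match goal with |- mult _ ?s = _ => change (-1 * (s : R) = - (s : R))%R end. ring.
        -- intros k. unfold mult, opp; simpl. ring.
    + generalize (is_series_plus _ _ _ _ (P _ _ HuR HvI) (P _ _ HuI HvR)).
      apply is_series_ext. intros n. unfold Cconv. rewrite Im_sum_n.
      symmetry. rewrite <- sum_n_plus. apply sum_n_ext. intros k. reflexivity.
  - destruct Hu as [lu Hu]. destruct Hv as [lv Hv].
    apply (@ex_series_le R_AbsRing R_CompleteNormedModule _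
      (fun n => sum_f_R0 (fun k => Cmod (u k) * Cmod (v (n - k)%nat))%R n)).
    + intros n. change (Rabs (Cmod (Cconv u v n)) <=
        sum_f_R0 (fun k => Cmod (u k) * Cmod (v (n - k)%nat)) n)%R.
      rewrite Rabs_right by (apply Rle_ge, Cmod_ge_0). rewrite <- sum_n_Reals.
      unfold Cconv. eapply Rle_trans; [apply Cmod_sum_n_le|]. right.
      apply sum_n_ext. intros k. apply Cmod_mult.
    + exists (lu * lv)%R. apply (is_series_mult_pos (fun n => Cmod (u n)) (fun n => Cmod (v n)));
        try assumption; intros; apply Cmod_ge_0.
Qed.

Lemma Cconv_pow (a b : nat -> C) (z : C) (n : nat) :
  Cconv (fun k => a k * z ^ k) (fun k => b k * z ^ k) n = Cconv a b n * z ^ n.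
Proof.
  unfold Cconv. transitivity (@sum_n C_AbelianMonoid
    (fun k => @mult C_Ring (a k * b (n - k)%nat) (z ^ n)) n).
  - apply sum_n_ext_loc. intros k Hk.
    replace (z ^ n) with (z ^ k * z ^ (n - k)).
    + unfold mult; simpl. ring.
    + rewrite <- Cpow_add_r. f_equal. lia.
  - rewrite (@sum_n_mult_r C_Ring). reflexivity.
Qed.

Lemma conv_disc_mult (a b : nat -> C) (rho : R) :
  conv_disc a rho -> conv_disc b rho -> conv_disc (Cconv a b) rho.
Proof.
  intros Ha Hb r Hr.
  apply ex_series_ext with
    (fun n => Cmod (Cconv (fun k => a k * RtoC r ^ k) (fun k => b k * RtoC r ^ k) n)).
  - intros n. rewrite Cconv_pow, Cmod_mult, Cmod_pow, Cmod_R, Rabs_right by lra. reflexivity.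
  - apply Cseries_mult.
    + apply ex_series_ext with (fun n => Cmod (a n) * r ^ n)%R; [|now apply Ha].
      intros n. rewrite Cmod_mult, Cmod_pow, Cmod_R, Rabs_right by lra. reflexivity.
    + apply ex_series_ext with (fun n => Cmod (b n) * r ^ n)%R; [|now apply Hb].
      intros n. rewrite Cmod_mult, Cmod_pow, Cmod_R, Rabs_right by lra. reflexivity.
Qed.

Lemma CPS_mult (a b : nat -> C) (rho : R) (z : C) :
  conv_disc a rho -> conv_disc b rho -> (Cmod z < rho)%R ->
  CPS (Cconv a b) z = CPS a z * CPS b z.
Proof.
  intros Ha Hb Hz. apply CPS_unique.
  apply is_Cseries_ext with (Cconv (fun k => a k * z ^ k) (fun k => b k * z ^ k)).
  - intros n. apply Cconv_pow.
  - assert (Hz0 := Cmod_ge_0 z). apply Cseries_mult.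
    + apply ex_series_ext with (fun n => Cmod (a n) * Cmod z ^ n)%R; [|now apply Ha].
      intros n. now rewrite Cmod_mult, Cmod_pow.
    + apply ex_series_ext with (fun n => Cmod (b n) * Cmod z ^ n)%R; [|now apply Hb].
      intros n. now rewrite Cmod_mult, Cmod_pow.
Qed.

Lemma CPS_zero_coeff_0 (a : nat -> C) (rho : R) (w : C) (d : R) :
  (0 < rho)%R -> conv_disc a rho -> w <> 0 -> (0 < d)%R -> (d * Cmod w <= rho)%R ->
  (forall s : R, (0 < s < d)%R -> CPS a (RtoC s * w) = 0) -> a 0%nat = 0.
Proof.
  intros Hrho Ha Hw Hd Hdw H.
  assert (Hw0 : (0 < Cmod w)%R) by now apply Cmod_gt_0.
  apply Cmod_eq_0. apply Rle_antisym; [|apply Cmod_ge_0]. apply Rnot_lt_le; intros Hlt.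
    assert (D := CPS_derive a rho 0 Ha ltac:(rewrite Cmod_0; lra)).
    destruct (is_Cderive_lipschitz _ _ _ D) as [d1 [Hd1 H1]].
    set (K := (Cmod (CPS (deriv_coeff a) 0) + 1)%R) in *.
    assert (HK : (0 < K)%R) by (unfold K; generalize (Cmod_ge_0 (CPS (deriv_coeff a) 0)); lra).
    (* So small that the Lipschitz bound K |s w| at 0 is at most half of |a_0|, although the series
       vanishes at s w. *)
    set (s := (Rmin (d / 2) (Rmin (d1 / (2 * Cmod w)) (Cmod (a 0%nat) / (2 * K * Cmod w))))%R).
    assert (Hs : (0 < s)%R).
    { unfold s. repeat apply Rmin_glb_lt; [lra| |].
      - apply Rdiv_lt_0_compat; lra.
      - apply Rdiv_lt_0_compat; [lra|]. repeat apply Rmult_lt_0_compat; lra. }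
    assert (Hs1 : (s <= d / 2)%R) by apply Rmin_l.
    assert (Hs2 : (s <= d1 / (2 * Cmod w))%R)
      by (eapply Rle_trans; [apply Rmin_r|apply Rmin_l]).
    assert (Hs3 : (s <= Cmod (a 0%nat) / (2 * K * Cmod w))%R)
      by (eapply Rle_trans; [apply Rmin_r|apply Rmin_r]).
    assert (Hsw : Cmod (RtoC s * w) = (s * Cmod w)%R)
      by (rewrite Cmod_mult, Cmod_R, Rabs_right; lra).
    specialize (H1 (RtoC s * w)). rewrite Cplus_0_l, Hsw, (H s), CPS_at_0 in H1 by lra.
    replace (0 - a 0%nat) with (- a 0%nat) in H1 by ring. rewrite Cmod_opp in H1.
    apply Rmult_le_compat_r with (r := Cmod w) in Hs2; [|lra].
    apply Rmult_le_compat_r with (r := (K * Cmod w)%R) in Hs3; [|apply Rmult_le_pos; lra].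
    replace (d1 / (2 * Cmod w) * Cmod w)%R with (d1 / 2)%R in Hs2 by (field; lra).
    replace (Cmod (a 0%nat) / (2 * K * Cmod w) * (K * Cmod w))%R with (Cmod (a 0%nat) / 2)%R
      in Hs3 by (field; lra).
    specialize (H1 ltac:(lra)). lra.
Qed.

(** Zeros on one ray segment suffice: once a_0 vanishes, the nonzero factor s w divides out and
    leaves the shifted series with the same zeros. *)
Lemma CPS_zero_coeffs (a : nat -> C) (rho : R) (w : C) (d : R) :
  (0 < rho)%R -> conv_disc a rho -> w <> 0 -> (0 < d)%R -> (d * Cmod w <= rho)%R ->
  (forall s : R, (0 < s < d)%R -> CPS a (RtoC s * w) = 0) -> forall n, a n = 0.
Proof.
  intros Hrho Ha Hw Hd Hdw H n. revert a Ha H. induction n as [|n IH]; intros a Ha H;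
    assert (H0 := CPS_zero_coeff_0 a rho w d Hrho Ha Hw Hd Hdw H); [exact H0|].
    apply (IH (shift_coeff a)); [now apply conv_disc_shift|].
    intros s Hs. assert (Hsw : (Cmod (RtoC s * w) < rho)%R).
    { rewrite Cmod_mult, Cmod_R, Rabs_right by lra.
      apply Rlt_le_trans with (d * Cmod w)%R; [|exact Hdw].
      apply Rmult_lt_compat_r; [now apply Cmod_gt_0|lra]. }
    specialize (H s Hs). rewrite (CPS_shift a rho _ Ha Hsw), H0, Cplus_0_l in H.
    destruct (Ceq_dec (CPS (shift_coeff a) (RtoC s * w)) 0) as [E|E]; [exact E|exfalso].
    revert H. apply Cmult_neq_0; [|exact E]. apply Cmult_neq_0; [|exact Hw].
    intros F. apply RtoC_inj in F. lra.
Qed.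

(** * Analytic functions *)

Lemma analytic_atP (f : C -> C) (w : C) :
  analytic_at f w <-> exists (a : nat -> C) (r : R), (0 < r)%R /\ conv_disc a r /\
    forall h : C, (Cmod h < r)%R -> f (w + h) = CPS a h.
Proof.
  split.
  - intros [a [r [Hr H]]]. exists a, r. split; [exact Hr|]. split.
    + apply conv_disc_of_pointwise. intros z Hz. exists (f (w + z)).
      exact (proj1 (is_pseries_C _ _ _) (H z Hz)).
    + intros h Hh. symmetry. exact (CPS_unique _ _ _ (proj1 (is_pseries_C _ _ _) (H h Hh))).
  - intros [a [r [Hr [Ha H]]]]. exists a, r. split; [exact Hr|]. intros h Hh.
    apply is_pseries_C. rewrite (H h Hh). now apply (CPS_correct a r).
Qed.

Lemma is_Cderive_translate (f : C -> C) (w z l : C) :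
  is_Cderive (fun x => f (w + x)) z l -> is_Cderive f (w + z) l.
Proof.
  intros H. apply is_Cderive_eps; intros eps He.
  destruct (proj1 (is_Cderive_eps _ _ _) H eps He) as [d [Hd Hf]].
  exists d; split; [exact Hd|]. intros h Hh. specialize (Hf h Hh). simpl in Hf.
  now rewrite Cplus_assoc in Hf.
Qed.

Lemma CPS_is_Cderive_of_eq (f : C -> C) (w : C) (a : nat -> C) (r : R) (h : C) :
  conv_disc a r -> (forall k, (Cmod k < r)%R -> f (w + k) = CPS a k) -> (Cmod h < r)%R ->
  is_Cderive f (w + h) (CPS (deriv_coeff a) h).
Proof.
  intros Ha Hf Hh. apply is_Cderive_translate.
  apply (is_Cderive_local (CPS a) _ h _ (r - Cmod h)); [lra| |now apply (CPS_derive a r)].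
  intros k Hk. symmetry. apply Hf. generalize (Cmod_triangle h k). lra.
Qed.

Lemma analytic_is_Cderive (f : C -> C) (w : C) :
  analytic_at f w -> is_Cderive f w (C_derive f w).
Proof.
  intros H. apply analytic_atP in H. destruct H as [a [r [Hr [Ha Hf]]]].
  assert (D := CPS_is_Cderive_of_eq f w a r 0 Ha Hf ltac:(rewrite Cmod_0; exact Hr)).
  rewrite Cplus_0_r in D. rewrite (is_C_derive_unique f w _ D). exact D.
Qed.

Lemma analytic_C_derive (f : C -> C) (w : C) :
  analytic_at f w -> analytic_at (C_derive f) w.
Proof.
  intros H. apply analytic_atP in H. destruct H as [a [r [Hr [Ha Hf]]]].
  apply analytic_atP. exists (deriv_coeff a), r. split; [exact Hr|].
  split; [now apply conv_disc_deriv|]. intros h Hh.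
  apply is_C_derive_unique. now apply (CPS_is_Cderive_of_eq f w a r h).
Qed.

Lemma analytic_plus (f g : C -> C) (w : C) :
  analytic_at f w -> analytic_at g w -> analytic_at (fun z => f z + g z) w.
Proof.
  intros Hf Hg. apply analytic_atP in Hf, Hg.
  destruct Hf as [a [r [Hr [Ha Hf]]]]. destruct Hg as [b [s [Hs [Hb Hg]]]].
  apply analytic_atP. exists (fun n => a n + b n), (Rmin r s).
  assert (Ha' := conv_disc_radius_le a r (Rmin r s) (Rmin_l r s) Ha).
  assert (Hb' := conv_disc_radius_le b s (Rmin r s) (Rmin_r r s) Hb).
  split; [now apply Rmin_glb_lt|]. split; [now apply conv_disc_plus|]. intros h Hh.
  rewrite (CPS_plus a b (Rmin r s)) by assumption.
  rewrite Hf, Hg; [reflexivity| |]; eapply Rlt_le_trans; try exact Hh;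
    [apply Rmin_r|apply Rmin_l].
Qed.

Lemma analytic_mult (f g : C -> C) (w : C) :
  analytic_at f w -> analytic_at g w -> analytic_at (fun z => f z * g z) w.
Proof.
  intros Hf Hg. apply analytic_atP in Hf, Hg.
  destruct Hf as [a [r [Hr [Ha Hf]]]]. destruct Hg as [b [s [Hs [Hb Hg]]]].
  apply analytic_atP. exists (Cconv a b), (Rmin r s).
  assert (Ha' := conv_disc_radius_le a r (Rmin r s) (Rmin_l r s) Ha).
  assert (Hb' := conv_disc_radius_le b s (Rmin r s) (Rmin_r r s) Hb).
  split; [now apply Rmin_glb_lt|]. split; [now apply conv_disc_mult|]. intros h Hh.
  rewrite (CPS_mult a b (Rmin r s)) by assumption.
  rewrite Hf, Hg; [reflexivity| |]; eapply Rlt_le_trans; try exact Hh;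
    [apply Rmin_r|apply Rmin_l].
Qed.

Lemma analytic_const (c w : C) : analytic_at (fun _ => c) w.
Proof.
  exists (fun n => match n with O => c | S _ => 0 end), 1%R. split; [lra|]. intros h _.
  apply is_pseries_C. apply (is_Cseries_cons _ _ 0); [|simpl; ring].
  apply is_Cseries_ext with (fun _ => RtoC 0); [|apply is_Cseries_zero].
  intros n. ring.
Qed.

Lemma analytic_id (w : C) : analytic_at (fun z => z) w.
Proof.
  exists (fun n => match n with O => w | S O => 1 | _ => 0 end), 1%R.
  split; [lra|]. intros h _. apply is_pseries_C.
  apply (is_Cseries_cons _ _ h); [|simpl; ring].
  apply (is_Cseries_cons _ _ 0); [|simpl; ring].
  apply is_Cseries_ext with (fun _ => RtoC 0); [|apply is_Cseries_zero].
  intros n. ring.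
Qed.

(* Isolated zeros, propagated from the left end of a segment by a supremum argument. *)
Lemma analytic_segment_eq_0 (f : C -> C) (b w : C) (d : R) :
  (forall t : R, (0 <= t <= 1)%R -> analytic_at f (b + RtoC t * w)) ->
  (0 < d)%R -> (forall t : R, (0 <= t < d)%R -> f (b + RtoC t * w) = 0) ->
  f (b + w) = 0.
Proof.
  intros Han Hd H0.
  destruct (Ceq_dec w 0) as [->|Hw].
  { replace (b + 0) with (b + RtoC 0 * 0) by ring. apply H0; lra. }
  assert (Hw0 : (0 < Cmod w)%R) by now apply Cmod_gt_0.
  set (E := fun t : R => (0 <= t <= 1)%R /\
              forall s : R, (0 <= s <= t)%R -> f (b + RtoC s * w) = 0).
  destruct (completeness E) as [T [HT1 HT2]].
  { exists 1%R. intros t [Ht _]. lra. }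
  { exists 0%R. split; [lra|]. intros s Hs. apply H0; lra. }
  set (d' := Rmin (d / 2) 1).
  assert (Hd' : (0 < d' /\ d' < d /\ d' <= 1)%R).
  { unfold d'. generalize (Rmin_l (d / 2) 1) (Rmin_r (d / 2) 1)
      (Rmin_glb_lt (d / 2) 1 0 ltac:(lra) ltac:(lra)). lra. }
  assert (HTd : (d' <= T)%R).
  { apply HT1. split; [lra|]. intros s Hs. apply H0; lra. }
  assert (HT : (T <= 1)%R) by (apply HT2; intros t [Ht _]; lra).
  assert (Hlt : forall s : R, (0 <= s < T)%R -> f (b + RtoC s * w) = 0).
  { intros s Hs. destruct (Classical_Prop.classic (exists t, E t /\ (s < t)%R)) as [[t [[_ Ht] Hst]]|Hn].
    - apply Ht; lra.
    - exfalso. assert (HTs : (T <= s)%R); [|lra].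
      apply HT2. intros t Ht. apply Rnot_lt_le; intros Hst. apply Hn. now exists t. }
  destruct (proj1 (analytic_atP _ _) (Han T ltac:(lra))) as [a [r [Hr [Ha Hf]]]].
  (* The zeros known so far lie behind T, so the Taylor series at T is tested on the ray in
     direction - w. *)
  assert (Hz : forall n, a n = 0).
  { apply (CPS_zero_coeffs a r (- w) (Rmin T (r / Cmod w))); try assumption.
    - intros F. apply Hw. replace w with (- - w) by ring. rewrite F. ring.
    - apply Rmin_glb_lt; [lra|]. apply Rdiv_lt_0_compat; lra.
    - rewrite Cmod_opp. replace r with (r / Cmod w * Cmod w)%R at 2 by (field; lra).
      apply Rmult_le_compat_r; [lra|apply Rmin_r].
    - intros s Hs.
      assert (Hs1 := Rmin_l T (r / Cmod w)). assert (Hs2 := Rmin_r T (r / Cmod w)).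
      rewrite <- Hf.
      + replace (b + RtoC T * w + RtoC s * - w) with (b + RtoC (T - s) * w)
          by (rewrite RtoC_minus; ring).
        apply Hlt; lra.
      + rewrite Cmod_mult, Cmod_opp, Cmod_R, Rabs_right by lra.
        replace r with (r / Cmod w * Cmod w)%R by (field; lra).
        apply Rmult_lt_compat_r; lra. }
  assert (Hnear : forall h, (Cmod h < r)%R -> f (b + RtoC T * w + h) = 0).
  { intros h Hh. rewrite (Hf h Hh). apply CPS_unique.
    apply is_Cseries_ext with (fun _ => RtoC 0); [|apply is_Cseries_zero].
    intros n. rewrite Hz. ring. }
  (* If T < 1, the disc around T on which f vanishes reaches past T and contradicts the supremum. *)
  destruct (Rle_lt_or_eq_dec T 1 HT) as [HT'|HT'].
  - exfalso.
    set (u := (Rmin 1 (T + r / (2 * Cmod w)))%R).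
    assert (Hrw : (0 < r / (2 * Cmod w))%R) by (apply Rdiv_lt_0_compat; lra).
    assert (Hu1 : (u <= 1)%R) by apply Rmin_l.
    assert (Hu2 : (u <= T + r / (2 * Cmod w))%R) by apply Rmin_r.
    assert (Hu3 : (T < u)%R) by (apply Rmin_glb_lt; lra).
    assert (Eu : E u); [|specialize (HT1 u Eu); lra].
    split; [lra|]. intros s Hs. destruct (Rlt_le_dec s T) as [Hs'|Hs']; [apply Hlt; lra|].
    replace (b + RtoC s * w) with (b + RtoC T * w + RtoC (s - T) * w)
      by (rewrite RtoC_minus; ring).
    apply Hnear. rewrite Cmod_mult, Cmod_R, Rabs_right by lra.
    replace r with (r / Cmod w * Cmod w)%R by (field; lra).
    apply Rmult_lt_compat_r; [lra|].
    replace (r / Cmod w)%R with (r / (2 * Cmod w) + r / (2 * Cmod w))%R by (field; lra). lra.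
  - replace (b + w) with (b + RtoC T * w + 0) by (rewrite HT'; ring).
    apply Hnear. rewrite Cmod_0. exact Hr.
Qed.

(** * The hypergeometric function and its differential equation *)

(* Taylor coefficients of [(1 - x) ^ (-1/2)]. *)
Fixpoint beta (n : nat) : R :=
  match n with
  | O => 1%R
  | S k => (beta k * ((INR k + / 2) / (INR k + 1)))%R
  end.

Lemma beta_pos (n : nat) : (0 < beta n)%R.
Proof.
  induction n as [|n IH]; simpl; [lra|]. assert (H := pos_INR n).
  apply Rmult_lt_0_compat; [exact IH|]. apply Rdiv_lt_0_compat; lra.
Qed.

Lemma beta_decr (n : nat) : (beta (S n) <= beta n)%R.
Proof.
  simpl. assert (H := pos_INR n). assert (Hb := beta_pos n).
  rewrite <- (Rmult_1_r (beta n)) at 2. apply Rmult_le_compat_l; [lra|].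
  apply Rmult_le_reg_r with (INR n + 1)%R; [lra|]. unfold Rdiv.
  rewrite Rmult_assoc, Rinv_l; lra.
Qed.

Lemma beta_le_1 (n : nat) : (beta n <= 1)%R.
Proof.
  induction n as [|n IH]; [simpl; lra|]. eapply Rle_trans; [apply beta_decr|exact IH].
Qed.

Lemma beta_rec (n : nat) : ((INR n + 1) * beta (S n) = (INR n + / 2) * beta n)%R.
Proof. simpl. field. generalize (pos_INR n); lra. Qed.

Lemma pochhammer_half (n : nat) : pochhammer (1 / 2) n = RtoC (beta n * INR (fact n)).
Proof.
  induction n as [|n IH]; [simpl; f_equal; ring|].
  cbn [pochhammer]. rewrite IH.
  replace (1 / 2) with (RtoC (/ 2)) by (rewrite RtoC_inv by lra; field; intros H; apply RtoC_inj in H; lra).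
  rewrite <- RtoC_plus, <- RtoC_mult. f_equal.
  change (fact (S n)) with (S n * fact n)%nat. rewrite mult_INR, S_INR.
  replace (beta (S n) * ((INR n + 1) * INR (fact n)))%R
    with (((INR n + 1) * beta (S n)) * INR (fact n))%R by ring.
  rewrite beta_rec. ring.
Qed.

Lemma pochhammer_one (n : nat) : pochhammer 1 n = RtoC (INR (fact n)).
Proof.
  induction n as [|n IH]; [reflexivity|].
  cbn [pochhammer]. rewrite IH. change (fact (S n)) with (S n * fact n)%nat.
  rewrite mult_INR, S_INR, RtoC_mult, RtoC_plus. ring.
Qed.

Lemma hyp2F1_coeff_half (n : nat) :
  hyp2F1_coeff (1 / 2) (1 / 2) 1 n = RtoC (beta n ^ 2).
Proof.
  unfold hyp2F1_coeff. rewrite pochhammer_half, pochhammer_one, <- !RtoC_mult.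
  assert (H : INR (fact n) <> 0%R) by apply INR_fact_neq_0.
  rewrite <- RtoC_div by now apply Rmult_integral_contrapositive_currified.
  f_equal. field. exact H.
Qed.

Definition hyp_coeff (n : nat) : C := RtoC (beta n ^ 2).

Lemma conv_disc_bounded (a : nat -> C) (B : R) :
  (forall n, Cmod (a n) <= B)%R -> conv_disc a 1.
Proof.
  intros H r Hr.
  apply (@ex_series_le R_AbsRing R_CompleteNormedModule _ (fun n => B * r ^ n)%R).
  - intros n. change (Rabs (Cmod (a n) * r ^ n) <= B * r ^ n)%R.
    assert (0 <= r ^ n)%R by (apply pow_le; lra).
    rewrite Rabs_right by (apply Rle_ge, Rmult_le_pos; [apply Cmod_ge_0|assumption]).
    now apply Rmult_le_compat_r.
  - apply (ex_series_scal_l B (fun n => r ^ n)%R), ex_series_geom.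
    rewrite Rabs_right; lra.
Qed.

Lemma beta_sq_bounds (n : nat) : (0 < beta n ^ 2 <= 1)%R.
Proof.
  assert (H := beta_pos n). assert (H' := beta_le_1 n). split.
  - now apply pow_lt.
  - rewrite <- (pow1 2). apply pow_incr. lra.
Qed.

Lemma conv_disc_hyp : conv_disc hyp_coeff 1.
Proof.
  apply (conv_disc_bounded _ 1). intros n. unfold hyp_coeff.
  assert (H := beta_sq_bounds n). rewrite Cmod_R, Rabs_right; lra.
Qed.

(** Taylor coefficients of x (1 - x) y'' + (1 - 2 x) y' - y / 4 in terms of those of y. *)
Definition hyp_op (a : nat -> C) (n : nat) : C :=
  RtoC (INR n + 1) ^ 2 * a (S n) - RtoC (INR n + / 2) ^ 2 * a n.

Lemma RtoC_half_sq (n : nat) :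
  RtoC (INR n + / 2) ^ 2 = RtoC (INR n) ^ 2 + RtoC (INR n) + / 4.
Proof.
  rewrite <- (RtoC_inv 4) by lra. rewrite <- !RtoC_pow, <- !RtoC_plus. f_equal. field.
Qed.

Lemma CPS_hyp_op (a : nat -> C) (x : C) :
  conv_disc a 1 -> (Cmod x < 1)%R ->
  x * (1 - x) * CPS (deriv_coeff (deriv_coeff a)) x +
  (1 - 2 * x) * CPS (deriv_coeff a) x - / 4 * CPS a x = CPS (hyp_op a) x.
Proof.
  intros Ha Hx. symmetry. apply CPS_unique.
  assert (Hd := conv_disc_deriv _ _ Ha). assert (Hdd := conv_disc_deriv _ _ Hd).
  set (d1 := deriv_coeff a) in *. set (d2 := deriv_coeff d1) in *.
  assert (S1 : is_Cseries (fun n => incr_coeff d2 n * x ^ n) (x * CPS d2 x)).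
  { rewrite <- (CPS_incr d2 1) by assumption. apply (CPS_correct _ 1); [|exact Hx].
    now apply conv_disc_incr. }
  assert (S2 : is_Cseries (fun n => incr_coeff (incr_coeff d2) n * x ^ n) (x * (x * CPS d2 x))).
  { rewrite <- (CPS_incr d2 1), <- (CPS_incr _ 1) by (try assumption; now apply conv_disc_incr).
    apply (CPS_correct _ 1); [|exact Hx]. now apply conv_disc_incr, conv_disc_incr. }
  assert (S3 : is_Cseries (fun n => incr_coeff d1 n * x ^ n) (x * CPS d1 x)).
  { rewrite <- (CPS_incr d1 1) by assumption. apply (CPS_correct _ 1); [|exact Hx].
    now apply conv_disc_incr. }
  assert (S4 := CPS_correct d1 1 x Hd Hx). assert (S5 := CPS_correct a 1 x Ha Hx).
  generalize (is_Cseries_plus _ _ _ _ (is_Cseries_plus _ _ _ _ S1 (is_Cseries_scal (-(1)) _ _ S2))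
    (is_Cseries_plus _ _ _ _ (is_Cseries_plus _ _ _ _ S4 (is_Cseries_scal (-(2)) _ _ S3))
      (is_Cseries_scal (- / 4) _ _ S5))).
  match goal with |- is_series _ ?l -> is_series _ ?m => replace l with m by ring end.
  apply is_Cseries_ext. intros n. unfold hyp_op.
  rewrite RtoC_half_sq.
  replace (incr_coeff d2 n) with (RtoC (INR n) * RtoC (INR n + 1) * a (S n)).
  replace (incr_coeff (incr_coeff d2) n) with (RtoC (INR n) * (RtoC (INR n) - 1) * a n).
  replace (incr_coeff d1 n) with (RtoC (INR n) * a n).
  replace (d1 n) with (RtoC (INR n + 1) * a (S n)).
  - rewrite RtoC_plus. ring.
  - unfold d1, deriv_coeff. now rewrite S_INR.
  - destruct n as [|n]; unfold d1, incr_coeff, deriv_coeff; [simpl; ring|reflexivity].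
  - destruct n as [|[|n]]; unfold d2, d1, incr_coeff, deriv_coeff; try (simpl; ring).
    rewrite !S_INR, !RtoC_plus. ring.
  - destruct n as [|n]; unfold d2, d1, incr_coeff, deriv_coeff; [simpl; ring|].
    rewrite !S_INR, !RtoC_plus. ring.
Qed.

Lemma hyp_op_hyp_coeff (n : nat) : hyp_op hyp_coeff n = 0.
Proof.
  unfold hyp_op, hyp_coeff. rewrite <- !RtoC_pow, <- !RtoC_mult, <- RtoC_minus.
  rewrite <- !Rpow_mult_distr, beta_rec. f_equal. ring.
Qed.

Lemma CPS_zero (a : nat -> C) (z : C) : (forall n, a n = 0) -> CPS a z = 0.
Proof.
  intros H. apply CPS_unique. apply is_Cseries_ext with (fun _ => RtoC 0).
  - intros n. rewrite H. ring.
  - apply is_Cseries_zero.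
Qed.

Definition hypF (x : C) : C := CPS hyp_coeff x.
Definition hypF' (x : C) : C := CPS (deriv_coeff hyp_coeff) x.
Definition hypF'' (x : C) : C := CPS (deriv_coeff (deriv_coeff hyp_coeff)) x.

Lemma hypF_ode (x : C) : (Cmod x < 1)%R ->
  x * (1 - x) * hypF'' x + (1 - 2 * x) * hypF' x - / 4 * hypF x = 0.
Proof.
  intros Hx. unfold hypF, hypF', hypF''. rewrite CPS_hyp_op by (try assumption; apply conv_disc_hyp).
  apply CPS_zero, hyp_op_hyp_coeff.
Qed.

Lemma hypF_derive (x : C) : (Cmod x < 1)%R -> is_Cderive hypF x (hypF' x).
Proof. apply CPS_derive, conv_disc_hyp. Qed.

Lemma hypF'_derive (x : C) : (Cmod x < 1)%R -> is_Cderive hypF' x (hypF'' x).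
Proof. apply CPS_derive, conv_disc_deriv, conv_disc_hyp. Qed.

Lemma hyp_ext_disc (F : C -> C)
    (hF : is_hyp2F1 (1 / 2) (1 / 2) 1 F) (x : C) : (Cmod x < 1)%R -> F x = hypF x.
Proof.
  intros Hx. symmetry. apply CPS_unique.
  apply (proj1 (is_pseries_C hyp_coeff x (F x))).
  apply is_pseries_ext with (hyp2F1_coeff (1 / 2) (1 / 2) 1).
  - intros n. apply hyp2F1_coeff_half.
  - now apply hF.
Qed.

Lemma hyp_ext_derive_disc (F : C -> C)
    (hF : is_hyp2F1 (1 / 2) (1 / 2) 1 F) (x : C) : (Cmod x < 1)%R -> is_Cderive F x (hypF' x).
Proof.
  intros Hx. apply (is_Cderive_local hypF F x _ (1 - Cmod x)); [lra| |now apply hypF_derive].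
  intros h Hh. symmetry. apply (hyp_ext_disc F hF). generalize (Cmod_triangle x h). lra.
Qed.

Lemma hyp_ext_C_derive_disc (F : C -> C)
    (hF : is_hyp2F1 (1 / 2) (1 / 2) 1 F) (x : C) : (Cmod x < 1)%R -> C_derive F x = hypF' x.
Proof. intros Hx. apply is_C_derive_unique. now apply (hyp_ext_derive_disc F hF). Qed.

Lemma hyp_ext_C_derive2_disc (F : C -> C)
    (hF : is_hyp2F1 (1 / 2) (1 / 2) 1 F) (x : C) : (Cmod x < 1)%R -> C_derive (C_derive F) x = hypF'' x.
Proof.
  intros Hx. apply is_C_derive_unique.
  apply (is_Cderive_local hypF' (C_derive F) x _ (1 - Cmod x)); [lra| |now apply hypF'_derive].
  intros h Hh. symmetry. apply (hyp_ext_C_derive_disc F hF). generalize (Cmod_triangle x h). lra.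
Qed.

Lemma slit_plane_scal (u : C) (t : R) :
  slit_plane u -> (0 <= t <= 1)%R -> slit_plane (RtoC t * u).
Proof.
  unfold slit_plane. rewrite re_scal_l, im_scal_l. intros H Ht.
  destruct (Req_dec t 0) as [->|Ht0]; [right; lra|].
  destruct H as [H|H].
  - left. now apply Rmult_integral_contrapositive_currified.
  - right. destruct (Rle_lt_dec (Re u) 0) as [Hu|Hu]; nra.
Qed.

(** Identity theorem: the equation holds on the disc by [hypF_ode], its left side is analytic on the
    slit plane, and that plane is star-shaped about 0 by [slit_plane_scal], so the zero propagates
    along the segment from 0 to u. *)
Lemma hyp_ext_ode (F : C -> C)
    (hF : is_hyp2F1 (1 / 2) (1 / 2) 1 F) (u : C) : slit_plane u ->
  u * (1 - u) * C_derive (C_derive F) u + (1 - 2 * u) * C_derive F u - / 4 * F u = 0.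
Proof.
  intros Hu.
  (* Written with sums and products only, to which the closure properties of analyticity apply. *)
  set (R := fun u => u * (1 + (-(1)) * u) * C_derive (C_derive F) u +
     ((1 + (-(2)) * u) * C_derive F u + (- / 4) * F u)).
  assert (H : R (0 + u) = 0).
  { apply (analytic_segment_eq_0 R 0 u (/ (Cmod u + 1))).
    - intros t Ht. rewrite Cplus_0_l.
      assert (HF := proj2 hF _ (slit_plane_scal u t Hu Ht)).
      assert (HF1 := analytic_C_derive _ _ HF). assert (HF2 := analytic_C_derive _ _ HF1).
      assert (P : forall c d : C, analytic_at (fun v => c + d * v) (RtoC t * u)).
      { intros c d. apply (analytic_plus (fun _ => c)); [apply analytic_const|].
        apply (analytic_mult (fun _ => d)); [apply analytic_const|apply analytic_id]. }
      apply (analytic_plus (fun v => v * (1 + (-(1)) * v) * C_derive (C_derive F) v)).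
      + apply (analytic_mult (fun v => v * (1 + (-(1)) * v))); [|exact HF2].
        apply (analytic_mult (fun v => v)); [apply analytic_id|apply P].
      + apply (analytic_plus (fun v => (1 + (-(2)) * v) * C_derive F v)).
        * apply (analytic_mult (fun v => 1 + (-(2)) * v)); [apply P|exact HF1].
        * apply (analytic_mult (fun _ => - / 4)); [apply analytic_const|exact HF].
    - apply Rinv_0_lt_compat. generalize (Cmod_ge_0 u); lra.
    - intros t Ht. rewrite Cplus_0_l.
      assert (Hlt : (Cmod (RtoC t * u) < 1)%R).
      { rewrite Cmod_mult, Cmod_R, Rabs_right by lra.
        assert (Hu0 := Cmod_ge_0 u).
        apply Rle_lt_trans with (t * (Cmod u + 1))%R; [apply Rmult_le_compat_l; lra|].
        apply Rmult_lt_reg_r with (/ (Cmod u + 1))%R; [apply Rinv_0_lt_compat; lra|].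
        rewrite Rmult_assoc, Rinv_r; lra. }
      unfold R. rewrite (hyp_ext_C_derive_disc F hF), (hyp_ext_C_derive2_disc F hF), (hyp_ext_disc F hF)
        by assumption.
      rewrite <- (hypF_ode _ Hlt). ring. }
  rewrite Cplus_0_l in H. rewrite <- H. unfold R. ring.
Qed.

(** * Wallis and alternating harmonic bounds *)

Open Scope R_scope.

Definition wallis (n : nat) : R := RInt (fun t => sin t ^ n) 0 (PI / 2).

Lemma ex_RInt_sin_pow (n : nat) (a b : R) : ex_RInt (fun t => sin t ^ n) a b.
Proof.
  apply (@ex_RInt_continuous R_CompleteNormedModule). intros t _.
  apply (@ex_derive_continuous R_AbsRing R_NormedModule). auto_derive. exact I.
Qed.

(** (n + 2) sin^(n+2) - (n + 1) sin^n is the derivative of - cos sin^(n+1), which vanishes at both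
    ends. *)
Lemma wallis_rec (n : nat) : (INR n + 2) * wallis (S (S n)) = (INR n + 1) * wallis n.
Proof.
  assert (H : is_RInt (fun t => (INR n + 2) * sin t ^ S (S n) - (INR n + 1) * sin t ^ n)
                0 (PI / 2)
                (minus (- cos (PI / 2) * sin (PI / 2) ^ S n) (- cos 0 * sin 0 ^ S n))).
  { apply (is_RInt_derive (fun t => - cos t * sin t ^ S n)).
    - intros t _. auto_derive; [exact I|].
      change (match n with O => 1 | S _ => INR n + 1 end) with (INR (S n)).
      rewrite S_INR. generalize (sin2_cos2 t). unfold Rsqr. intros E.
      replace (- cos t * (1 * cos t * ((INR n + 1) * sin t ^ n)))
        with (- (cos t * cos t) * ((INR n + 1) * sin t ^ n)) by ring.
      replace (cos t * cos t) with (1 - sin t * sin t) by lra. simpl. ring.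
    - intros t _. apply (@ex_derive_continuous R_AbsRing R_NormedModule). auto_derive. exact I. }
  rewrite cos_PI2, sin_0 in H.
  replace (minus (- 0 * sin (PI / 2) ^ S n) (- cos 0 * 0 ^ S n)) with 0 in H
    by (unfold minus, plus, opp; simpl; ring).
  assert (K : forall m, is_RInt (fun t => sin t ^ m) 0 (PI / 2) (wallis m)).
  { intros m. apply (@RInt_correct R_CompleteNormedModule), ex_RInt_sin_pow. }
  assert (H' := is_RInt_minus _ _ _ _ _ _ (is_RInt_scal _ _ _ (INR n + 2) _ (K (S (S n))))
    (is_RInt_scal _ _ _ (INR n + 1) _ (K n))).
  apply (@is_RInt_unique R_CompleteNormedModule) in H.
  apply (@is_RInt_unique R_CompleteNormedModule) in H'.
  assert (E : (INR n + 2) * wallis (S (S n)) - (INR n + 1) * wallis n = 0).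
  { etransitivity; [symmetry; exact H'|exact H]. }
  lra.
Qed.

Lemma wallis_0 : wallis 0 = PI / 2.
Proof.
  unfold wallis. simpl. rewrite RInt_const. unfold scal; simpl. unfold mult; simpl. ring.
Qed.

Lemma wallis_1 : wallis 1 = 1.
Proof.
  unfold wallis. apply is_RInt_unique.
  apply is_RInt_ext with sin; [intros x _; symmetry; apply pow_1|].
  replace 1 with (minus (- cos (PI / 2)) (- cos 0))
    by (rewrite cos_PI2, cos_0; unfold minus, plus, opp; simpl; ring).
  apply (is_RInt_derive (fun t => - cos t)).
  - intros t _. auto_derive; [exact I|ring].
  - intros t _. apply (@ex_derive_continuous R_AbsRing R_NormedModule). auto_derive. exact I.
Qed.

Lemma wallis_decr (n : nat) : wallis (S n) <= wallis n.
Proof.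
  unfold wallis. apply RInt_le; try apply ex_RInt_sin_pow.
  - generalize PI_RGT_0; lra.
  - intros t Ht.
    assert (H0 : 0 <= sin t) by (apply sin_ge_0; generalize PI_RGT_0; lra).
    assert (H1 : sin t <= 1) by apply SIN_bound.
    simpl. rewrite <- (Rmult_1_l (sin t ^ n)) at 2.
    apply Rmult_le_compat_r; [now apply pow_le|exact H1].
Qed.

Lemma wallis_even (n : nat) : wallis (2 * n) = PI / 2 * beta n.
Proof.
  induction n as [|n IH]; [simpl; rewrite wallis_0; ring|].
  replace (2 * S n)%nat with (S (S (2 * n))) by lia.
  assert (H := wallis_rec (2 * n)). rewrite IH, mult_INR in H. replace (INR 2) with 2 in H by (simpl; ring).
  assert (Hb := beta_rec n). assert (Hn := pos_INR n).
  apply Rmult_eq_reg_l with (2 * INR n + 2); [|lra].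
  rewrite H. replace ((2 * INR n + 2) * (PI / 2 * beta (S n)))
    with (PI * ((INR n + 1) * beta (S n))) by field.
  rewrite Hb. field.
Qed.

Lemma wallis_odd (n : nat) : wallis (S (2 * n)) * ((2 * INR n + 1) * beta n) = 1.
Proof.
  induction n as [|n IH]; [simpl; rewrite wallis_1; ring|].
  replace (2 * S n)%nat with (S (S (2 * n))) by lia.
  assert (H := wallis_rec (S (2 * n))). rewrite !S_INR, mult_INR in H. replace (INR 2) with 2 in H by (simpl; ring).
  assert (Hb := beta_rec n). assert (Hn := pos_INR n). rewrite S_INR.
  apply eq_trans with (wallis (S (2 * n)) * ((2 * INR n + 1) * beta n)); [|exact IH].
  replace (wallis (S (S (S (2 * n)))) * ((2 * (INR n + 1) + 1) * beta (S n)))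
    with (((2 * INR n + 1 + 2) * wallis (S (S (S (2 * n))))) * beta (S n)) by ring.
  rewrite H.
  replace ((2 * INR n + 1 + 1) * wallis (S (2 * n)) * beta (S n))
    with (2 * wallis (S (2 * n)) * ((INR n + 1) * beta (S n))) by ring.
  rewrite Hb. field.
Qed.

(** Consecutive Wallis integrals decrease, the even ones being pi beta_n / 2 and the odd ones 1 /
    ((2n + 1) beta_n). Together with [beta_sq_upper] this squeezes beta_n^2 between 1 / (pi (n +
    1/2)) and 1 / (pi n): the source of pi in the connection formula. *)
Lemma beta_sq_lower (n : nat) : 1 <= PI * (INR n + / 2) * beta n ^ 2.
Proof.
  assert (H := wallis_decr (2 * n)). assert (Hb := beta_pos n). assert (Hn := pos_INR n).
  apply Rmult_le_compat_r with (r := (2 * INR n + 1) * beta n) in H;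
    [|apply Rmult_le_pos; lra].
  rewrite wallis_odd, wallis_even in H.
  replace (PI * (INR n + / 2) * beta n ^ 2)
    with (PI / 2 * beta n * ((2 * INR n + 1) * beta n)) by (simpl; field). exact H.
Qed.

Lemma beta_sq_upper (n : nat) : PI * INR n * beta n ^ 2 <= 1.
Proof.
  destruct n as [|n]; [simpl; lra|].
  assert (H := wallis_decr (S (2 * n))). assert (Hb := beta_pos n). assert (Hn := pos_INR n).
  apply Rmult_le_compat_r with (r := (2 * INR n + 1) * beta n) in H;
    [|apply Rmult_le_pos; lra].
  rewrite wallis_odd in H. replace (S (S (2 * n))) with (2 * S n)%nat in H by lia.
  rewrite wallis_even in H. assert (Hr := beta_rec n). rewrite S_INR.
  replace (PI * (INR n + 1) * beta (S n) ^ 2)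
    with (PI * beta (S n) * ((INR n + 1) * beta (S n))) by (simpl; ring).
  rewrite Hr. lra.
Qed.

(** * Harmonic sums and ln 2 *)

Fixpoint harmonic (n : nat) : R :=
  match n with O => 0 | S k => harmonic k + / (INR k + 1) end.

(** Partial sums of 1 - 1/2 + 1/3 - 1/4 + ... taken two terms at a time; their limit ln 2 is the
    source of log 16. *)
Fixpoint alt_harmonic (n : nat) : R :=
  match n with
  | O => 0
  | S k => alt_harmonic k + / ((2 * INR k + 1) * (2 * INR k + 2))
  end.

Lemma alt_harmonic_eq (n : nat) : alt_harmonic n = harmonic (2 * n) - harmonic n.
Proof.
  induction n as [|n IH]; [simpl; ring|].
  replace (2 * S n)%nat with (S (S (2 * n))) by lia.
  cbn [harmonic alt_harmonic]. rewrite IH, S_INR, mult_INR. replace (INR 2) with 2 by (simpl; ring).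
  assert (Hn := pos_INR n). field. lra.
Qed.

Lemma ln_le_sub_1 (x : R) : 0 < x -> ln x <= x - 1.
Proof.
  intros Hx. rewrite <- (ln_exp (x - 1)). apply ln_le; [exact Hx|].
  generalize (exp_ineq1_le (x - 1)). lra.
Qed.

(** Telescopes ln (1 + 1/m) <= 1/m; the companion upper bound telescopes ln (1 - 1/m) <= - 1/m
    instead. *)
Lemma harmonic_lower (n j : nat) :
  ln ((INR n + INR j + 1) / (INR n + 1)) <= harmonic (n + j) - harmonic n.
Proof.
  assert (Hn := pos_INR n). induction j as [|j IH].
  - rewrite Nat.add_0_r. simpl INR. replace ((INR n + 0 + 1) / (INR n + 1)) with 1 by (field; lra).
    rewrite ln_1. lra.
  - assert (Hj := pos_INR j). rewrite Nat.add_succ_r. cbn [harmonic].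
    rewrite plus_INR, S_INR.
    replace ((INR n + (INR j + 1) + 1) / (INR n + 1))
      with ((INR n + INR j + 1) / (INR n + 1) * (1 + / (INR n + INR j + 1))) by (field; lra).
    assert (H0 : 0 < / (INR n + INR j + 1)) by (apply Rinv_0_lt_compat; lra).
    rewrite ln_mult; [|apply Rdiv_lt_0_compat; lra|lra].
    generalize (ln_le_sub_1 (1 + / (INR n + INR j + 1)) ltac:(lra)). lra.
Qed.

Lemma harmonic_upper (n j : nat) : (0 < n)%nat ->
  harmonic (n + j) - harmonic n <= ln ((INR n + INR j) / INR n).
Proof.
  intros Hn0. assert (Hn : 0 < INR n) by now apply lt_0_INR.
  induction j as [|j IH].
  - rewrite Nat.add_0_r. simpl INR. replace ((INR n + 0) / INR n) with 1 by (field; lra).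
    rewrite ln_1. lra.
  - assert (Hj := pos_INR j). rewrite Nat.add_succ_r. cbn [harmonic].
    rewrite plus_INR, S_INR.
    assert (E : (INR n + INR j) / INR n =
      (INR n + (INR j + 1)) / INR n * (1 - / (INR n + INR j + 1))) by (field; lra).
    assert (H0 : / (INR n + INR j + 1) < 1).
    { rewrite <- Rinv_1. apply Rinv_lt_contravar; lra. }
    rewrite E, ln_mult in IH; [|apply Rdiv_lt_0_compat; lra|lra].
    generalize (ln_le_sub_1 (1 - / (INR n + INR j + 1)) ltac:(lra)). lra.
Qed.

Lemma alt_harmonic_upper (n : nat) : alt_harmonic n <= ln 2.
Proof.
  destruct n as [|n].
  - simpl. left. rewrite <- ln_1. apply ln_increasing; lra.
  - rewrite alt_harmonic_eq. replace (2 * S n)%nat with (S n + S n)%nat by lia.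
    eapply Rle_trans; [apply harmonic_upper; lia|]. right. f_equal.
    field. apply not_0_INR; lia.
Qed.

Lemma alt_harmonic_lower (n : nat) : ln 2 - / (2 * INR n + 1) <= alt_harmonic n.
Proof.
  rewrite alt_harmonic_eq. replace (2 * n)%nat with (n + n)%nat by lia.
  eapply Rle_trans; [|apply harmonic_lower]. assert (Hn := pos_INR n).
  (* The bound from [harmonic_lower] misses ln 2 by ln (1 + 1/(2n + 1)), which is at most 1/(2n +
     1). *)
  assert (E : 2 = (INR n + INR n + 1) / (INR n + 1) * (1 + / (2 * INR n + 1)))
    by (field; lra).
  assert (H0 : 0 < / (2 * INR n + 1)) by (apply Rinv_0_lt_compat; lra).
  rewrite E at 1. rewrite ln_mult; [|apply Rdiv_lt_0_compat; lra|lra].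
  generalize (ln_le_sub_1 (1 + / (2 * INR n + 1)) ltac:(lra)). lra.
Qed.

Lemma alt_harmonic_pos (n : nat) : 0 <= alt_harmonic n.
Proof.
  induction n as [|n IH]; simpl; [lra|]. assert (Hn := pos_INR n).
  assert (0 < / ((2 * INR n + 1) * (2 * INR n + 2)))
    by (apply Rinv_0_lt_compat, Rmult_lt_0_compat; lra). lra.
Qed.

Open Scope C_scope.

(** * The logarithmic solution *)

(* Frobenius: [hypF x * log x + hypM x] is the second solution at the origin. *)
Definition log_coeff (n : nat) : C := RtoC (4 * beta n ^ 2 * alt_harmonic n).
Definition hypM (x : C) : C := CPS log_coeff x.
Definition hypM' (x : C) : C := CPS (deriv_coeff log_coeff) x.
Definition hypM'' (x : C) : C := CPS (deriv_coeff (deriv_coeff log_coeff)) x.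

Lemma ln_2_lt_1 : (ln 2 < 1)%R.
Proof.
  rewrite <- (ln_exp 1). apply ln_increasing; [lra|].
  generalize (exp_ineq1 1 ltac:(lra)). lra.
Qed.

Lemma conv_disc_log : conv_disc log_coeff 1.
Proof.
  apply (conv_disc_bounded _ 4). intros n. unfold log_coeff.
  assert (H := beta_sq_bounds n). assert (H0 := alt_harmonic_pos n).
  assert (H1 := alt_harmonic_upper n). assert (H2 := ln_2_lt_1).
  rewrite Cmod_R, Rabs_right by (apply Rle_ge, Rmult_le_pos; [apply Rmult_le_pos|]; lra).
  assert (beta n ^ 2 * alt_harmonic n <= 1 * 1)%R by (apply Rmult_le_compat; lra). lra.
Qed.

Lemma hypM_derive (x : C) : (Cmod x < 1)%R -> is_Cderive hypM x (hypM' x).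
Proof. apply CPS_derive, conv_disc_log. Qed.

Lemma hypM'_derive (x : C) : (Cmod x < 1)%R -> is_Cderive hypM' x (hypM'' x).
Proof. apply CPS_derive, conv_disc_deriv, conv_disc_log. Qed.

(** The recurrence for beta_n^2 cancels the accumulated sum, so only the increment of [alt_harmonic]
    survives. *)
Lemma hyp_op_log_coeff (n : nat) :
  hyp_op log_coeff n =
  RtoC ((2 * INR n + 1) / (2 * INR n + 2) * beta n ^ 2).
Proof.
  unfold hyp_op, log_coeff. rewrite <- !RtoC_pow, <- !RtoC_mult, <- RtoC_minus. f_equal.
  cbn [alt_harmonic]. assert (Hn := pos_INR n).
  replace ((INR n + 1) ^ 2 * (4 * beta (S n) ^ 2 * (alt_harmonic n +
     / ((2 * INR n + 1) * (2 * INR n + 2)))))%R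
    with (((INR n + 1) * beta (S n)) ^ 2 * (4 * (alt_harmonic n +
     / ((2 * INR n + 1) * (2 * INR n + 2)))))%R by ring.
  rewrite beta_rec. field. lra.
Qed.

(** When the hypergeometric operator is applied to F log x, the logarithm cancels and 2 (1 - x) F' -
    F remains; [hypM] has to compensate it. *)
Lemma hypM_ode (x : C) : (Cmod x < 1)%R ->
  x * (1 - x) * hypM'' x + (1 - 2 * x) * hypM' x - / 4 * hypM x =
  hypF x - 2 * (1 - x) * hypF' x.
Proof.
  intros Hx. unfold hypM, hypM', hypM''.
  rewrite CPS_hyp_op by (try assumption; apply conv_disc_log).
  apply CPS_unique.
  assert (Ha := conv_disc_hyp). assert (Hd := conv_disc_deriv _ _ Ha).
  assert (S3 : is_Cseries (fun n => incr_coeff (deriv_coeff hyp_coeff) n * x ^ n) (x * hypF' x)).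
  { unfold hypF'. rewrite <- (CPS_incr _ 1) by assumption. apply (CPS_correct _ 1); [|exact Hx].
    now apply conv_disc_incr. }
  assert (S4 := CPS_correct _ 1 x Hd Hx). assert (S5 := CPS_correct _ 1 x Ha Hx).
  generalize (is_Cseries_plus _ _ _ _ S5 (is_Cseries_plus _ _ _ _
    (is_Cseries_scal (-(2)) _ _ S4) (is_Cseries_scal 2 _ _ S3))).
  fold (hypF' x). fold (hypF x).
  match goal with |- is_series _ ?l -> is_series _ ?m => replace l with m by ring end.
  apply is_Cseries_ext. intros n. rewrite hyp_op_log_coeff.
  replace (incr_coeff (deriv_coeff hyp_coeff) n) with (RtoC (INR n) * hyp_coeff n)
    by (destruct n as [|n]; [simpl; ring|reflexivity]).
  unfold deriv_coeff, hyp_coeff. rewrite S_INR.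
  assert (Hn := pos_INR n).
  replace ((2 * INR n + 1) / (2 * INR n + 2) * beta n ^ 2)%R
    with (beta n ^ 2 + (- (2) * ((INR n + 1) * beta (S n) ^ 2) + 2 * (INR n * beta n ^ 2)))%R.
  - rewrite !RtoC_plus, !RtoC_mult, RtoC_opp, RtoC_plus. ring.
  - replace ((INR n + 1) * beta (S n) ^ 2)%R with (((INR n + 1) * beta (S n)) ^ 2 / (INR n + 1))%R
      by (field; lra).
    rewrite beta_rec. field. lra.
Qed.

(** This is x (1 - x) times the Wronskian of F and F log x + M, in which the logarithms cancel. It
    is constant by Abel's identity and equals 1 at x = 0. *)
Lemma log_wronskian (x : C) : (Cmod x < 1)%R ->
  (1 - x) * hypF x ^ 2 + x * (1 - x) * (hypF x * hypM' x - hypF' x * hypM x) = 1.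
Proof.
  intros Hx.
  set (V := fun x => (1 - x) * (hypF x * hypF x) +
     x * (1 - x) * (hypF x * hypM' x - hypF' x * hypM x)).
  assert (E : V (0 + x) = V 0).
  { apply Cderive_0_segment. intros t Ht.
    assert (Ht' : (Cmod (0 + RtoC t * x) < 1)%R).
    { rewrite Cplus_0_l, Cmod_mult, Cmod_R, Rabs_right by lra.
      generalize (Cmod_ge_0 x). intros. apply Rle_lt_trans with (1 * Cmod x)%R; [|lra].
      apply Rmult_le_compat_r; lra. }
    set (y := 0 + RtoC t * x) in *. clearbody y.
    assert (O1 := hypF_ode y Ht'). assert (O2 := hypM_ode y Ht').
    assert (D1 := hypF_derive y Ht'). assert (D2 := hypF'_derive y Ht').
    assert (D3 := hypM_derive y Ht'). assert (D4 := hypM'_derive y Ht').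
    eapply is_Cderive_eq.
    - unfold V. Cderive_rules.
    - cbv beta.
      transitivity (hypF y * (y * (1 - y) * hypM'' y + (1 - 2 * y) * hypM' y - / 4 * hypM y)
        - hypM y * (y * (1 - y) * hypF'' y + (1 - 2 * y) * hypF' y - / 4 * hypF y)
        - hypF y * hypF y + 2 * (1 - y) * hypF y * hypF' y); [ring|].
      rewrite O1, O2. ring. }
  rewrite Cplus_0_l in E.
  transitivity (V x); [unfold V; ring|]. rewrite E. unfold V, hypF.
  rewrite CPS_at_0.
  replace (hyp_coeff 0) with (RtoC 1) by (unfold hyp_coeff; simpl; f_equal; ring). ring.
Qed.

Lemma CPS_RtoC (a : nat -> C) (c : nat -> R) (r : R) :
  (forall n, a n = RtoC (c n)) -> CPS a (RtoC r) = RtoC (PSeries c r).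
Proof.
  intros H. apply C_ext.
  - rewrite re_RtoC. apply Series_ext. intros n. now rewrite H, <- RtoC_pow, <- RtoC_mult.
  - rewrite im_RtoC. apply is_series_unique.
    apply (is_series_ext (fun _ => 0%R)).
    + intros n. now rewrite H, <- RtoC_pow, <- RtoC_mult.
    + exact (proj1 (proj1 (is_Cseries_Re_Im _ _) is_Cseries_zero)).
Qed.

Lemma is_derive_PSeries_disc (c : nat -> R) (r : R) :
  conv_disc (fun n => RtoC (c n)) 1 -> (Rabs r < 1)%R ->
  is_derive (PSeries c) r (PSeries (PS_derive c) r).
Proof.
  intros Hc Hr.
  assert (D := CPS_derive _ 1 (0 + RtoC r * 1) Hc
    ltac:(rewrite Cplus_0_l, Cmult_1_r, Cmod_R; exact Hr)).
  apply is_derive_Re_line in D. destruct D as [D _].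
  replace (Re (CPS (deriv_coeff (fun n : nat => RtoC (c n))) (0 + RtoC r * 1) * 1))
    with (PSeries (PS_derive c) r) in D.
  - eapply is_derive_ext; [|exact D]. intros s.
    cbv beta. rewrite Cplus_0_l, Cmult_1_r, (CPS_RtoC _ c); reflexivity.
  - rewrite Cplus_0_l, !Cmult_1_r, (CPS_RtoC _ (PS_derive c)); [reflexivity|].
    intros n. unfold deriv_coeff, PS_derive. now rewrite RtoC_mult.
Qed.

(** * Connection formula on the interval (0, 1) *)

Open Scope R_scope.

Definition rF : R -> R := PSeries (fun n => beta n ^ 2).
Definition rF' : R -> R := PSeries (PS_derive (fun n => beta n ^ 2)).
Definition rF'' : R -> R := PSeries (PS_derive (PS_derive (fun n => beta n ^ 2))).
Definition rM : R -> R := PSeries (fun n => 4 * beta n ^ 2 * alt_harmonic n).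
Definition rM' : R -> R := PSeries (PS_derive (fun n => 4 * beta n ^ 2 * alt_harmonic n)).

Lemma hypF_RtoC (r : R) : hypF (RtoC r) = RtoC (rF r).
Proof. now apply CPS_RtoC. Qed.

Lemma deriv_coeff_RtoC (a : nat -> C) (c : nat -> R) :
  (forall n, a n = RtoC (c n)) -> forall n, deriv_coeff a n = RtoC (PS_derive c n).
Proof. intros H n. unfold deriv_coeff, PS_derive. now rewrite H, RtoC_mult. Qed.

Lemma hypF'_RtoC (r : R) : hypF' (RtoC r) = RtoC (rF' r).
Proof. now apply CPS_RtoC, deriv_coeff_RtoC. Qed.

Lemma hypF''_RtoC (r : R) : hypF'' (RtoC r) = RtoC (rF'' r).
Proof. now apply CPS_RtoC, deriv_coeff_RtoC, deriv_coeff_RtoC. Qed.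

Lemma hypM_RtoC (r : R) : hypM (RtoC r) = RtoC (rM r).
Proof. now apply CPS_RtoC. Qed.

Lemma hypM'_RtoC (r : R) : hypM' (RtoC r) = RtoC (rM' r).
Proof. now apply CPS_RtoC, deriv_coeff_RtoC. Qed.

Lemma rF_derive (r : R) : Rabs r < 1 -> is_derive rF r (rF' r).
Proof. apply is_derive_PSeries_disc, conv_disc_hyp. Qed.

Lemma rF'_derive (r : R) : Rabs r < 1 -> is_derive rF' r (rF'' r).
Proof.
  apply is_derive_PSeries_disc.
  apply conv_disc_ext with (deriv_coeff hyp_coeff); [now apply deriv_coeff_RtoC|].
  apply conv_disc_deriv, conv_disc_hyp.
Qed.

Lemma rM_derive (r : R) : Rabs r < 1 -> is_derive rM r (rM' r).
Proof. apply is_derive_PSeries_disc, conv_disc_log. Qed.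

Lemma rF_ode (r : R) : Rabs r < 1 ->
  r * (1 - r) * rF'' r + (1 - 2 * r) * rF' r - / 4 * rF r = 0.
Proof.
  intros Hr. apply RtoC_inj. rewrite <- (hypF_ode (RtoC r)) by (now rewrite Cmod_R).
  rewrite hypF_RtoC, hypF'_RtoC, hypF''_RtoC.
  rewrite RtoC_minus, RtoC_plus, !RtoC_mult, !RtoC_minus, RtoC_mult, RtoC_inv by lra.
  reflexivity.
Qed.

Lemma r_log_wronskian (r : R) : Rabs r < 1 ->
  (1 - r) * rF r ^ 2 + r * (1 - r) * (rF r * rM' r - rF' r * rM r) = 1.
Proof.
  intros Hr. apply RtoC_inj. rewrite <- (log_wronskian (RtoC r)) by (now rewrite Cmod_R).
  rewrite hypF_RtoC, hypF'_RtoC, hypM_RtoC, hypM'_RtoC.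
  rewrite RtoC_plus, !RtoC_mult, !RtoC_minus, !RtoC_mult, RtoC_pow. reflexivity.
Qed.

Lemma ex_series_disc_R (c : nat -> R) (r : R) :
  conv_disc (fun n => RtoC (c n)) 1 -> 0 <= r < 1 -> ex_series (fun n => c n * r ^ n).
Proof.
  intros H Hr. apply ex_series_Rabs. eapply ex_series_ext; [|apply (H r Hr)].
  intros n. cbv beta. rewrite Cmod_R, Rabs_mult, (Rabs_right (r ^ n)); [reflexivity|].
  apply Rle_ge, pow_le; lra.
Qed.

Lemma rF_is_series (r : R) : 0 <= r < 1 -> is_series (fun n => beta n ^ 2 * r ^ n) (rF r).
Proof. intros Hr. apply Series_correct, ex_series_disc_R; [apply conv_disc_hyp|exact Hr]. Qed.

Lemma is_series_le (a b : nat -> R) (la lb : R) :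
  is_series a la -> is_series b lb -> (forall n, a n <= b n) -> la <= lb.
Proof.
  intros Ha Hb H.
  apply (is_lim_seq_le (sum_n a) (sum_n b) la lb); [|exact Ha|exact Hb].
  intros n. now apply sum_n_m_le.
Qed.

Lemma is_series_tail (a : nat -> R) (l : R) :
  is_series a l -> is_series (fun n => a (S n)) (l - a 0%nat).
Proof.
  intros H. apply is_series_incr_1.
  match goal with |- is_series _ ?m => assert (E : m = l) end.
  { match goal with |- ?a = ?b => change (@eq R a b) end. unfold plus; simpl. ring. }
  rewrite E. exact H.
Qed.

Lemma is_series_ln (r : R) : 0 <= r < 1 ->
  is_series (fun n => r ^ S n / (INR n + 1)) (- ln (1 - r)).
Proof.
  intros Hr.
  assert (Hc : conv_disc (fun n => RtoC (match n with O => 0 | S k => / (INR k + 1) end)) 1).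
  { apply (conv_disc_bounded _ 1). intros n. rewrite Cmod_R. destruct n as [|n].
    - rewrite Rabs_R0; lra.
    - assert (Hn := pos_INR n). assert (0 < / (INR n + 1)) by (apply Rinv_0_lt_compat; lra).
      rewrite Rabs_right by lra. rewrite <- Rinv_1. apply Rinv_le_contravar; lra. }
  set (c := fun n => match n with O => 0 | S k => / (INR k + 1) end) in *.
  assert (E : PSeries c r + ln (1 - r) = PSeries c 0 + ln (1 - 0)).
  { symmetry. apply (is_derive_0_eq (fun t => PSeries c t + ln (1 - t))); [lra|].
    intros t Ht.
    replace 0 with (PSeries (PS_derive c) t + - / (1 - t)).
    - apply (@is_derive_plus R_AbsRing R_NormedModule).
      + apply is_derive_PSeries_disc; [exact Hc|]. rewrite Rabs_right; lra.
      + auto_derive; [lra|]. field. lra.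
    - unfold PSeries. rewrite (is_series_unique _ (/ (1 - t))); [ring|].
      eapply is_series_ext; [|apply is_series_geom; rewrite Rabs_right; lra].
      intros n. match goal with |- ?a = ?b => change (@eq R a b) end.
      unfold PS_derive, c. rewrite S_INR. field. generalize (pos_INR n); lra. }
  rewrite PSeries_0, Rminus_0_r, ln_1 in E. change (c 0%nat) with 0 in E.
  replace (- ln (1 - r)) with (PSeries c r) by lra.
  assert (H : is_series (fun n => c n * r ^ n) (PSeries c r)).
  { apply Series_correct, ex_series_disc_R; assumption. }
  apply (is_series_ext (fun n => c (S n) * r ^ S n)).
  - intros n. apply Rmult_comm.
  - replace (PSeries c r) with (PSeries c r - c 0%nat * r ^ 0) by (unfold c; simpl; ring).
    exact (is_series_tail _ _ H).
Qed.

(** Termwise comparison with the logarithmic series through [beta_sq_lower]. With [rF_upper] it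
    confines rF r + ln (1 - r) / pi to [0, 1], the asymptotics at 1 used in the connection
    formula. *)
Lemma rF_lower (r : R) : 0 <= r < 1 -> - / PI * ln (1 - r) <= rF r.
Proof.
  intros Hr. assert (HPI := PI_RGT_0).
  apply (is_series_le (fun n => / PI * (r ^ S n / (INR n + 1)))
           (fun n => beta n ^ 2 * r ^ n)).
  - replace (- / PI * ln (1 - r)) with (/ PI * - ln (1 - r)) by ring.
    exact (is_series_scal_l (/ PI) _ _ (is_series_ln r Hr)).
  - now apply rF_is_series.
  - intros n. assert (Hn := pos_INR n). assert (Hb := beta_sq_lower n).
    assert (Hrn : 0 <= r ^ n) by (apply pow_le; lra).
    apply Rle_trans with (/ PI / (INR n + 1) * r ^ n).
    + simpl. replace (/ PI * (r * r ^ n / (INR n + 1))) with (r * (/ PI / (INR n + 1) * r ^ n))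
        by (field; lra).
      rewrite <- (Rmult_1_l (/ PI / (INR n + 1) * r ^ n)) at 2.
      apply Rmult_le_compat_r; [|lra]. apply Rmult_le_pos; [|exact Hrn].
      apply Rdiv_le_0_compat; [|lra]. left; now apply Rinv_0_lt_compat.
    + apply Rmult_le_compat_r; [exact Hrn|].
      apply Rmult_le_reg_r with (PI * (INR n + 1)); [apply Rmult_lt_0_compat; lra|].
      replace (/ PI / (INR n + 1) * (PI * (INR n + 1))) with 1 by (field; lra).
      assert (0 <= beta n ^ 2 * PI * / 2).
      { assert (Hb2 := proj1 (beta_sq_bounds n)).
        apply Rmult_le_pos; [apply Rmult_le_pos|]; lra. }
      lra.
Qed.

Lemma rF_upper (r : R) : 0 <= r < 1 -> rF r <= 1 - / PI * ln (1 - r).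
Proof.
  intros Hr. assert (HPI := PI_RGT_0).
  assert (H := rF_is_series r Hr).
  assert (H1 : is_series (fun n => beta (S n) ^ 2 * r ^ S n) (rF r - 1)).
  { replace (rF r - 1) with (rF r - beta 0 ^ 2 * r ^ 0) by (simpl; ring).
    exact (is_series_tail _ _ (rF_is_series r Hr)). }
  cut (rF r - 1 <= / PI * - ln (1 - r)); [lra|].
  apply (is_series_le _ (fun n => / PI * (r ^ S n / (INR n + 1))) _ _ H1).
  - exact (is_series_scal_l (/ PI) _ _ (is_series_ln r Hr)).
  - intros n. assert (Hn := pos_INR n). assert (Hb := beta_sq_upper (S n)).
    rewrite S_INR in Hb. assert (Hrn : 0 <= r ^ S n) by (apply pow_le; lra).
    replace (/ PI * (r ^ S n / (INR n + 1))) with (/ PI / (INR n + 1) * r ^ S n)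
      by (field; lra).
    apply Rmult_le_compat_r; [exact Hrn|].
    apply Rmult_le_reg_r with (PI * (INR n + 1)); [apply Rmult_lt_0_compat; lra|].
    replace (/ PI / (INR n + 1) * (PI * (INR n + 1))) with 1 by (field; lra). lra.
Qed.

Lemma rF_geom_upper (r : R) : 0 <= r < 1 -> rF r <= / (1 - r).
Proof.
  intros Hr. apply (is_series_le (fun n => beta n ^ 2 * r ^ n) (fun n => r ^ n)).
  - now apply rF_is_series.
  - apply is_series_geom. rewrite Rabs_right; lra.
  - intros n. rewrite <- (Rmult_1_l (r ^ n)) at 2.
    apply Rmult_le_compat_r; [apply pow_le; lra|]. apply beta_sq_bounds.
Qed.

Lemma rF_ge_1 (r : R) : 0 <= r < 1 -> 1 <= rF r.
Proof.
  intros Hr.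
  assert (H1 : is_series (fun n => beta (S n) ^ 2 * r ^ S n) (rF r - 1)).
  { replace (rF r - 1) with (rF r - beta 0 ^ 2 * r ^ 0) by (simpl; ring).
    exact (is_series_tail _ _ (rF_is_series r Hr)). }
  cut (0 <= rF r - 1); [lra|].
  apply (is_series_le (fun _ => 0) _ _ _) with (2 := H1).
  - exact (proj1 (proj1 (is_Cseries_Re_Im _ _) is_Cseries_zero)).
  - intros n. apply Rmult_le_pos; [|apply pow_le; lra]. left; apply beta_sq_bounds.
Qed.

Open Scope C_scope.

Open Scope R_scope.

Lemma is_series_telescope : is_series (fun n => / (INR n + 1) - / (INR n + 2)) 1.
Proof.
  apply is_series_Reals. intros eps He.
  destruct (archimed_cor1 eps He) as [N [HN HN0]].
  exists N. intros n Hn. unfold Rdist.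
  assert (E : sum_f_R0 (fun k => / (INR k + 1) - / (INR k + 2)) n = 1 - / (INR n + 2)).
  { induction n as [|n IH]; [simpl; field|].
    destruct (Nat.eq_dec N (S n)) as [->|Hne].
    - clear IH HN HN0 Hn. induction (S n) as [|m IH]; [simpl; field|].
      rewrite tech5, IH, S_INR. field. generalize (pos_INR m); lra.
    - rewrite tech5, IH, S_INR by lia. field. generalize (pos_INR n); lra. }
  rewrite E.
  assert (HN1 : 0 < INR N) by now apply lt_0_INR.
  assert (HNn : INR N <= INR n) by now apply le_INR.
  assert (0 < / (INR n + 2)) by (apply Rinv_0_lt_compat; lra).
  assert (/ (INR n + 2) < / INR N) by (apply Rinv_lt_contravar; [apply Rmult_lt_0_compat|]; lra).
  rewrite Rabs_left; lra.
Qed.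

(** F and M both blow up at 1, but this combination has coefficients 4 (ln 2 - alt_harmonic n)
    beta_n^2 of order 1/n^2, so it is dominated by a telescoping series. *)
Lemma rM_rF_bound (r : R) : 0 <= r < 1 -> Rabs (4 * ln 2 * rF r - rM r) <= 20.
Proof.
  intros Hr.
  assert (S1 : is_series (fun n => 4 * (ln 2 - alt_harmonic n) * (beta n ^ 2 * r ^ n))
                 (4 * ln 2 * rF r - rM r)).
  { assert (HM : is_series (fun n => 4 * beta n ^ 2 * alt_harmonic n * r ^ n) (rM r)).
    { apply Series_correct, ex_series_disc_R; [apply conv_disc_log|exact Hr]. }
    generalize (is_series_minus _ _ _ _
      (is_series_scal_l (4 * ln 2) _ _ (rF_is_series r Hr)) HM).
    apply is_series_ext. intros n.
    match goal with |- ?a = ?b => change (@eq R a b) end.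
    unfold plus, opp, scal; simpl; unfold mult; simpl. ring. }
  (* With b = beta_n^2, both b and n b are at most 1, so 4 b (n + 1)(n + 2) <= 4 n + 20 <= 20 (2 n +
     1); this fixes the constant 20. *)
  assert (B : forall n, 0 <= 4 * (ln 2 - alt_harmonic n) * (beta n ^ 2 * r ^ n) <=
                20 * (/ (INR n + 1) - / (INR n + 2))).
  { intros n. assert (Hn := pos_INR n). assert (H1 := alt_harmonic_upper n).
    assert (H2 := alt_harmonic_lower n). assert (Hb := beta_sq_bounds n).
    assert (Hu := beta_sq_upper n). assert (HPI := PI2_1).
    assert (Hrn : 0 <= r ^ n <= 1).
    { split; [apply pow_le; lra|]. rewrite <- (pow1 n). apply pow_incr; lra. }
    split; [apply Rmult_le_pos; [lra|]; apply Rmult_le_pos; lra|].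
    replace (20 * (/ (INR n + 1) - / (INR n + 2))) with (20 / ((INR n + 1) * (INR n + 2)))
      by (field; lra).
    assert (H3 : (ln 2 - alt_harmonic n) * (beta n ^ 2 * r ^ n) <=
                 / (2 * INR n + 1) * (beta n ^ 2 * 1)).
    { apply Rmult_le_compat; try lra.
      - apply Rmult_le_pos; lra.
      - apply Rmult_le_compat_l; lra. }
    apply Rle_trans with (4 * (/ (2 * INR n + 1) * (beta n ^ 2 * 1))); [lra|].
    apply Rmult_le_reg_r with ((2 * INR n + 1) * ((INR n + 1) * (INR n + 2))).
    { repeat apply Rmult_lt_0_compat; lra. }
    replace (4 * (/ (2 * INR n + 1) * (beta n ^ 2 * 1)) *
             ((2 * INR n + 1) * ((INR n + 1) * (INR n + 2))))
      with (4 * beta n ^ 2 * ((INR n + 1) * (INR n + 2))) by (field; lra).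
    replace (20 / ((INR n + 1) * (INR n + 2)) * ((2 * INR n + 1) * ((INR n + 1) * (INR n + 2))))
      with (20 * (2 * INR n + 1)) by (field; lra).
    assert (Hu' : INR n * beta n ^ 2 <= 1).
    { apply Rle_trans with (PI * INR n * beta n ^ 2); [|exact Hu].
      rewrite <- (Rmult_1_l (INR n * beta n ^ 2)), Rmult_assoc.
      apply Rmult_le_compat_r; [apply Rmult_le_pos; lra|lra]. }
    set (b := beta n ^ 2) in *. set (m := INR n) in *.
    assert (m * (m * b) <= m * 1) by (apply Rmult_le_compat_l; lra).
    lra. }
  assert (H0 : 0 <= 4 * ln 2 * rF r - rM r).
  { apply (is_series_le (fun _ => 0) _ _ _) with (2 := S1); [|intros n; apply B].
    exact (proj1 (proj1 (is_Cseries_Re_Im _ _) is_Cseries_zero)). }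
  assert (Hup : 4 * ln 2 * rF r - rM r <= 20 * 1).
  { apply (is_series_le _ _ _ _ S1 (is_series_scal_l 20 _ _ is_series_telescope)).
    intros n. apply B. }
  rewrite Rabs_right; lra.
Qed.

Lemma unbounded_ln (a B : R) :
  (forall r, 0 < r < / 2 -> Rabs (a * ln r) <= B) -> a = 0.
Proof.
  intros H. destruct (Req_dec a 0) as [E|E]; [exact E|exfalso].
  assert (Ha := Rabs_pos_lt a E).
  (* Chosen so that |a| T = |a| + |B| + 1 exceeds B at r = exp(- T), while T > 1 keeps r below
     1/2. *)
  set (T := 1 + (Rabs B + 1) / Rabs a).
  assert (HB := Rabs_pos B).
  assert (HT : 1 < T).
  { unfold T. assert (0 < (Rabs B + 1) / Rabs a) by (apply Rdiv_lt_0_compat; lra). lra. }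
  specialize (H (exp (- T))). rewrite ln_exp, Rabs_mult, Rabs_Ropp, (Rabs_right T) in H by lra.
  assert (HaT : Rabs a * T = Rabs a + (Rabs B + 1)) by (unfold T; field; lra).
  assert (HB' := Rle_abs B).
  assert (0 < exp (- T) < / 2); [|specialize (H H0); lra].
  split; [apply exp_pos|]. rewrite exp_Ropp.
  apply Rinv_lt_contravar; generalize (exp_ineq1 T ltac:(lra)); lra.
Qed.

Lemma neg_ln_le (r : R) : 0 < r -> - ln r <= / r - 1.
Proof. intros Hr. rewrite <- ln_Rinv by exact Hr. apply ln_le_sub_1. now apply Rinv_0_lt_compat. Qed.

Lemma is_derive_mult_R (f g : R -> R) (x df dg : R) :
  is_derive f x df -> is_derive g x dg ->
  is_derive (fun t => f t * g t) x (df * g x + f x * dg).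
Proof. intros Hf Hg. exact (is_derive_mult f g x df dg Hf Hg Rmult_comm). Qed.

(* [W] and [K] are the two constants in [hypF (1 - r) = c (hypF r ln r + hypM r) + k hypF r]:
   the behaviour at [1] forces [k = -4 c ln 2], that at [0] forces [c = -1/PI]. *)
Lemma real_connection :
  (forall r, 0 < r < 1 ->
    r * (1 - r) * (rF r * rF' (1 - r) + rF' r * rF (1 - r)) = / PI) /\
  (forall r, 0 < r < 1 ->
    PI * rF (1 - r) = 4 * ln 2 * rF r - (rF r * ln r + rM r)).
Proof.
  assert (HPI := PI_RGT_0).
  (* Up to sign, r (1 - r) times the Wronskian of rF r and rF (1 - r), hence constant on (0, 1). *)
  set (W := fun r => r * (1 - r) * (rF r * rF' (1 - r) + rF' r * rF (1 - r))).
  set (c := - W (/ 2)).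
  assert (Dcomp : forall (f : R -> R) (r l : R), is_derive f (1 - r) l ->
    is_derive (fun t => f (1 - t)) r (- l)).
  { intros f r l Hf. replace (- l) with (scal (-1) l) by (unfold scal; simpl; unfold mult; simpl; ring).
    apply (is_derive_comp f (fun t => 1 - t)); [exact Hf|]. auto_derive; [exact I|ring]. }
  assert (DW : forall r, 0 < r < 1 -> is_derive W r 0).
  { intros r Hr.
    assert (A1 := rF_derive r ltac:(rewrite Rabs_right; lra)).
    assert (A2 := rF'_derive r ltac:(rewrite Rabs_right; lra)).
    assert (A3 := Dcomp _ _ _ (rF_derive (1 - r) ltac:(rewrite Rabs_right; lra))).
    assert (A4 := Dcomp _ _ _ (rF'_derive (1 - r) ltac:(rewrite Rabs_right; lra))).
    assert (O1 := rF_ode r ltac:(rewrite Rabs_right; lra)).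
    assert (O2 := rF_ode (1 - r) ltac:(rewrite Rabs_right; lra)).
    assert (Dp : is_derive (fun t => t * (1 - t)) r (1 - 2 * r)) by (auto_derive; [exact I|ring]).
    unfold W.
    replace 0 with ((1 - 2 * r) * (rF r * rF' (1 - r) + rF' r * rF (1 - r)) +
      r * (1 - r) * ((rF' r * rF' (1 - r) + rF r * - rF'' (1 - r)) +
                     (rF'' r * rF (1 - r) + rF' r * - rF' (1 - r)))).
    - apply (is_derive_mult_R (fun t => t * (1 - t))
        (fun t => rF t * rF' (1 - t) + rF' t * rF (1 - t))); [exact Dp|].
      apply (@is_derive_plus R_AbsRing R_NormedModule (fun t => rF t * rF' (1 - t))
               (fun t => rF' t * rF (1 - t))).
      + apply (is_derive_mult_R rF (fun t => rF' (1 - t))); [exact A1|exact A4].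
      + apply (is_derive_mult_R rF' (fun t => rF (1 - t))); [exact A2|exact A3].
    - transitivity (rF (1 - r) * (r * (1 - r) * rF'' r + (1 - 2 * r) * rF' r - / 4 * rF r) -
        rF r * ((1 - r) * (1 - (1 - r)) * rF'' (1 - r) + (1 - 2 * (1 - r)) * rF' (1 - r)
                 - / 4 * rF (1 - r))); [ring|]. rewrite O1, O2. ring. }
  assert (EW : forall r, 0 < r < 1 -> W r = - c).
  { intros r Hr. unfold c. rewrite Ropp_involutive.
    destruct (Rle_lt_dec r (/ 2)) as [H|H].
    - apply is_derive_0_eq; [exact H|]. intros t Ht. apply DW; lra.
    - symmetry. apply is_derive_0_eq; [lra|]. intros t Ht. apply DW; lra. }
  (* With c = - W, both rF (1 - r) / rF r and c (ln r + rM r / rF r) have derivative c / (r (1 - r)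
     rF r ^ 2), the latter by [r_log_wronskian]. *)
  set (K := fun r => rF (1 - r) / rF r - c * (ln r + rM r / rF r)).
  assert (DK : forall r, 0 < r < 1 -> is_derive K r 0).
  { intros r Hr.
    assert (A1 := rF_derive r ltac:(rewrite Rabs_right; lra)).
    assert (A2 := rM_derive r ltac:(rewrite Rabs_right; lra)).
    assert (A3 := Dcomp _ _ _ (rF_derive (1 - r) ltac:(rewrite Rabs_right; lra))).
    assert (A5 : is_derive ln r (/ r)) by (apply is_derive_ln; lra).
    assert (Hpos := rF_ge_1 r ltac:(lra)). assert (E := EW r Hr).
    assert (V := r_log_wronskian r ltac:(rewrite Rabs_right; lra)).
    unfold K.
    replace 0 with ((- rF' (1 - r) * rF r - rF (1 - r) * rF' r) / rF r ^ 2 -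
       c * (/ r + (rM' r * rF r - rM r * rF' r) / rF r ^ 2)).
    - apply (@is_derive_minus R_AbsRing R_NormedModule (fun t => rF (1 - t) / rF t)
               (fun t => c * (ln t + rM t / rF t))).
      + apply (is_derive_div (fun t => rF (1 - t))); [exact A3|exact A1|lra].
      + apply (is_derive_scal (fun t => ln t + rM t / rF t)).
        apply (@is_derive_plus R_AbsRing R_NormedModule ln (fun t => rM t / rF t));
          [exact A5|].
        apply is_derive_div; [exact A2|exact A1|lra].
    - unfold W in E.
      apply Rmult_eq_reg_l with (r * (1 - r) * rF r ^ 2).
      2:{ apply Rgt_not_eq. repeat apply Rmult_lt_0_compat; lra. }
      transitivity (- (r * (1 - r) * (rF r * rF' (1 - r) + rF' r * rF (1 - r))) -
        c * ((1 - r) * rF r ^ 2 + r * (1 - r) * (rF r * rM' r - rF' r * rM r))); [field; lra|].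
      rewrite E, V. ring. }
  set (k := K (/ 2)).
  assert (EK : forall r, 0 < r < 1 -> rF (1 - r) = c * (rF r * ln r + rM r) + k * rF r).
  { intros r Hr. assert (Hpos := rF_ge_1 r ltac:(lra)).
    assert (E : K r = k).
    { unfold k. destruct (Rle_lt_dec r (/ 2)) as [H|H].
      - apply is_derive_0_eq; [exact H|]. intros t Ht. apply DK; lra.
      - symmetry. apply is_derive_0_eq; [lra|]. intros t Ht. apply DK; lra. }
    rewrite <- E. unfold K. field. lra. }
  (* Near r = 1 every other term of the relation stays bounded, while rF r is at least - ln (1 - r)
     / pi; so the coefficient k + 4 c ln 2 of rF r must vanish. *)
  assert (Hk : k + 4 * ln 2 * c = 0).
  { apply (unbounded_ln _ (PI * (2 + Rabs c * (2 + 20)))). intros s Hs.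
    set (r := 1 - s). assert (Hr : / 2 < r < 1) by (unfold r; lra).
    assert (E := EK r ltac:(lra)). assert (B := rM_rF_bound r ltac:(lra)).
    assert (L := rF_lower r ltac:(lra)). assert (G := rF_geom_upper r ltac:(lra)).
    assert (P := rF_ge_1 r ltac:(lra)).
    assert (G' := rF_geom_upper (1 - r) ltac:(lra)).
    assert (P' := rF_ge_1 (1 - r) ltac:(lra)).
    assert (G2 : rF (1 - r) <= 2).
    { eapply Rle_trans; [exact G'|]. replace 2 with (/ (/ 2)) by field.
      apply Rinv_le_contravar; lra. }
    assert (Hln : Rabs (rF r * ln r) <= 2).
    { assert (ln r < 0) by (rewrite <- ln_1; apply ln_increasing; lra).
      rewrite Rabs_mult, (Rabs_right (rF r)), Rabs_left by lra.
      assert (N := neg_ln_le r ltac:(lra)).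
      assert (N2 : - ln r <= 2 * (1 - r)).
      { eapply Rle_trans; [exact N|]. apply Rmult_le_reg_r with r; [lra|].
        rewrite Rmult_minus_distr_r, Rinv_l by lra. nra. }
      apply Rle_trans with (/ (1 - r) * (2 * (1 - r))); [apply Rmult_le_compat; lra|].
      right. field. lra. }
    assert (Hs0 : ln s < 0) by (rewrite <- ln_1; apply ln_increasing; lra).
    assert (Hs1 : - ln s <= PI * rF r).
    { replace (1 - r) with s in L by (unfold r; ring).
      apply Rmult_le_compat_l with (r := PI) in L; [|lra].
      replace (PI * (- / PI * ln s)) with (- ln s) in L by (field; lra). exact L. }
    rewrite Rabs_mult, (Rabs_left (ln s)) by exact Hs0.
    apply Rle_trans with (Rabs (k + 4 * ln 2 * c) * (PI * rF r)).
    { apply Rmult_le_compat_l; [apply Rabs_pos|exact Hs1]. }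
    rewrite <- (Rabs_right (rF r)), (Rmult_comm PI), <- Rmult_assoc, <- Rabs_mult by lra.
    rewrite Rmult_comm. apply Rmult_le_compat_l; [lra|].
    replace ((k + 4 * ln 2 * c) * rF r)
      with (rF (1 - r) + - c * (rF r * ln r - (4 * ln 2 * rF r - rM r))) by (rewrite E; ring).
    eapply Rle_trans; [apply Rabs_triang|]. rewrite Rabs_mult, Rabs_Ropp.
    apply Rplus_le_compat; [rewrite Rabs_right; lra|].
    apply Rmult_le_compat_l; [apply Rabs_pos|].
    eapply Rle_trans; [apply Rabs_triang|]. rewrite Rabs_Ropp. lra. }
  (* Near r = 0, rF (1 - r) differs from - ln r / pi by at most 1, so (c + 1/pi) ln r is bounded. *)
  assert (Hc : c + / PI = 0).
  { apply (unbounded_ln _ (1 + Rabs c * (2 + 20))). intros r Hr.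
    assert (E := EK r ltac:(lra)). assert (B := rM_rF_bound r ltac:(lra)).
    assert (L := rF_lower (1 - r) ltac:(lra)). assert (U := rF_upper (1 - r) ltac:(lra)).
    replace (1 - (1 - r)) with r in L, U by ring.
    assert (G := rF_geom_upper r ltac:(lra)). assert (P := rF_ge_1 r ltac:(lra)).
    assert (Hln : ln r < 0) by (rewrite <- ln_1; apply ln_increasing; lra).
    assert (N := neg_ln_le r ltac:(lra)).
    assert (G2 : rF r - 1 <= 2 * r).
    { apply Rle_trans with (/ (1 - r) - 1); [lra|].
      apply Rmult_le_reg_r with (1 - r); [lra|].
      rewrite Rmult_minus_distr_r, Rinv_l by lra. nra. }
    assert (Hb : Rabs ((rF r - 1) * ln r) <= 2).
    { rewrite Rabs_mult, (Rabs_right (rF r - 1)), Rabs_left by lra.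
      apply Rle_trans with (2 * r * / r); [apply Rmult_le_compat; lra|]. right; field; lra. }
    replace ((c + / PI) * ln r)
      with ((rF (1 - r) - (- / PI * ln r)) + - c * ((rF r - 1) * ln r - (4 * ln 2 * rF r - rM r))
            - (k + 4 * ln 2 * c) * rF r) by (rewrite E; ring).
    rewrite Hk, Rmult_0_l, Rminus_0_r.
    eapply Rle_trans; [apply Rabs_triang|]. rewrite Rabs_mult, Rabs_Ropp.
    apply Rplus_le_compat; [rewrite Rabs_right; lra|].
    apply Rmult_le_compat_l; [apply Rabs_pos|].
    eapply Rle_trans; [apply Rabs_triang|]. rewrite Rabs_Ropp. lra. }
  assert (Ec : c = - / PI) by lra. assert (Ek : k = 4 * ln 2 * / PI) by (rewrite Ec in Hk; lra).
  split; intros r Hr.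
  - change (W r = / PI). rewrite EW by exact Hr. lra.
  - rewrite (EK r Hr), Ec, Ek. field. lra.
Qed.

Open Scope C_scope.

(** * The nome as a function of x *)

Definition beta_coeff (n : nat) : C := RtoC (beta n).
Definition betaS (x : C) : C := CPS beta_coeff x.
Definition betaS' (x : C) : C := CPS (deriv_coeff beta_coeff) x.

Lemma conv_disc_beta : conv_disc beta_coeff 1.
Proof.
  apply (conv_disc_bounded _ 1). intros n. unfold beta_coeff.
  assert (H := beta_pos n). assert (H' := beta_le_1 n). rewrite Cmod_R, Rabs_right; lra.
Qed.

Lemma betaS_derive (x : C) : (Cmod x < 1)%R -> is_Cderive betaS x (betaS' x).
Proof. apply CPS_derive, conv_disc_beta. Qed.

Lemma betaS_ode (x : C) : (Cmod x < 1)%R -> (1 - x) * betaS' x = / 2 * betaS x.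
Proof.
  intros Hx. symmetry.
  assert (Ha := conv_disc_beta). assert (Hd := conv_disc_deriv _ _ Ha).
  unfold betaS. rewrite <- (CPS_scal _ _ 1) by assumption.
  apply CPS_unique.
  assert (S1 := CPS_correct _ 1 x Hd Hx).
  assert (S2 : is_Cseries (fun n => incr_coeff (deriv_coeff beta_coeff) n * x ^ n) (x * betaS' x)).
  { unfold betaS'. rewrite <- (CPS_incr _ 1) by assumption. apply (CPS_correct _ 1); [|exact Hx].
    now apply conv_disc_incr. }
  generalize (is_Cseries_plus _ _ _ _ S1 (is_Cseries_scal (-(1)) _ _ S2)).
  fold (betaS' x).
  match goal with |- is_series _ ?l -> is_series _ ?m => replace l with m by ring end.
  apply is_Cseries_ext. intros n.
  replace (incr_coeff (deriv_coeff beta_coeff) n) with (RtoC (INR n) * beta_coeff n)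
    by (destruct n as [|n]; [simpl; ring|reflexivity]).
  unfold deriv_coeff, beta_coeff. rewrite S_INR, <- RtoC_mult, beta_rec.
  rewrite <- (RtoC_inv 2) by lra. rewrite RtoC_mult, RtoC_plus. ring.
Qed.

Lemma Cmod_scal_lt_1 (x : C) (t : R) :
  (0 <= t <= 1)%R -> (Cmod x < 1)%R -> (Cmod (0 + RtoC t * x) < 1)%R.
Proof.
  intros Ht Hx. rewrite Cplus_0_l, Cmod_mult, Cmod_R, Rabs_right by lra.
  assert (H := Cmod_ge_0 x). apply Rle_lt_trans with (1 * Cmod x)%R; [|lra].
  apply Rmult_le_compat_r; lra.
Qed.

(** Identifies [betaS] as an inverse square root of 1 - x without choosing a branch; constancy
    follows from [betaS_ode]. *)
Lemma betaS_sq (x : C) : (Cmod x < 1)%R -> (1 - x) * betaS x ^ 2 = 1.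
Proof.
  intros Hx. set (V := fun x => (1 - x) * (betaS x * betaS x)).
  assert (E : V (0 + x) = V 0).
  { apply Cderive_0_segment. intros t Ht. assert (Ht' := Cmod_scal_lt_1 x t Ht Hx).
    set (y := 0 + RtoC t * x) in *. clearbody y.
    assert (O := betaS_ode y Ht'). assert (D := betaS_derive y Ht').
    eapply is_Cderive_eq.
    - unfold V. Cderive_rules.
    - cbv beta.
      transitivity (- (betaS y * betaS y) + 2 * betaS y * ((1 - y) * betaS' y)); [ring|].
      rewrite O. field. }
  rewrite Cplus_0_l in E. transitivity (V x); [unfold V; ring|]. rewrite E.
  unfold V, betaS. rewrite CPS_at_0. unfold beta_coeff. simpl. ring.
Qed.

Definition conv_coeff (n : nat) : R :=
  sum_n (fun k => (beta k ^ 2 * beta (n - k)%nat)%R) n.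

Lemma RtoC_sum_n (u : nat -> R) (n : nat) :
  @sum_n C_AbelianMonoid (fun k => RtoC (u k)) n = RtoC (sum_n u n).
Proof.
  induction n as [|n IH]; [now rewrite !sum_O|].
  rewrite !sum_Sn, IH. symmetry. apply RtoC_plus.
Qed.

Lemma Cconv_hyp_beta (n : nat) : Cconv hyp_coeff beta_coeff n = RtoC (conv_coeff n).
Proof.
  unfold conv_coeff. rewrite <- RtoC_sum_n. apply sum_n_ext. intros k.
  symmetry. apply RtoC_mult.
Qed.

Lemma conv_coeff_pos (n : nat) : (0 <= conv_coeff n)%R.
Proof.
  unfold conv_coeff. rewrite <- (Rmult_0_r (INR (S n))), <- (sum_n_const n 0).
  apply sum_n_m_le. intros k. apply Rmult_le_pos; [left; apply beta_sq_bounds|].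
  left; apply beta_pos.
Qed.

(** Multiplication by 1 - x takes differences of [conv_coeff], whose value at 0 is 1. *)
Definition p_coeff (n : nat) : R :=
  match n with O => 1%R | S k => (conv_coeff (S k) - conv_coeff k)%R end.

(* [hypP] is [sqrt (1 - x) * hypF x], written without a square root. *)
Definition hypP (x : C) : C := (1 - x) * (hypF x * betaS x).

Lemma conv_disc_conv : conv_disc (fun n => RtoC (conv_coeff n)) 1.
Proof.
  apply conv_disc_ext with (Cconv hyp_coeff beta_coeff); [apply Cconv_hyp_beta|].
  apply conv_disc_mult; [apply conv_disc_hyp|apply conv_disc_beta].
Qed.

Lemma p_coeff_eq (n : nat) :
  RtoC (p_coeff n) =
  RtoC (conv_coeff n) + -(1) * incr_coeff (fun n => RtoC (conv_coeff n)) n.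
Proof.
  destruct n as [|n].
  - unfold conv_coeff. rewrite sum_O. simpl. rewrite <- RtoC_opp, <- !RtoC_mult, <- RtoC_plus.
    f_equal. ring.
  - cbn [p_coeff incr_coeff]. rewrite RtoC_minus. ring.
Qed.

Lemma conv_disc_p : conv_disc (fun n => RtoC (p_coeff n)) 1.
Proof.
  eapply conv_disc_ext; [intros n; symmetry; apply p_coeff_eq|].
  apply conv_disc_plus; [apply conv_disc_conv|].
  apply conv_disc_scal, conv_disc_incr, conv_disc_conv.
Qed.

Lemma CPS_conv (x : C) : (Cmod x < 1)%R ->
  CPS (fun n => RtoC (conv_coeff n)) x = hypF x * betaS x.
Proof.
  intros Hx. rewrite <- (CPS_ext (Cconv hyp_coeff beta_coeff)) by apply Cconv_hyp_beta.
  apply (CPS_mult _ _ 1); [apply conv_disc_hyp|apply conv_disc_beta|exact Hx].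
Qed.

Lemma CPS_p (x : C) : (Cmod x < 1)%R -> CPS (fun n => RtoC (p_coeff n)) x = hypP x.
Proof.
  intros Hx. rewrite (CPS_ext _ _ x p_coeff_eq).
  assert (H := conv_disc_conv).
  rewrite (CPS_plus _ _ 1), (CPS_scal _ _ 1), (CPS_incr _ 1)
    by (try assumption; try apply conv_disc_scal; now apply conv_disc_incr).
  rewrite CPS_conv by exact Hx. unfold hypP. ring.
Qed.

(** Conjugation by sqrt(1 - x) turns the hypergeometric equation into (x p')' = - F betaS / (4 (1 -
    x)), whose right side has Taylor coefficients of constant sign. *)
Lemma CPS_p_ode (x : C) : (Cmod x < 1)%R ->
  let p1 := CPS (deriv_coeff (fun n => RtoC (p_coeff n))) in
  let p2 := CPS (deriv_coeff (deriv_coeff (fun n => RtoC (p_coeff n)))) in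
  (1 - x) * (x * p2 x + p1 x) + / 4 * (hypF x * betaS x) = 0.
Proof.
  intros Hx p1 p2.
  assert (near : forall (f g : C -> C) (y l : C), (Cmod y < 1)%R ->
    (forall z, (Cmod z < 1)%R -> f z = g z) -> is_Cderive f y l -> is_Cderive g y l).
  { intros f g y l Hy Hfg. apply (is_Cderive_local f g y l (1 - Cmod y)); [lra|].
    intros h Hh. apply Hfg. generalize (Cmod_triangle y h). lra. }
  assert (E1 : forall y, (Cmod y < 1)%R ->
    (1 - y) * (hypF' y * betaS y) + - / 2 * (hypF y * betaS y) = p1 y).
  { intros y Hy. apply (is_Cderive_unique hypP y).
    - assert (O := betaS_ode y Hy).
      assert (D1 := hypF_derive y Hy). assert (D2 := betaS_derive y Hy). eapply is_Cderive_eq.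
      + unfold hypP. Cderive_rules.
      + cbv beta. transitivity ((1 - y) * (hypF' y * betaS y) - hypF y * betaS y +
          hypF y * ((1 - y) * betaS' y)); [ring|].
        rewrite O. field.
    - apply (near (CPS (fun n => RtoC (p_coeff n)))); [exact Hy|apply CPS_p|].
      apply (CPS_derive _ 1); [apply conv_disc_p|exact Hy]. }
  assert (E2 : (-(1) * (hypF' x * betaS x) + (1 - x) * (hypF'' x * betaS x + hypF' x * betaS' x)) +
     - / 2 * (hypF' x * betaS x + hypF x * betaS' x) = p2 x).
  { apply (is_Cderive_unique (fun y => (1 - y) * (hypF' y * betaS y) +
      - / 2 * (hypF y * betaS y)) x).
    - assert (D1 := hypF_derive x Hx). assert (D2 := betaS_derive x Hx).
      assert (D3 := hypF'_derive x Hx). eapply is_Cderive_eq.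
      + Cderive_rules.
      + cbv beta. ring.
    - apply (near p1); [exact Hx|intros z Hz; symmetry; now apply E1|].
      apply (CPS_derive _ 1); [apply conv_disc_deriv, conv_disc_p|exact Hx]. }
  rewrite <- E1, <- E2 by exact Hx.
  assert (O := betaS_ode x Hx). assert (O' := hypF_ode x Hx).
  (* A combination of the equations satisfied by [hypF] and by [betaS]. *)
  transitivity ((1 - x) * betaS x *
      (x * (1 - x) * hypF'' x + (1 - 2 * x) * hypF' x - / 4 * hypF x) +
    (x * (1 - x) * hypF' x - x * / 2 * hypF x) * ((1 - x) * betaS' x - / 2 * betaS x)).
  - field.
  - rewrite O, O'. ring.
Qed.

(** Compares coefficients in [CPS_p_ode]. As a one-step recurrence it shows that n^2 p_n never
    increases from its value 0 at n = 0. *)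
Lemma p_coeff_rec (n : nat) :
  ((INR n + 1) ^ 2 * p_coeff (S n) = INR n ^ 2 * p_coeff n - / 4 * conv_coeff n)%R.
Proof.
  set (d := fun n => RtoC (p_coeff n)).
  set (g := fun n => incr_coeff (deriv_coeff (deriv_coeff d)) n + deriv_coeff d n).
  assert (Hd := conv_disc_p). fold d in Hd. assert (Hd1 := conv_disc_deriv _ _ Hd).
  assert (Hd2 := conv_disc_deriv _ _ Hd1).
  assert (Hg : conv_disc g 1) by (apply conv_disc_plus; [now apply conv_disc_incr|exact Hd1]).
  set (e := fun n => (g n + -(1) * incr_coeff g n) + / 4 * RtoC (conv_coeff n)).
  assert (H1 : conv_disc (fun n => -(1) * incr_coeff g n) 1)
    by now apply conv_disc_scal, conv_disc_incr.
  assert (H2 : conv_disc (fun n => / 4 * RtoC (conv_coeff n)) 1)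
    by apply conv_disc_scal, conv_disc_conv.
  assert (H3 : conv_disc (fun n => g n + -(1) * incr_coeff g n) 1) by now apply conv_disc_plus.
  assert (He : e n = 0).
  { apply (CPS_zero_coeffs e 1 1 1); try lra.
    - now apply conv_disc_plus.
    - intros F. apply RtoC_inj in F. lra.
    - rewrite Cmod_1. lra.
    - intros s Hs. assert (Hx : (Cmod (RtoC s * 1) < 1)%R)
        by (rewrite Cmult_1_r, Cmod_R, Rabs_right; lra).
      set (x := RtoC s * 1) in *. clearbody x.
      unfold e. rewrite (CPS_plus _ _ 1), (CPS_plus g _ 1), (CPS_scal _ _ 1), (CPS_incr _ 1),
        (CPS_scal _ _ 1), CPS_conv
        by (try assumption; try apply conv_disc_conv; now apply conv_disc_incr).
      unfold g. rewrite (CPS_plus _ _ 1), (CPS_incr _ 1)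
        by (try assumption; now apply conv_disc_incr).
      rewrite <- (CPS_p_ode x Hx). fold d. ring. }
  assert (Eg : forall m, g m = RtoC ((INR m + 1) ^ 2 * p_coeff (S m))).
  { intros m. unfold g. destruct m as [|m]; unfold incr_coeff, deriv_coeff, d.
    - rewrite <- RtoC_mult, <- RtoC_plus. f_equal. simpl. ring.
    - rewrite <- !RtoC_mult, <- RtoC_plus. f_equal. rewrite !S_INR. ring. }
  unfold e in He. rewrite Eg in He.
  replace (incr_coeff g n) with (RtoC (INR n ^ 2 * p_coeff n)) in He.
  - rewrite <- (RtoC_inv 4), <- RtoC_mult, <- RtoC_opp, <- RtoC_mult, <- !RtoC_plus in He by lra.
    apply RtoC_inj in He. lra.
  - destruct n as [|m]; unfold incr_coeff; [f_equal; simpl; ring|]. rewrite Eg, S_INR. reflexivity.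
Qed.

Lemma p_coeff_neg (n : nat) : (p_coeff (S n) <= 0)%R.
Proof.
  assert (H : forall n, (INR n ^ 2 * p_coeff n <= 0)%R).
  { intros m. induction m as [|m IH]; [simpl; lra|].
    rewrite S_INR, p_coeff_rec. generalize (conv_coeff_pos m). lra. }
  specialize (H (S n)). rewrite S_INR in H. assert (Hn := pos_INR n).
  apply Rnot_lt_le; intros Hlt.
  assert (0 < (INR n + 1) ^ 2 * p_coeff (S n))%R; [|lra].
  apply Rmult_lt_0_compat; [apply pow_lt; lra|exact Hlt].
Qed.

Lemma hypP_sq (x : C) : (Cmod x < 1)%R -> hypP x ^ 2 = (1 - x) * hypF x ^ 2.
Proof.
  intros Hx. unfold hypP.
  transitivity ((1 - x) * hypF x ^ 2 * ((1 - x) * betaS x ^ 2)); [ring|].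
  rewrite betaS_sq by exact Hx. ring.
Qed.

(** Since p_n <= 0 for n >= 1, |1 - p(x)| is at most the sum of - p_n |x|^n, which is 1 - p(|x|);
    and p(|x|) > 0 by its product form. So p(x) stays in a disc about 1 that excludes 0. *)
Lemma hypP_bounds (x : C) : (Cmod x < 1)%R -> exists rho : R,
  hypP (RtoC (Cmod x)) = RtoC rho /\ (0 < rho <= 1)%R /\ (Cmod (1 - hypP x) <= 1 - rho)%R.
Proof.
  intros Hx. set (r := Cmod x). assert (Hr : (0 <= r < 1)%R) by (split; [apply Cmod_ge_0|exact Hx]).
  assert (Hrc : (Cmod (RtoC r) < 1)%R) by (rewrite Cmod_R, Rabs_right; lra).
  exists (PSeries p_coeff r).
  assert (E : hypP (RtoC r) = RtoC (PSeries p_coeff r)).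
  { rewrite <- CPS_p by exact Hrc. now apply CPS_RtoC. }
  assert (S1 : is_series (fun n => p_coeff n * r ^ n)%R (PSeries p_coeff r)).
  { apply Series_correct, ex_series_disc_R; [apply conv_disc_p|exact Hr]. }
  assert (S2 := is_series_tail _ _ S1).
  assert (S3 : is_series (fun n => - (p_coeff (S n) * r ^ S n))%R (1 - PSeries p_coeff r)%R).
  { replace (1 - PSeries p_coeff r)%R with (- (PSeries p_coeff r - p_coeff 0 * r ^ 0))%R
      by (simpl; ring).
    exact (is_series_opp _ _ S2). }
  assert (S4 : is_Cseries (fun n => RtoC (p_coeff (S n)) * x ^ S n) (hypP x - 1)).
  { rewrite <- CPS_p, (CPS_shift _ 1) by (try exact Hx; apply conv_disc_p).
    replace (RtoC (p_coeff 0) + x * CPS (shift_coeff (fun n => RtoC (p_coeff n))) x - 1)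
      with (x * CPS (shift_coeff (fun n => RtoC (p_coeff n))) x) by (simpl; ring).
    apply is_Cseries_ext with (fun n => x * (shift_coeff (fun n => RtoC (p_coeff n)) n * x ^ n)).
    - intros n. unfold shift_coeff. rewrite Cpow_S. ring.
    - apply is_Cseries_scal, (CPS_correct _ 1); [apply conv_disc_shift, conv_disc_p|exact Hx]. }
  assert (B : (Cmod (1 - hypP x) <= 1 - PSeries p_coeff r)%R).
  { replace (1 - hypP x) with (- (hypP x - 1)) by ring. rewrite Cmod_opp.
    apply (Cmod_series_le _ _ _ _ S4 S3). intros n.
    rewrite Cmod_mult, Cmod_R, Cmod_pow. fold r.
    generalize (p_coeff_neg n). intros Hp. rewrite Rabs_left1 by exact Hp. lra. }
  split; [exact E|]. split; [|exact B]. split.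
  - assert (Eb : betaS (RtoC r) = RtoC (PSeries beta r)) by now apply CPS_RtoC.
    unfold hypP in E. rewrite hypF_RtoC, Eb, <- RtoC_minus, <- !RtoC_mult in E.
    apply RtoC_inj in E. rewrite <- E.
    apply Rmult_lt_0_compat; [lra|]. apply Rmult_lt_0_compat.
    + generalize (rF_ge_1 r Hr). lra.
    + destruct (Rlt_le_dec 0 (PSeries beta r)) as [H|H]; [exact H|exfalso].
      assert (S5 : is_series (fun n => beta n * r ^ n)%R (PSeries beta r)).
      { apply Series_correct, ex_series_disc_R; [apply conv_disc_beta|exact Hr]. }
      assert (S6 := is_series_tail _ _ S5).
      assert (0 <= PSeries beta r - beta 0 * r ^ 0)%R; [|simpl in *; lra].
      apply (is_series_le (fun _ => 0%R) _ _ _) with (2 := S6).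
      * exact (proj1 (proj1 (is_Cseries_Re_Im _ _) is_Cseries_zero)).
      * intros n. apply Rmult_le_pos; [left; apply beta_pos|apply pow_le; lra].
  - generalize (Cmod_ge_0 (1 - hypP x)). lra.
Qed.

Lemma one_minus_neq_0 (x : C) : (Cmod x < 1)%R -> 1 - x <> 0.
Proof.
  intros Hx F. replace x with (RtoC 1) in Hx.
  - rewrite Cmod_1 in Hx. lra.
  - replace x with (1 - (1 - x)) by ring. rewrite F. ring.
Qed.

Lemma hypP_neq_0 (x : C) : (Cmod x < 1)%R -> hypP x <> 0.
Proof.
  intros Hx F. destruct (hypP_bounds x Hx) as [rho [_ [Hr Hb]]].
  rewrite F in Hb. replace (1 - 0) with (RtoC 1) in Hb by ring. rewrite Cmod_1 in Hb. lra.
Qed.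

Lemma hypF_neq_0 (x : C) : (Cmod x < 1)%R -> hypF x <> 0.
Proof.
  intros Hx F. apply (hypP_neq_0 x Hx). unfold hypP. rewrite F. ring.
Qed.

(* [x / nome x] times the derivative of the nome. *)
Definition nome_ratio (x : C) : C := / ((1 - x) * hypF x ^ 2).

(** 1/w^2 - 1 = ((1 - w) / w) (1/w + 1), and each factor is bounded by its value at [rho] because
    |w| >= rho. *)
Lemma Cinv_sq_sub_1_le (w : C) (rho : R) :
  (0 < rho)%R -> (Cmod (1 - w) <= 1 - rho)%R -> (Cmod (/ w ^ 2 - 1) <= / rho ^ 2 - 1)%R.
Proof.
  intros Hr Hw.
  assert (Hw1 : (rho <= Cmod w)%R).
  { assert (H := Cmod_triangle w (1 - w)). replace (w + (1 - w)) with (RtoC 1) in H by ring.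
    rewrite Cmod_1 in H. lra. }
  assert (Hw0 : w <> 0) by (apply Cmod_gt_0; lra).
  assert (Hi : (Cmod (/ w) <= / rho)%R).
  { rewrite Cmod_inv by exact Hw0. apply Rinv_le_contravar; assumption. }
  assert (Hi0 := Cmod_ge_0 (/ w)).
  assert (Hi1 : (0 < / rho)%R) by now apply Rinv_0_lt_compat.
  replace (/ w ^ 2 - 1) with (((1 - w) * / w) * (/ w + 1)) by (field; exact Hw0).
  replace (/ rho ^ 2 - 1)%R with (((1 - rho) * / rho) * (/ rho + 1))%R by (field; lra).
  rewrite !Cmod_mult.
  assert (H1 : (Cmod (/ w + 1) <= / rho + 1)%R).
  { eapply Rle_trans; [apply Cmod_triangle|]. rewrite Cmod_1. lra. }
  assert (H0 := Cmod_ge_0 (1 - w)).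
  apply Rmult_le_compat; try assumption; [|apply Cmod_ge_0|].
  - now apply Rmult_le_pos.
  - apply Rmult_le_compat; assumption.
Qed.

(** By [hypP_sq], [nome_ratio] is 1/p^2, and the bound for 1/p(x)^2 - 1 is its exact value at
    |x|. *)
Lemma nome_ratio_bound (x : C) : (Cmod x < 1)%R ->
  (Re (nome_ratio x - 1) <= Re (nome_ratio (RtoC (Cmod x)) - 1))%R.
Proof.
  intros Hx. destruct (hypP_bounds x Hx) as [rho [E [Hr Hb]]].
  unfold nome_ratio. rewrite <- !hypP_sq, E.
  - eapply Rle_trans; [apply Rle_abs|]. eapply Rle_trans; [apply re_le_Cmod|].
    eapply Rle_trans; [apply (Cinv_sq_sub_1_le _ rho); [lra|exact Hb]|].
    rewrite <- RtoC_pow, <- RtoC_inv, <- RtoC_minus, re_RtoC; [lra|].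
    apply pow_nonzero; lra.
  - rewrite Cmod_R, Rabs_right; [exact Hx|apply Rle_ge, Cmod_ge_0].
  - exact Hx.
Qed.

(** Regular part of the logarithm of the nome: formally log q = log (x / 16) + H. *)
Definition hypH (x : C) : C := hypM x / hypF x.
Definition hypH' (x : C) : C := (hypM' x * hypF x - hypM x * hypF' x) / (hypF x * hypF x).

Lemma hypH_derive (x : C) : (Cmod x < 1)%R -> is_Cderive hypH x (hypH' x).
Proof.
  intros Hx. apply is_Cderive_div; [now apply hypF_neq_0|now apply hypM_derive|
    now apply hypF_derive].
Qed.

(** The Wronskian identity divided by (1 - x) F^2. *)
Lemma hypH'_eq (x : C) : (Cmod x < 1)%R -> x * hypH' x = nome_ratio x - 1.
Proof.
  intros Hx. assert (W := log_wronskian x Hx).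
  assert (H1 := one_minus_neq_0 x Hx). assert (H2 := hypF_neq_0 x Hx).
  unfold hypH', nome_ratio.
  transitivity ((x * (1 - x) * (hypF x * hypM' x - hypF' x * hypM x)) /
    ((1 - x) * hypF x ^ 2)); [field; auto|].
  replace (x * (1 - x) * (hypF x * hypM' x - hypF' x * hypM x))
    with (1 - (1 - x) * hypF x ^ 2) by (rewrite <- W at 1; ring).
  field. auto.
Qed.

Lemma hypH_0 : hypH 0 = 0.
Proof.
  unfold hypH, hypM. rewrite CPS_at_0. unfold log_coeff. simpl.
  rewrite Rmult_0_r. unfold Cdiv. ring.
Qed.

(** Along the rays to |x| and to x, t times the t-derivative of Re H is Re (nome_ratio - 1) at the
    moving point, so by [nome_ratio_bound] the difference of the two real parts does not decrease
    from its value 0 at t = 0. *)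
Lemma Re_hypH_le (x : C) : (Cmod x < 1)%R ->
  (Re (hypH x) <= Re (hypH (RtoC (Cmod x))))%R.
Proof.
  intros Hx. set (r := RtoC (Cmod x)).
  assert (Hr : (Cmod r < 1)%R).
  { unfold r. rewrite Cmod_R, Rabs_right; [exact Hx|apply Rle_ge, Cmod_ge_0]. }
  set (D := fun t : R => (Re (hypH (0 + RtoC t * r)%C) - Re (hypH (0 + RtoC t * x)%C))%R).
  set (D' := fun t : R => (Re (hypH' (0 + RtoC t * r)%C * r) -
                           Re (hypH' (0 + RtoC t * x)%C * x))%R).
  destruct (MVT_cor2 D D' 0 1) as [c [Hc Hc01]]; [lra| |].
  { intros t Ht. apply is_derive_Reals. unfold D, D'.
    apply (@is_derive_minus R_AbsRing R_NormedModule
      (fun t => Re (hypH (0 + RtoC t * r))) (fun t => Re (hypH (0 + RtoC t * x))));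
    apply is_derive_Re_line, hypH_derive; now apply Cmod_scal_lt_1. }
  assert (HD' : (0 <= D' c)%R).
  { apply Rmult_le_reg_l with c; [lra|]. rewrite Rmult_0_r.
    unfold D'. rewrite Rmult_minus_distr_l, <- !re_scal_l.
    rewrite !Cplus_0_l.
    replace (RtoC c * (hypH' (RtoC c * r) * r)) with (nome_ratio (RtoC c * r) - 1).
    replace (RtoC c * (hypH' (RtoC c * x) * x)) with (nome_ratio (RtoC c * x) - 1).
    - assert (Hcx := Cmod_scal_lt_1 x c ltac:(lra) Hx). rewrite Cplus_0_l in Hcx.
      assert (B := nome_ratio_bound _ Hcx).
      rewrite Cmod_mult, Cmod_R, (Rabs_right c), RtoC_mult in B by lra. fold r in B. lra.
    - rewrite <- hypH'_eq; [ring|].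
      rewrite <- (Cplus_0_l (RtoC c * x)). apply Cmod_scal_lt_1; [lra|exact Hx].
    - rewrite <- hypH'_eq; [ring|].
      rewrite <- (Cplus_0_l (RtoC c * r)). apply Cmod_scal_lt_1; [lra|exact Hr]. }
  unfold D in Hc. rewrite !Cplus_0_l, !Cmult_0_l, !Cmult_1_l, hypH_0 in Hc. lra.
Qed.

Definition nome (x : C) : C := x / 16 * Cexp (hypH x).

Lemma RtoC_neq_0 (r : R) : r <> 0%R -> RtoC r <> 0.
Proof. intros H F. now apply H, RtoC_inj. Qed.

(** The connection formula, exponentiated; 16 is exp (4 ln 2). *)
Lemma real_nome (r : R) : (0 < r < 1)%R ->
  (r / 16 * exp (rM r / rF r) = exp (- (PI * rF (1 - r) / rF r)))%R.
Proof.
  intros Hr. rewrite (proj2 real_connection r Hr).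
  assert (H := rF_ge_1 r ltac:(lra)).
  replace (- ((4 * ln 2 * rF r - (rF r * ln r + rM r)) / rF r))%R
    with (rM r / rF r + ln r + - (4 * ln 2))%R by (field; lra).
  rewrite !exp_plus, exp_ln, exp_Ropp by lra.
  replace (4 * ln 2)%R with (ln 2 + ln 2 + (ln 2 + ln 2))%R by ring.
  rewrite !exp_plus, exp_ln by lra. field.
Qed.

Lemma Cmod_nome_lt_1 (x : C) : (Cmod x < 1)%R -> (Cmod (nome x) < 1)%R.
Proof.
  intros Hx. unfold nome.
  assert (H16 : RtoC 16 <> 0) by (apply RtoC_neq_0; lra).
  rewrite Cmod_mult, Cmod_Cexp, Cmod_div, Cmod_R, (Rabs_right 16) by (lra || exact H16).
  destruct (Rle_lt_or_eq_dec 0 (Cmod x) (Cmod_ge_0 x)) as [H0|<-].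
  2:{ unfold Rdiv. rewrite !Rmult_0_l. lra. }
  assert (Hle := Re_hypH_le x Hx).
  assert (HF := rF_ge_1 (Cmod x) ltac:(lra)).
  assert (E : Re (hypH (RtoC (Cmod x))) = (rM (Cmod x) / rF (Cmod x))%R).
  { unfold hypH. rewrite hypF_RtoC, hypM_RtoC, <- RtoC_div by lra. apply re_RtoC. }
  apply Rle_lt_trans with (Cmod x / 16 * exp (rM (Cmod x) / rF (Cmod x)))%R.
  - apply Rmult_le_compat_l; [lra|]. rewrite <- E.
    destruct Hle as [Hlt|Heq]; [left; now apply exp_increasing|right; now rewrite Heq].
  - rewrite real_nome by lra. apply Rlt_le_trans with (exp 0); [|rewrite exp_0; lra].
    apply exp_increasing.
    assert (HF' := rF_ge_1 (1 - Cmod x) ltac:(lra)). assert (HPI := PI_RGT_0).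
    assert (0 < PI * rF (1 - Cmod x) / rF (Cmod x))%R; [|lra].
    apply Rdiv_lt_0_compat; [|lra]. apply Rmult_lt_0_compat; lra.
Qed.

Lemma nome_derive (x : C) : (Cmod x < 1)%R ->
  is_Cderive nome x (/ 16 * Cexp (hypH x) * nome_ratio x).
Proof.
  intros Hx. assert (D := hypH_derive x Hx). eapply is_Cderive_eq.
  - unfold nome, Cdiv. Cderive_rules.
  - cbv beta. replace (nome_ratio x) with (x * hypH' x + 1) by (rewrite hypH'_eq by exact Hx; ring).
    unfold Cdiv. ring.
Qed.

(** * Identification of q on the slit disc *)

Lemma Cmod_segment_lt_1 (a b : C) (t : R) :
  (0 <= t <= 1)%R -> (Cmod a < 1)%R -> (Cmod b < 1)%R ->
  (Cmod (a + RtoC t * (b - a)) < 1)%R.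
Proof.
  intros Ht Ha Hb.
  replace (a + RtoC t * (b - a)) with (RtoC (1 - t) * a + RtoC t * b)
    by (rewrite RtoC_minus; ring).
  eapply Rle_lt_trans; [apply Cmod_triangle|].
  rewrite !Cmod_mult, !Cmod_R, !Rabs_right by lra.
  assert (Ha0 := Cmod_ge_0 a). assert (Hb0 := Cmod_ge_0 b).
  destruct (Rlt_le_dec t 1) as [H|H].
  - assert ((1 - t) * Cmod a < (1 - t) * 1)%R by (apply Rmult_lt_compat_l; lra).
    assert (t * Cmod b <= t * 1)%R by (apply Rmult_le_compat_l; lra). lra.
  - replace t with 1%R by lra. lra.
Qed.

(** The slit domain is star-shaped about 1/2, the point fixed by x -> 1 - x, where the real results
    apply to both F (x) and F (1 - x). *)
Lemma slit_segment (x : C) (t : R) :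
  (0 <= t <= 1)%R -> slit_plane (1 - x) ->
  slit_plane (1 - (RtoC (/ 2) + RtoC t * (x - RtoC (/ 2)))).
Proof.
  unfold slit_plane. destruct x as [a b]. simpl. intros Ht H.
  destruct (Req_dec t 0) as [->|Ht0]; [right; lra|].
  destruct (Req_dec b 0) as [->|Hb].
  - destruct H as [H|H]; [lra|]. right.
    destruct (Req_dec t 1) as [->|Ht1]; nra.
  - left. intros F. assert (t * b = 0)%R by lra. apply Rmult_integral in H0. lra.
Qed.

Lemma slit_neq_0 (x : C) : slit_plane (1 - x) -> x <> 0.
Proof.
  intros H ->. unfold slit_plane in H. simpl in H. lra.
Qed.

Lemma hyp_ext_reflect_derive (F : C -> C) (hF : is_hyp2F1 (1 / 2) (1 / 2) 1 F) (x : C) :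
  slit_plane (1 - x) -> is_Cderive (fun y => F (1 - y)) x (- C_derive F (1 - x)).
Proof.
  intros Hx. eapply is_Cderive_eq.
  - apply (is_Cderive_comp F (fun y => 1 - y)).
    + apply analytic_is_Cderive. now apply hF.
    + apply is_Cderive_minus; [apply is_Cderive_const|apply is_Cderive_id].
  - ring.
Qed.

Lemma hyp_ext_reflect_derive2 (F : C -> C) (hF : is_hyp2F1 (1 / 2) (1 / 2) 1 F) (x : C) :
  slit_plane (1 - x) ->
  is_Cderive (fun y => C_derive F (1 - y)) x (- C_derive (C_derive F) (1 - x)).
Proof.
  intros Hx. eapply is_Cderive_eq.
  - apply (is_Cderive_comp (C_derive F) (fun y => 1 - y)).
    + apply analytic_is_Cderive, analytic_C_derive. now apply hF.
    + apply is_Cderive_minus; [apply is_Cderive_const|apply is_Cderive_id].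
  - ring.
Qed.

Lemma Cmod_half : (Cmod (RtoC (/ 2)) < 1)%R.
Proof. rewrite Cmod_R, Rabs_right; lra. Qed.

Lemma one_minus_half : 1 - RtoC (/ 2) = RtoC (/ 2).
Proof. rewrite <- RtoC_minus. f_equal. field. Qed.

(** Abel's identity along the segment from 1/2, where the constant is the real Wronskian found in
    [real_connection]. *)
Lemma wronskian (F : C -> C) (hF : is_hyp2F1 (1 / 2) (1 / 2) 1 F) (x : C) :
  (Cmod x < 1)%R -> slit_plane (1 - x) ->
  x * (1 - x) * (hypF x * C_derive F (1 - x) + hypF' x * F (1 - x)) = RtoC (/ PI).
Proof.
  intros Hx Hs.
  set (W := fun x => (x * (1 - x)) * (hypF x * C_derive F (1 - x) + hypF' x * F (1 - x))).
  assert (E : W (RtoC (/ 2) + (x - RtoC (/ 2))) = W (RtoC (/ 2))).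
  { apply Cderive_0_segment. intros t Ht.
    assert (Hy := Cmod_segment_lt_1 _ x t Ht Cmod_half Hx).
    assert (Hys := slit_segment x t Ht Hs).
    set (y := RtoC (/ 2) + RtoC t * (x - RtoC (/ 2))) in *. clearbody y.
    assert (O1 := hypF_ode y Hy). assert (O2 := hyp_ext_ode F hF _ Hys).
    assert (D1 := hypF_derive y Hy). assert (D2 := hypF'_derive y Hy).
    assert (D3 := hyp_ext_reflect_derive F hF y Hys).
    assert (D4 := hyp_ext_reflect_derive2 F hF y Hys).
    eapply is_Cderive_eq.
    - unfold W. Cderive_rules.
    - cbv beta.
      transitivity (F (1 - y) * (y * (1 - y) * hypF'' y + (1 - 2 * y) * hypF' y - / 4 * hypF y)
        - hypF y * ((1 - y) * (1 - (1 - y)) * C_derive (C_derive F) (1 - y) +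
            (1 - 2 * (1 - y)) * C_derive F (1 - y) - / 4 * F (1 - y))); [ring|].
      rewrite O1, O2. ring. }
  replace (RtoC (/ 2) + (x - RtoC (/ 2))) with x in E by ring.
  transitivity (W x); [reflexivity|]. rewrite E. unfold W.
  rewrite one_minus_half, (hyp_ext_C_derive_disc F hF), (hyp_ext_disc F hF) by apply Cmod_half.
  rewrite hypF_RtoC, hypF'_RtoC, <- !RtoC_mult, <- RtoC_plus, <- RtoC_mult. f_equal.
  rewrite <- (proj1 real_connection (/ 2)%R) by lra.
  replace (1 - / 2)%R with (/ 2)%R by field. reflexivity.
Qed.

(** Dividing by x outside the exponential avoids a complex logarithm. The quotient [E] has zero
    derivative by [wronskian] and [hypH'_eq], and [real_nome] gives its value 1/16 at 1/2. *)
Lemma nome_eq_slit (F : C -> C) (hF : is_hyp2F1 (1 / 2) (1 / 2) 1 F) (x : C) :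
  (Cmod x < 1)%R -> slit_plane (1 - x) ->
  Cexp (- (RtoC PI * (F (1 - x) / F x))) = nome x.
Proof.
  intros Hx Hs. rewrite (hyp_ext_disc F hF x Hx).
  assert (HPI : RtoC PI <> 0) by (apply RtoC_neq_0; generalize PI_RGT_0; lra).
  set (E := fun x => Cexp (- (RtoC PI * (F (1 - x) / hypF x)) - hypH x) / x).
  assert (EE : E (RtoC (/ 2) + (x - RtoC (/ 2))) = E (RtoC (/ 2))).
  { apply Cderive_0_segment. intros t Ht.
    assert (Hy := Cmod_segment_lt_1 _ x t Ht Cmod_half Hx).
    assert (Hys := slit_segment x t Ht Hs).
    set (y := RtoC (/ 2) + RtoC t * (x - RtoC (/ 2))) in *. clearbody y.
    assert (Hy0 := slit_neq_0 y Hys). assert (HF0 := hypF_neq_0 y Hy).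
    assert (W := wronskian F hF y Hy Hys). assert (H1 := one_minus_neq_0 y Hy).
    assert (D1 := hypF_derive y Hy). assert (D2 := hypH_derive y Hy).
    assert (D3 := hyp_ext_reflect_derive F hF y Hys).
    eapply is_Cderive_eq.
    - unfold E. Cderive_rules; assumption.
    - cbv beta. set (e := Cexp _).
      assert (HH : hypH' y = (nome_ratio y - 1) / y)
        by (rewrite <- hypH'_eq by exact Hy; field; exact Hy0).
      rewrite HH. unfold nome_ratio.
      transitivity (e / (y * y) *
        (RtoC PI * (y * (1 - y) * (hypF y * C_derive F (1 - y) + hypF' y * F (1 - y))) - 1) /
        ((1 - y) * hypF y ^ 2)); [field; auto|].
      rewrite W, RtoC_inv by (generalize PI_RGT_0; lra).
      replace (RtoC PI * / RtoC PI) with (RtoC 1) by (field; exact HPI).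
      unfold Cdiv. ring. }
  replace (RtoC (/ 2) + (x - RtoC (/ 2))) with x in EE by ring.
  assert (E0 : E (RtoC (/ 2)) = / 16).
  { unfold E. rewrite one_minus_half, (hyp_ext_disc F hF) by apply Cmod_half.
    assert (H := rF_ge_1 (/ 2) ltac:(lra)). assert (R := real_nome (/ 2) ltac:(lra)).
    replace (1 - / 2)%R with (/ 2)%R in R by field.
    unfold hypH. rewrite hypF_RtoC, hypM_RtoC, <- !RtoC_div, <- RtoC_mult, <- RtoC_opp,
      <- RtoC_minus, Cexp_RtoC, <- RtoC_div by lra.
    rewrite <- RtoC_inv by lra. f_equal.
    unfold Rminus. rewrite exp_plus, exp_Ropp.
    replace (PI * (rF (/ 2) / rF (/ 2)))%R with (PI * rF (/ 2) / rF (/ 2))%R by (field; lra).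
    assert (Hp := exp_pos (rM (/ 2) / rF (/ 2))).
    rewrite <- exp_Ropp, <- R, exp_Ropp. field. lra. }
  rewrite E0 in EE. unfold E in EE.
  assert (Hx0 := slit_neq_0 x Hs).
  set (A := - (RtoC PI * (F (1 - x) / hypF x))) in *.
  replace A with ((A - hypH x) + hypH x) by ring. rewrite Cexp_plus.
  unfold nome. f_equal.
  transitivity (x * (Cexp (A - hypH x) / x)); [field; exact Hx0|]. rewrite EE.
  unfold Cdiv. ring.
Qed.

(** * Boundary values on the cut *)

Definition Clim (u : nat -> C) (l : C) : Prop :=
  forall eps : R, (0 < eps)%R -> exists N, forall n, (N <= n)%nat -> (Cmod (u n - l) < eps)%R.

Lemma Clim_unique (u : nat -> C) (l m : C) : Clim u l -> Clim u m -> l = m.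
Proof.
  intros Hl Hm. apply Ceq_minus, Cmod_eq_0. apply Rle_antisym; [|apply Cmod_ge_0].
  apply Rnot_lt_le; intros Hlt.
  destruct (Hl (Cmod (l - m) / 2)%R ltac:(lra)) as [N1 H1].
  destruct (Hm (Cmod (l - m) / 2)%R ltac:(lra)) as [N2 H2].
  specialize (H1 (max N1 N2) ltac:(lia)). specialize (H2 (max N1 N2) ltac:(lia)).
  set (v := u (max N1 N2)) in *.
  assert (H := Cmod_triangle (- (v - l)) (v - m)). rewrite Cmod_opp in H.
  replace (- (v - l) + (v - m)) with (l - m) in H by ring. lra.
Qed.

Lemma Clim_ext (u v : nat -> C) (l : C) (N : nat) :
  (forall n, (N <= n)%nat -> u n = v n) -> Clim u l -> Clim v l.
Proof.
  intros H Hu eps He. destruct (Hu eps He) as [N' HN]. exists (max N N'). intros n Hn.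
  rewrite <- H by lia. apply HN. lia.
Qed.

Lemma Clim_comp (f : C -> C) (d : C) (u : nat -> C) (l : C) :
  is_Cderive f l d -> Clim u l -> Clim (fun n => f (u n)) (f l).
Proof.
  intros Hf Hu eps He. destruct (is_Cderive_lipschitz f l d Hf) as [r [Hr H]].
  assert (Hd := Cmod_ge_0 d).
  destruct (Hu (Rmin r (eps / (Cmod d + 1)))%R) as [N HN].
  { apply Rmin_glb_lt; [exact Hr|]. apply Rdiv_lt_0_compat; lra. }
  exists N. intros n Hn. specialize (HN n Hn).
  assert (H1 := Rmin_l r (eps / (Cmod d + 1))). assert (H2 := Rmin_r r (eps / (Cmod d + 1))).
  specialize (H (u n - l) ltac:(lra)). replace (l + (u n - l)) with (u n) in H by ring.
  eapply Rle_lt_trans; [exact H|].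
  replace eps with ((Cmod d + 1) * (eps / (Cmod d + 1)))%R by (field; lra).
  apply Rmult_lt_compat_l; lra.
Qed.

Lemma Clim_mult (u v : nat -> C) (l m : C) :
  Clim u l -> Clim v m -> Clim (fun n => u n * v n) (l * m).
Proof.
  intros Hu Hv eps He. assert (Hl := Cmod_ge_0 l). assert (Hm := Cmod_ge_0 m).
  set (e := Rmin 1 (eps / (Cmod l + Cmod m + 2))%R).
  assert (He0 : (0 < e)%R).
  { apply Rmin_glb_lt; [lra|]. apply Rdiv_lt_0_compat; lra. }
  assert (He1 : (e <= 1)%R) by apply Rmin_l.
  assert (He2 : (e <= eps / (Cmod l + Cmod m + 2))%R) by apply Rmin_r.
  destruct (Hu e He0) as [N1 H1]. destruct (Hv e He0) as [N2 H2].
  exists (max N1 N2). intros n Hn. specialize (H1 n ltac:(lia)). specialize (H2 n ltac:(lia)).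
  replace (u n * v n - l * m) with ((u n - l) * (v n - m) + (l * (v n - m) + (u n - l) * m))
    by ring.
  assert (Hc1 := Cmod_ge_0 (u n - l)). assert (Hc2 := Cmod_ge_0 (v n - m)).
  assert (T1 : (Cmod ((u n - l) * (v n - m) + (l * (v n - m) + (u n - l) * m)) <=
    Cmod (u n - l) * Cmod (v n - m) + (Cmod l * Cmod (v n - m) + Cmod (u n - l) * Cmod m))%R).
  { eapply Rle_trans; [apply Cmod_triangle|]. rewrite Cmod_mult.
    apply Rplus_le_compat_l. eapply Rle_trans; [apply Cmod_triangle|]. rewrite !Cmod_mult. lra. }
  assert (T2 : (Cmod (u n - l) * Cmod (v n - m) <= e * 1)%R) by (apply Rmult_le_compat; lra).
  assert (T3 : (Cmod l * Cmod (v n - m) <= Cmod l * e)%R) by (apply Rmult_le_compat_l; lra).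
  assert (T4 : (Cmod (u n - l) * Cmod m <= e * Cmod m)%R) by (apply Rmult_le_compat_r; lra).
  assert (T5 : (e * (Cmod l + Cmod m + 2) <= eps)%R).
  { apply Rmult_le_compat_r with (r := (Cmod l + Cmod m + 2)%R) in He2; [|lra].
    replace (eps / (Cmod l + Cmod m + 2) * (Cmod l + Cmod m + 2))%R with eps in He2
      by (field; lra). exact He2. }
  lra.
Qed.

Lemma Clim_vertical (a : C) (s : R) :
  (Rabs s = 1)%R -> Clim (fun n => a + RtoC (s / (INR n + 1)) * Ci) a.
Proof.
  intros Hs eps He. destruct (archimed_cor1 eps He) as [N [HN HN0]].
  exists N. intros n Hn.
  replace (a + RtoC (s / (INR n + 1)) * Ci - a) with (RtoC (s / (INR n + 1)) * Ci) by ring.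
  rewrite Cmod_mult, Cmod_Ci, Cmod_R, Rmult_1_r.
  assert (HN1 : (0 < INR N)%R) by now apply lt_0_INR.
  assert (HNn : (INR N <= INR n)%R) by now apply le_INR.
  unfold Rdiv. rewrite Rabs_mult, Hs, Rmult_1_l, Rabs_right.
  - apply Rlt_trans with (/ INR N)%R; [|exact HN].
    apply Rinv_lt_contravar; [apply Rmult_lt_0_compat|]; lra.
  - apply Rle_ge. left. apply Rinv_0_lt_compat. lra.
Qed.

Lemma Clim_within (F : C -> C) (P : C -> Prop) (a v : C) (u : nat -> C) :
  filterlim F (within P (locally a)) (locally v) ->
  (forall n, P (u n)) -> Clim u a -> Clim (fun n => F (u n)) v.
Proof.
  intros HF HP Hu eps He.
  (* Balls of the uniform structure on C are squares, so eps / 2 in each coordinate bounds the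
     modulus by eps. *)
  assert (He2 : (0 < eps / 2)%R) by lra.
  assert (L : locally v (fun y : C => (Cmod (y - v) < eps)%R)).
  { exists (mkposreal _ He2). intros y [H1 H2].
    change (Rabs (Re y - Re v) < eps / 2)%R in H1. change (Rabs (Im y - Im v) < eps / 2)%R in H2.
    eapply Rle_lt_trans; [apply Cmod_le_Re_Im|].
    replace (Re (y - v)) with (Re y - Re v)%R by (destruct y, v; simpl; ring).
    replace (Im (y - v)) with (Im y - Im v)%R by (destruct y, v; simpl; ring). lra. }
  destruct (HF _ L) as [d Hd].
  destruct (Hu d (cond_pos d)) as [N HN]. exists N. intros n Hn.
  apply Hd; [|apply HP]. specialize (HN n Hn).
  split.
  - change (Rabs (Re (u n) - Re a) < d)%R. eapply Rle_lt_trans; [|exact HN].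
    replace (Re (u n) - Re a)%R with (Re (u n - a)) by (destruct (u n), a; simpl; ring).
    apply re_le_Cmod.
  - change (Rabs (Im (u n) - Im a) < d)%R. eapply Rle_lt_trans; [|exact HN].
    replace (Im (u n) - Im a)%R with (Im (u n - a)) by (destruct (u n), a; simpl; ring).
    apply im_le_Cmod.
Qed.

(** On the cut, x is approached vertically so that 1 - y comes from the side that defines w: F (1 -
    y) then tends to w, while [nome] is continuous at x. As [nome] does not depend on the side,
    neither does q. *)
Lemma nome_eq_branch (F : C -> C) (hF : is_hyp2F1 (1 / 2) (1 / 2) 1 F) (x w : C) :
  (Cmod x < 1)%R -> is_branch_value F (1 - x) w ->
  Cexp (- (RtoC PI * (w / F x))) = nome x.
Proof.
  intros Hx [[Hs ->]|[Hs Hlim]]; [now apply nome_eq_slit|].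
  assert (Him : Im (1 - x) = 0%R).
  { destruct (Req_dec (Im (1 - x)) 0) as [E|E]; [exact E|]. exfalso. apply Hs. now left. }
  assert (K : exists s : R, Rabs s = 1%R /\
    Clim (fun n => F (1 - x + RtoC (s / (INR n + 1)) * Ci)) w).
  { assert (Hpos : forall n, (0 < / (INR n + 1))%R).
    { intros n. apply Rinv_0_lt_compat. generalize (pos_INR n); lra. }
    assert (Hi : forall s n, Im (1 - x + RtoC (s / (INR n + 1)) * Ci) = (s * / (INR n + 1))%R).
    { intros s n. rewrite im_plus, Him, im_scal_l. simpl. unfold Rdiv. ring. }
    destruct Hlim as [H|H].
    - exists 1%R. split; [apply Rabs_R1|].
      apply (Clim_within F _ _ _ (fun n => 1 - x + RtoC (1 / (INR n + 1)) * Ci) H).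
      + intros n. rewrite Hi. generalize (Hpos n); lra.
      + apply Clim_vertical, Rabs_R1.
    - assert (H1 : Rabs (-1) = 1%R) by (rewrite Rabs_left; lra).
      exists (-1)%R. split; [exact H1|].
      apply (Clim_within F _ _ _ (fun n => 1 - x + RtoC (-1 / (INR n + 1)) * Ci) H).
      + intros n. rewrite Hi. generalize (Hpos n); lra.
      + now apply Clim_vertical. }
  destruct K as [s [Hs1 HL]].
  (* The sign of s is reversed because 1 - y moves opposite to y. *)
  set (y := fun n : nat => x + RtoC ((- s) / (INR n + 1)) * Ci).
  assert (Hy : Clim y x) by (apply Clim_vertical; now rewrite Rabs_Ropp).
  assert (E1 : forall n, 1 - x + RtoC (s / (INR n + 1)) * Ci = 1 - y n).
  { intros n. unfold y, Rdiv. rewrite Ropp_mult_distr_l_reverse, RtoC_opp. ring. }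
  assert (HL' : Clim (fun n => F (1 - y n)) w).
  { apply (Clim_ext (fun n => F (1 - x + RtoC (s / (INR n + 1)) * Ci)) _ _ 0); [|exact HL].
    intros n _. now rewrite E1. }
  assert (HF0 : hypF x <> 0) by now apply hypF_neq_0.
  assert (L1 : Clim (fun n => Cexp (- (RtoC PI * (F (1 - y n) / hypF (y n)))))
                 (Cexp (- (RtoC PI * (w / hypF x))))).
  { apply (Clim_comp (fun v => Cexp (- (RtoC PI * v)))
      (Cexp (- (RtoC PI * (w / hypF x))) * - (0 * (w / hypF x) + RtoC PI * 1))).
    - Cderive_rules.
    - apply Clim_mult; [exact HL'|].
      apply (Clim_comp (fun v => / hypF v) (- / (hypF x * hypF x) * hypF' x)); [|exact Hy].
      apply (is_Cderive_comp Cinv hypF); [now apply is_Cderive_Cinv|now apply hypF_derive]. }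
  assert (L2 : Clim (fun n => nome (y n)) (nome x)).
  { eapply Clim_comp; [now apply nome_derive|exact Hy]. }
  rewrite (hyp_ext_disc F hF x Hx).
  apply (Clim_unique _ _ _ L1).
  (* Only from some index on is the sequence known to lie in the unit disc. *)
  destruct (Hy (1 - Cmod x)%R ltac:(lra)) as [N HN].
  apply (Clim_ext (fun n => nome (y n)) _ _ N); [|exact L2].
  intros n Hn. specialize (HN n Hn).
  assert (Hyn : (Cmod (y n) < 1)%R).
  { assert (T := Cmod_triangle (y n - x) x). replace (y n - x + x) with (y n) in T by ring. lra. }
  rewrite <- (nome_eq_slit F hF _ Hyn).
  - now rewrite (hyp_ext_disc F hF _ Hyn).
  - left. rewrite <- E1, im_plus, Him, im_scal_l.
    assert (0 < / (INR n + 1))%R by (apply Rinv_0_lt_compat; generalize (pos_INR n); lra).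
    simpl. unfold Rdiv. rewrite Rplus_0_l, Rmult_1_r.
    apply Rmult_integral_contrapositive_currified; [|lra].
    intros ->. rewrite Rabs_R0 in Hs1. lra.
Qed.

(** * Convolution of divisor sums *)

(** The index runs over 1, ..., B, the range of possible divisors of B. *)
Fixpoint sum1 (f : nat -> C) (B : nat) : C :=
  match B with O => 0 | S k => sum1 f k + f (S k) end.

Lemma sum1_ext (f g : nat -> C) (B : nat) :
  (forall i, (1 <= i <= B)%nat -> f i = g i) -> sum1 f B = sum1 g B.
Proof.
  induction B as [|B IH]; intros H; [reflexivity|].
  simpl. rewrite IH by (intros; apply H; lia). now rewrite H by lia.
Qed.

Lemma sum1_plus (f g : nat -> C) (B : nat) :
  sum1 (fun i => f i + g i) B = sum1 f B + sum1 g B.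
Proof. induction B as [|B IH]; simpl; [ring|]. rewrite IH. ring. Qed.

Lemma sum1_minus (f g : nat -> C) (B : nat) :
  sum1 (fun i => f i - g i) B = sum1 f B - sum1 g B.
Proof. induction B as [|B IH]; simpl; [ring|]. rewrite IH. ring. Qed.

Lemma sum1_scal (c : C) (f : nat -> C) (B : nat) : sum1 (fun i => c * f i) B = c * sum1 f B.
Proof. induction B as [|B IH]; simpl; [ring|]. rewrite IH. ring. Qed.

Lemma sum1_zero (f : nat -> C) (B : nat) :
  (forall i, (1 <= i <= B)%nat -> f i = 0) -> sum1 f B = 0.
Proof.
  induction B as [|B IH]; intros H; [reflexivity|].
  simpl. rewrite IH by (intros; apply H; lia). rewrite H by lia. ring.
Qed.

Lemma sum1_swap (f : nat -> nat -> C) (A B : nat) :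
  sum1 (fun i => sum1 (fun j => f i j) B) A = sum1 (fun j => sum1 (fun i => f i j) A) B.
Proof.
  induction A as [|A IH]; simpl.
  - symmetry. now apply sum1_zero.
  - rewrite IH, <- sum1_plus. reflexivity.
Qed.

Lemma sum1_vanish (f : nat -> C) (B B' : nat) :
  (B <= B')%nat -> (forall i, (B < i)%nat -> f i = 0) -> sum1 f B' = sum1 f B.
Proof.
  intros HB H. induction HB as [|B' HB IH]; [reflexivity|].
  simpl. rewrite IH, H by lia. ring.
Qed.

Definition ind (b : bool) : C := if b then 1 else 0.

(** The substitution m = a + b. As g vanishes beyond n, truncation at n is harmless and finite sums
    are rearranged like infinite ones. *)
Lemma sum1_shift (g : nat -> C) (a n : nat) :
  (forall m, (n < m)%nat -> g m = 0) ->
  sum1 (fun b => g (a + b)%nat) n = sum1 (fun m => ind (a <? m)%nat * g m) n.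
Proof.
  intros Hg.
  rewrite <- (sum1_vanish (fun m => ind (a <? m)%nat * g m) n (a + n)); [|lia|].
  - clear Hg. induction n as [|n IH].
    + rewrite Nat.add_0_r. symmetry. apply sum1_zero. intros i Hi.
      replace (a <? i)%nat with false by (symmetry; apply Nat.ltb_ge; lia). simpl. ring.
    + rewrite Nat.add_succ_r. simpl. rewrite IH, Nat.add_succ_r.
      replace (a <? S (a + n))%nat with true by (symmetry; apply Nat.ltb_lt; lia).
      simpl. ring.
  - intros i Hi. rewrite Hg by exact Hi. ring.
Qed.

Lemma sum1_ind_lt (f : nat -> C) (m n : nat) : (1 <= m <= n)%nat ->
  sum1 (fun c => ind (c <? m)%nat * f c) n = sum1 f (m - 1).
Proof.
  intros Hm. rewrite (sum1_vanish _ (m - 1) n); [|lia|].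
  - apply sum1_ext. intros i Hi.
    replace (i <? m)%nat with true by (symmetry; apply Nat.ltb_lt; lia). simpl. ring.
  - intros i Hi. replace (i <? m)%nat with false by (symmetry; apply Nat.ltb_ge; lia).
    simpl. ring.
Qed.

Lemma sum1_symmetric (k : nat -> nat -> C) (n : nat) :
  (forall a b, k a b = k b a) ->
  sum1 (fun a => sum1 (fun b => k a b) n) n =
  sum1 (fun a => k a a) n + 2 * sum1 (fun m => sum1 (fun a => ind (a <? m)%nat * k m a) n) n.
Proof.
  intros Hk.
  transitivity (sum1 (fun a => sum1 (fun b => ind (b <? a)%nat * k a b) n +
     (k a a + sum1 (fun b => ind (a <? b)%nat * k b a) n)) n).
  - apply sum1_ext. intros a Ha.
    replace (k a a) with (sum1 (fun b => ind (a =? b)%nat * k a b) n).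
    + rewrite <- !sum1_plus. apply sum1_ext. intros b Hb. rewrite (Hk b a).
      destruct (Nat.ltb_spec b a), (Nat.eqb_spec a b), (Nat.ltb_spec a b);
        simpl; try lia; ring.
    + rewrite (sum1_vanish _ a n); [|lia|].
      * destruct a as [|a]; [lia|]. simpl. rewrite Nat.eqb_refl, sum1_zero; [simpl; ring|].
        intros i Hi. replace (match i with O => false | S m' => (a =? m')%nat end)
          with (S a =? i)%nat by reflexivity.
        replace (S a =? i)%nat with false by (symmetry; apply Nat.eqb_neq; lia). simpl. ring.
      * intros i Hi. replace (a =? i)%nat with false by (symmetry; apply Nat.eqb_neq; lia).
        simpl. ring.
  - rewrite sum1_plus, sum1_plus.
    rewrite (sum1_swap (fun a b => ind (a <? b)%nat * k b a)). ring.
Qed.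

(* Coefficients of [q ^ a / (1 - q ^ a)]. *)
Definition Nmul (a n : nat) : C := ind ((1 <=? n)%nat && (n mod a =? 0)%nat).

Lemma Nmul_small (a n : nat) : (n < a)%nat -> Nmul a n = 0.
Proof.
  intros H. unfold Nmul. destruct n as [|n]; [reflexivity|].
  rewrite Nat.mod_small by exact H. reflexivity.
Qed.

Lemma Nmul_add (a n : nat) : (1 <= a)%nat ->
  Nmul a (a + n) = Nmul a n + ind (n =? 0)%nat.
Proof.
  intros Ha. unfold Nmul.
  replace ((a + n) mod a)%nat with (n mod a)%nat.
  - replace (1 <=? a + n)%nat with true by (symmetry; apply Nat.leb_le; lia).
    destruct n as [|n]; simpl.
    + rewrite Nat.Div0.mod_0_l. simpl. ring.
    + ring.
  - replace (a + n)%nat with (n + 1 * a)%nat by lia. symmetry. apply Nat.Div0.mod_add.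
Qed.

Lemma Cmod_ind_le (b : bool) : (Cmod (ind b) <= 1)%R.
Proof. destruct b; simpl; [rewrite Cmod_1|rewrite Cmod_0]; lra. Qed.

Lemma conv_disc_Nmul (a : nat) : conv_disc (Nmul a) 1.
Proof.
  apply (conv_disc_bounded _ 1). intros n. apply Cmod_ind_le.
Qed.

Fixpoint incr_n (k : nat) (a : nat -> C) : nat -> C :=
  match k with O => a | S k => incr_coeff (incr_n k a) end.

Lemma incr_n_small (k : nat) (a : nat -> C) (n : nat) : (n < k)%nat -> incr_n k a n = 0.
Proof.
  revert n. induction k as [|k IH]; intros n Hn; [lia|].
  destruct n as [|n]; [reflexivity|]. simpl. apply IH. lia.
Qed.

Lemma incr_n_add (k : nat) (a : nat -> C) (n : nat) : incr_n k a (k + n) = a n.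
Proof. induction k as [|k IH]; [reflexivity|]. exact IH. Qed.

Lemma conv_disc_incr_n (k : nat) (a : nat -> C) (rho : R) :
  conv_disc a rho -> conv_disc (incr_n k a) rho.
Proof. intros Ha. induction k as [|k IH]; [exact Ha|]. now apply conv_disc_incr. Qed.

Lemma CPS_incr_n (k : nat) (a : nat -> C) (rho : R) (z : C) :
  conv_disc a rho -> (Cmod z < rho)%R -> CPS (incr_n k a) z = z ^ k * CPS a z.
Proof.
  intros Ha Hz. induction k as [|k IH]; [simpl; ring|].
  cbn [incr_n]. rewrite (CPS_incr _ rho), IH, Cpow_S by (try exact Hz; now apply conv_disc_incr_n).
  ring.
Qed.

Definition delta0 (n : nat) : C := ind (n =? 0)%nat.

Lemma conv_disc_delta0 : conv_disc delta0 1.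
Proof.
  apply (conv_disc_bounded _ 1). intros n. apply Cmod_ind_le.
Qed.

(** Reduces coefficient identities to generating functions, where [Nmul a] becomes the rational
    function z^a / (1 - z^a). *)
Lemma CPS_inj (a b : nat -> C) :
  conv_disc a 1 -> conv_disc b 1 ->
  (forall z, (Cmod z < 1)%R -> CPS a z = CPS b z) -> forall n, a n = b n.
Proof.
  intros Ha Hb H n. apply Ceq_minus.
  assert (Hb' : conv_disc (fun n => -(1) * b n) 1) by now apply conv_disc_scal.
  transitivity (a n + -(1) * b n); [ring|].
  apply (CPS_zero_coeffs (fun n => a n + -(1) * b n) 1 1 1); try lra.
  - now apply conv_disc_plus.
  - intros F. apply RtoC_inj in F. lra.
  - rewrite Cmod_1. lra.
  - intros s Hs. assert (Hx : (Cmod (RtoC s * 1) < 1)%R)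
      by (rewrite Cmult_1_r, Cmod_R, Rabs_right; lra).
    rewrite (CPS_plus _ _ 1), (CPS_scal _ _ 1), H by assumption. ring.
Qed.

Lemma CPS_delta0 (z : C) : (Cmod z < 1)%R -> CPS delta0 z = 1.
Proof.
  intros Hz. rewrite (CPS_shift _ 1) by (try exact Hz; apply conv_disc_delta0).
  rewrite CPS_zero by reflexivity. unfold delta0; simpl; ring.
Qed.

Lemma Nmul_incr (a n : nat) : (1 <= a)%nat ->
  Nmul a n = incr_n a (fun k => Nmul a k + delta0 k) n.
Proof.
  intros Ha. destruct (Nat.lt_ge_cases n a) as [H|H].
  - now rewrite Nmul_small, incr_n_small.
  - replace n with (a + (n - a))%nat by lia. rewrite incr_n_add. now apply Nmul_add.
Qed.

Lemma CPS_Nmul (a : nat) (z : C) : (1 <= a)%nat -> (Cmod z < 1)%R ->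
  CPS (Nmul a) z = z ^ a * (CPS (Nmul a) z + 1).
Proof.
  intros Ha Hz. assert (H1 := conv_disc_Nmul a). assert (H2 := conv_disc_delta0).
  rewrite (CPS_ext _ _ z (fun n => Nmul_incr a n Ha)) at 1.
  rewrite (CPS_incr_n _ _ 1), (CPS_plus _ _ 1), CPS_delta0
    by (try assumption; now apply conv_disc_plus). reflexivity.
Qed.

Lemma one_minus_pow_neq_0 (z : C) (a : nat) : (1 <= a)%nat -> (Cmod z < 1)%R -> 1 - z ^ a <> 0.
Proof.
  intros Ha Hz F. assert (E : z ^ a = 1).
  { replace (z ^ a) with (1 - (1 - z ^ a)) by ring. rewrite F. ring. }
  assert (H : (Cmod z ^ a < 1)%R).
  { destruct a as [|a]; [lia|]. assert (H0 := Cmod_ge_0 z).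
    assert (Cmod z ^ a <= 1)%R by (rewrite <- (pow1 a); apply pow_incr; lra).
    assert (0 <= Cmod z ^ a)%R by now apply pow_le. simpl. nra. }
  rewrite <- Cmod_pow, E, Cmod_1 in H. lra.
Qed.

Lemma CPS_Nmul_eq (a : nat) (z : C) : (1 <= a)%nat -> (Cmod z < 1)%R ->
  CPS (Nmul a) z = z ^ a / (1 - z ^ a).
Proof.
  intros Ha Hz. assert (H := CPS_Nmul a z Ha Hz). assert (H0 := one_minus_pow_neq_0 z a Ha Hz).
  transitivity (CPS (Nmul a) z * (1 - z ^ a) / (1 - z ^ a)); [field; exact H0|].
  f_equal. transitivity (CPS (Nmul a) z - z ^ a * (CPS (Nmul a) z + 1) + z ^ a); [ring|].
  rewrite <- H. ring.
Qed.

(** For positive a and b, the number of pairs (i, j) of positive integers with a i + b j = n. *)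
Definition rep (a b : nat) : nat -> C := Cconv (Nmul a) (Nmul b).

Lemma conv_disc_rep (a b : nat) : conv_disc (rep a b) 1.
Proof. apply conv_disc_mult; apply conv_disc_Nmul. Qed.

Lemma CPS_rep (a b : nat) (z : C) : (Cmod z < 1)%R ->
  CPS (rep a b) z = CPS (Nmul a) z * CPS (Nmul b) z.
Proof. intros Hz. apply (CPS_mult _ _ 1); [apply conv_disc_Nmul|apply conv_disc_Nmul|exact Hz]. Qed.

(* Partial fractions: with [N_a = z^a / (1 - z^a)], [N_a N_b = N_(a+b) (1 + N_a + N_b)]. *)
Lemma rep_split (a b n : nat) : (1 <= a)%nat -> (1 <= b)%nat ->
  rep a b n = Nmul (a + b) n + (rep (a + b) a n + rep (a + b) b n).
Proof.
  intros Ha Hb.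
  assert (R1 := conv_disc_rep (a + b) a). assert (R2 := conv_disc_rep (a + b) b).
  assert (R3 := conv_disc_plus _ _ _ R1 R2). assert (R0 := conv_disc_Nmul (a + b)).
  revert n. apply CPS_inj; [apply conv_disc_rep|exact (conv_disc_plus _ _ _ R0 R3)|].
  intros z Hz.
  rewrite (CPS_plus _ _ 1 z R0 R3 Hz), (CPS_plus _ _ 1 z R1 R2 Hz), !CPS_rep by exact Hz.
  rewrite !CPS_Nmul_eq by (lia || exact Hz).
  assert (H1 := one_minus_pow_neq_0 z a Ha Hz). assert (H2 := one_minus_pow_neq_0 z b Hb Hz).
  assert (H3 := one_minus_pow_neq_0 z (a + b) ltac:(lia) Hz).
  rewrite Cpow_add_r in *. field. auto.
Qed.

Lemma rep_comm (a b n : nat) : rep a b n = rep b a n.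
Proof.
  revert n. apply CPS_inj; try apply conv_disc_rep.
  intros z Hz. rewrite !CPS_rep by exact Hz. ring.
Qed.

Lemma rep_large (a b n : nat) : (n < a)%nat -> rep a b n = 0.
Proof.
  intros H. unfold rep, Cconv.
  rewrite (sum_n_ext_loc _ (fun _ => RtoC 0)).
  - clear H. induction n as [|n IH]; [now rewrite sum_O|]. rewrite sum_Sn, IH.
    unfold plus; simpl. ring.
  - intros k Hk. rewrite Nmul_small by lia. exact (Cmult_0_l _).
Qed.

(** If c divides n >= 1, then n = c i + c j has n / c - 1 solutions. The induction uses the
    coefficient form of N^2 = z^c (N^2 + N), where N = z^c / (1 - z^c). *)
Lemma rep_diag (c n : nat) : (1 <= c)%nat ->
  RtoC (INR c) * rep c c n = (RtoC (INR n) - RtoC (INR c)) * Nmul c n.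
Proof.
  intros Hc.
  assert (E : forall m, rep c c m = incr_n c (fun k => rep c c k + Nmul c k) m).
  { assert (H1 := conv_disc_rep c c). assert (H2 := conv_disc_Nmul c).
    assert (H3 := conv_disc_plus _ _ _ H1 H2).
    apply CPS_inj; [exact H1|exact (conv_disc_incr_n c _ _ H3)|].
    intros z Hz. rewrite (CPS_incr_n _ _ 1 z H3 Hz), (CPS_plus _ _ 1 z H1 H2 Hz), CPS_rep
      by exact Hz.
    assert (H := CPS_Nmul c z Hc Hz).
    transitivity (CPS (Nmul c) z * (z ^ c * (CPS (Nmul c) z + 1))); [now rewrite <- H|ring]. }
  induction n as [n IH] using (well_founded_induction lt_wf).
  destruct (Nat.lt_ge_cases n c) as [H|H].
  - rewrite E, incr_n_small, Nmul_small by exact H. ring.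
  - set (m := (n - c)%nat). assert (Hm : n = (c + m)%nat) by (unfold m; lia).
    rewrite Hm, E, incr_n_add, Nmul_add, plus_INR, RtoC_plus by exact Hc.
    specialize (IH m ltac:(lia)).
    transitivity (RtoC (INR c) * rep c c m + RtoC (INR c) * Nmul c m); [ring|].
    rewrite IH. destruct m as [|m]; simpl ind; [|ring].
    replace (INR 0) with 0%R by reflexivity. unfold Nmul. simpl. ring.
Qed.

(** * Divisor sums and their convolutions *)

Definition divsum (g : nat -> C) (n : nat) : C := sum1 (fun d => g d * Nmul d n) n.

(** A common range lets divisor sums at different arguments be combined term by term. *)
Lemma divsum_widen (g : nat -> C) (n B : nat) : (n <= B)%nat ->
  divsum g n = sum1 (fun d => g d * Nmul d n) B.
Proof.
  intros H. symmetry. apply sum1_vanish; [exact H|]. intros i Hi.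
  rewrite Nmul_small by exact Hi. ring.
Qed.

Lemma sum_n_sum1 (f : nat -> nat -> C) (n B : nat) :
  @sum_n C_AbelianMonoid (fun k => sum1 (f k) B) n =
  sum1 (fun i => @sum_n C_AbelianMonoid (fun k => f k i) n) B.
Proof.
  induction B as [|B IH]; simpl.
  - induction n as [|n IHn]; [now rewrite sum_O|]. rewrite sum_Sn, IHn.
    unfold plus; simpl. ring.
  - rewrite <- IH. apply (@sum_n_plus C_AbelianMonoid).
Qed.

Lemma sum1_mult (f g : nat -> C) (A B : nat) :
  sum1 f A * sum1 g B = sum1 (fun i => sum1 (fun j => f i * g j) B) A.
Proof.
  induction A as [|A IH]; simpl; [ring|]. rewrite <- IH, sum1_scal. ring.
Qed.

(** Exchanging sums: pairs of divisors (a of k, b of n - k) are counted by the representations of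
    n. *)
Lemma Cconv_divsum (g h : nat -> C) (n : nat) :
  Cconv (divsum g) (divsum h) n =
  sum1 (fun a => sum1 (fun b => g a * h b * rep a b n) n) n.
Proof.
  unfold Cconv.
  rewrite (sum_n_ext_loc _ (fun k => sum1 (fun a => sum1 (fun b =>
    g a * h b * (Nmul a k * Nmul b (n - k)%nat)) n) n)).
  - rewrite sum_n_sum1. apply sum1_ext. intros a _. rewrite sum_n_sum1.
    apply sum1_ext. intros b _. unfold rep, Cconv.
    apply (@sum_n_mult_l C_Ring).
  - intros k Hk. rewrite (divsum_widen g k n), (divsum_widen h (n - k) n) by lia.
    rewrite sum1_mult. apply sum1_ext. intros a _. apply sum1_ext. intros b _. ring.
Qed.

(** [chi] will be 1 or -1, making chi ^ k a trivial or an alternating sign. *)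
Definition chi_sq (chi : C) (k : nat) : C := chi ^ k * RtoC (INR k) ^ 2.
Definition chi_pow (chi : C) (s k : nat) : C := chi ^ k * RtoC (INR k) ^ s.

(* Liouville's elementary method with the even weight [chi ^ k * k ^ 2]:
   [4 a b = (a + b) ^ 2 - (a - b) ^ 2], and both halves telescope through [rep_split]. *)
Lemma Cconv_chi (chi : C) (n : nat) : chi * chi = 1 ->
  4 * Cconv (divsum (chi_pow chi 1)) (divsum (chi_pow chi 1)) n =
  sum1 (fun m => (RtoC (INR (m - 1)) * chi_sq chi m + 2 * sum1 (chi_sq chi) (m - 1)) * Nmul m n
     - 2 * (chi_pow chi 1 m * (RtoC (INR n) - RtoC (INR m)) * Nmul m n)) n.
Proof.
  intros Hchi. set (f := chi_sq chi). rewrite Cconv_divsum.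
  assert (Hr0 : forall a b, (n < a)%nat -> rep a b n = 0) by (intros; now apply rep_large).
  assert (Hs0 : forall a, (n < a)%nat -> Nmul a n = 0) by (intros; now apply Nmul_small).
  (* Weight f at |a - b|; the conditional replaces truncated subtraction. *)
  set (D := sum1 (fun a => sum1 (fun b => f (if (a <? b)%nat then b - a else a - b)%nat *
    rep a b n) n) n).
  set (U := sum1 (fun a => sum1 (fun b => f (a + b)%nat * rep a b n) n) n).
  (* As chi^2 = 1, the signs chi^(a+b), chi^|a-b| and chi^a chi^b coincide. *)
  assert (E0 : 4 * sum1 (fun a => sum1 (fun b => chi_pow chi 1 a * chi_pow chi 1 b * rep a b n) n) n
    = U - D).
  { unfold U, D. rewrite <- sum1_minus, <- sum1_scal. apply sum1_ext. intros a Ha.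
    rewrite <- sum1_minus, <- sum1_scal. apply sum1_ext. intros b Hb.
    assert (P : forall k d, chi ^ (2 * k + d) = chi ^ d).
    { intros k d. rewrite Cpow_add_r, Cpow_mult_r. simpl. rewrite Cmult_1_r, Hchi, Cpow_1_l. ring. }
    unfold f, chi_sq, chi_pow. rewrite Cpow_add_r, plus_INR, RtoC_plus.
    destruct (Nat.ltb_spec a b) as [H|H].
    - assert (Q := P a (b - a)%nat). replace (2 * a + (b - a))%nat with (a + b)%nat in Q by lia.
      rewrite <- Q, Cpow_add_r, minus_INR, RtoC_minus by lia. ring.
    - assert (Q := P b (a - b)%nat). replace (2 * b + (a - b))%nat with (a + b)%nat in Q by lia.
      rewrite <- Q, Cpow_add_r, minus_INR, RtoC_minus by lia. ring. }
  rewrite E0. clear E0.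
  set (X := sum1 (fun m => sum1 (fun a => ind (a <? m)%nat * (f m * rep m a n)) n) n).
  set (S := sum1 (fun a => sum1 (fun b => f (a + b)%nat * Nmul (a + b) n) n) n).
  set (S' := sum1 (fun b => sum1 (fun c => f c * Nmul (b + c) n) n) n).
  assert (EX : sum1 (fun a => sum1 (fun b => f (a + b)%nat * rep (a + b) a n) n) n = X).
  { unfold X. rewrite (sum1_swap (fun m a => ind (a <? m)%nat * (f m * rep m a n))).
    apply sum1_ext. intros a Ha.
    apply (sum1_shift (fun m => f m * rep m a n)). intros m Hm. rewrite Hr0 by exact Hm. ring. }
  (* After [rep_split] the two sums of [rep] agree by exchanging a and b. *)
  assert (EU : U = S + 2 * X).
  { unfold U. transitivity (S + (sum1 (fun a => sum1 (fun b => f (a + b)%nat * rep (a + b) a n) n) n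
      + sum1 (fun a => sum1 (fun b => f (a + b)%nat * rep (a + b) b n) n) n)).
    - unfold S. rewrite <- !sum1_plus. apply sum1_ext. intros a Ha.
      rewrite <- !sum1_plus. apply sum1_ext. intros b Hb. rewrite (rep_split a b n) by lia. ring.
    - rewrite EX.
      replace (sum1 (fun a => sum1 (fun b => f (a + b)%nat * rep (a + b) b n) n) n) with X; [ring|].
      rewrite <- EX, sum1_swap. apply sum1_ext. intros a _. apply sum1_ext. intros b _.
      now rewrite Nat.add_comm. }
  set (Y := sum1 (fun c => f c * rep c c n) n).
  (* The diagonal has weight f(0) = 0, and by symmetry D is twice the sum of f(c) rep (b + c) b.
     Solving [rep_split] for this term leaves - S' and the sums over b of rep b c - rep (b + c) c,
     where all terms with b > c cancel; b < c yields X and b = c yields Y. The two X then cancel in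
     U - D. *)
  assert (ED : D = 2 * (X + Y - S')).
  { unfold D. rewrite sum1_symmetric.
    2:{ intros a b. rewrite (rep_comm a b). f_equal. f_equal.
        destruct (Nat.ltb_spec a b), (Nat.ltb_spec b a); lia. }
    rewrite sum1_zero.
    2:{ intros i Hi. rewrite Nat.ltb_irrefl, Nat.sub_diag. unfold f, chi_sq. simpl. ring. }
    rewrite Cplus_0_l. f_equal.
    transitivity (sum1 (fun b => sum1 (fun c => f c * rep (b + c) b n) n) n).
    { rewrite sum1_swap. apply sum1_ext. intros b Hb.
      rewrite <- (sum1_shift (fun m => f (if (m <? b)%nat then b - m else m - b)%nat *
        rep m b n) b n).
      - apply sum1_ext. intros c Hc.
        replace (b + c <? b)%nat with false by (symmetry; apply Nat.ltb_ge; lia).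
        now replace (b + c - b)%nat with c by lia.
      - intros m Hm. rewrite Hr0 by exact Hm. ring. }
    transitivity (sum1 (fun c => f c * (sum1 (fun b => rep b c n) n -
        sum1 (fun b => rep (c + b) c n) n)) n - S').
    { unfold S'. rewrite (sum1_swap (fun b c => f c * Nmul (b + c) n)), sum1_swap, <- sum1_minus.
      apply sum1_ext. intros c Hc. rewrite <- sum1_minus, <- sum1_scal, <- sum1_minus.
      apply sum1_ext. intros b Hb. rewrite (rep_split b c n) by lia.
      rewrite (Nat.add_comm c b). ring. }
    f_equal. unfold X, Y. rewrite <- sum1_plus. apply sum1_ext. intros c Hc.
    rewrite (sum1_shift (fun m => rep m c n) c n) by (intros m Hm; now apply Hr0).
    rewrite <- sum1_minus, <- sum1_scal.
    replace (f c * rep c c n) with (sum1 (fun b => ind (b =? c)%nat * (f c * rep c b n)) n).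
    - rewrite <- sum1_plus. apply sum1_ext. intros b Hb. rewrite (rep_comm c b).
      destruct (Nat.ltb_spec c b), (Nat.ltb_spec b c), (Nat.eqb_spec b c);
        simpl; try lia; ring.
    - rewrite (sum1_vanish _ c n); [|lia|].
      + destruct c as [|c]; [lia|]. cbn [sum1]. rewrite Nat.eqb_refl, sum1_zero; [simpl; ring|].
        intros i Hi. replace (i =? Datatypes.S c)%nat with false by (symmetry; apply Nat.eqb_neq; lia).
        simpl. ring.
      + intros i Hi. replace (i =? c)%nat with false by (symmetry; apply Nat.eqb_neq; lia).
        simpl. ring. }
  assert (ES : S = sum1 (fun m => RtoC (INR (m - 1)) * (f m * Nmul m n)) n).
  { unfold S. transitivity (sum1 (fun a => sum1 (fun m => ind (a <? m)%nat * (f m * Nmul m n)) n) n).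
    - apply sum1_ext. intros a Ha. apply (sum1_shift (fun m => f m * Nmul m n)).
      intros m Hm. rewrite Hs0 by exact Hm. ring.
    - rewrite sum1_swap. apply sum1_ext. intros m Hm.
      rewrite (sum1_ind_lt (fun _ => f m * Nmul m n) m n Hm).
      generalize (m - 1)%nat. intros k. induction k as [|k IH]; [simpl; ring|].
      cbn [sum1]. rewrite IH, S_INR, RtoC_plus. ring. }
  assert (ES' : S' = sum1 (fun m => sum1 f (m - 1) * Nmul m n) n).
  { unfold S'. rewrite sum1_swap.
    transitivity (sum1 (fun c => sum1 (fun m => ind (c <? m)%nat * (f c * Nmul m n)) n) n).
    - apply sum1_ext. intros c Hc.
      rewrite <- (sum1_shift (fun m => f c * Nmul m n)).
      + apply sum1_ext. intros b _. now rewrite Nat.add_comm.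
      + intros m Hm. rewrite Hs0 by exact Hm. ring.
    - rewrite sum1_swap. apply sum1_ext. intros m Hm.
      rewrite (Cmult_comm (sum1 f (m - 1))), <- sum1_scal.
      rewrite <- (sum1_ind_lt (fun c => Nmul m n * f c) m n Hm).
      apply sum1_ext. intros c _. ring. }
  assert (EY : Y = sum1 (fun m => chi_pow chi 1 m * (RtoC (INR n) - RtoC (INR m)) * Nmul m n) n).
  { apply sum1_ext. intros c Hc. unfold f, chi_sq, chi_pow.
    transitivity (chi ^ c * RtoC (INR c) * (RtoC (INR c) * rep c c n)); [ring|].
    rewrite rep_diag by lia. ring. }
  rewrite EU, ED. transitivity (S + 2 * S' - 2 * Y); [ring|].
  rewrite ES, ES', EY, <- !sum1_scal, <- sum1_plus, <- sum1_minus.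
  apply sum1_ext. intros m _. ring.
Qed.

(** [dv 1 s] is the divisor function sigma_s, and [dv (-(1)) s] sums (-1)^d d^s. *)
Definition dv (chi : C) (s : nat) : nat -> C := divsum (chi_pow chi s).

Lemma Cmod_sum1_le (f : nat -> C) (B : nat) (M : R) :
  (forall i, (1 <= i <= B)%nat -> (Cmod (f i) <= M)%R) -> (Cmod (sum1 f B) <= INR B * M)%R.
Proof.
  induction B as [|B IH]; intros H.
  - simpl. rewrite Cmod_0. lra.
  - cbn [sum1]. rewrite S_INR. eapply Rle_trans; [apply Cmod_triangle|].
    assert (H1 := IH ltac:(intros; apply H; lia)). assert (H2 := H (S B) ltac:(lia)). lra.
Qed.

Lemma conv_disc_INR_pow (k : nat) : conv_disc (fun n => RtoC (INR n) ^ k) 1.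
Proof.
  induction k as [|k IH].
  - apply (conv_disc_bounded _ 1). intros n. simpl. rewrite Cmod_1. lra.
  - exact (conv_disc_INR _ _ IH).
Qed.

Lemma conv_disc_dv (chi : C) (s : nat) : Cmod chi = 1%R -> conv_disc (dv chi s) 1.
Proof.
  intros Hchi. apply (conv_disc_le (fun n => RtoC (INR n) ^ S s)); [|apply conv_disc_INR_pow].
  intros n. rewrite Cmod_pow, Cmod_R, Rabs_right by (apply Rle_ge, pos_INR).
  cbn [pow]. apply Cmod_sum1_le. intros i Hi. unfold chi_pow.
  rewrite !Cmod_mult, !Cmod_pow, Hchi, pow1, Cmod_R, Rabs_right by (apply Rle_ge, pos_INR).
  assert (H0 := pos_INR i). assert (Hin : (INR i <= INR n)%R) by (apply le_INR; lia).
  assert (Hp : (INR i ^ s <= INR n ^ s)%R) by (apply pow_incr; lra).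
  assert (Hp0 : (0 <= INR i ^ s)%R) by now apply pow_le.
  assert (HN := Cmod_ind_le ((1 <=? n)%nat && (n mod i =? 0)%nat)).
  fold (Nmul i n) in HN. assert (HN0 := Cmod_ge_0 (Nmul i n)).
  apply Rle_trans with (1 * INR i ^ s * 1)%R; [|lra].
  apply Rmult_le_compat_l; lra.
Qed.

Lemma Cmod_m1' : Cmod (-(1)) = 1%R.
Proof. rewrite Cmod_opp. apply Cmod_1. Qed.

(** * The substitutions q -> q^2 and q -> - q *)

Definition spread2 (a : nat -> C) (n : nat) : C :=
  if Nat.even n then a (Nat.div2 n) else 0.

Lemma spread2_double (a : nat -> C) (k : nat) : spread2 a (2 * k) = a k.
Proof.
  unfold spread2. rewrite Nat.even_mul. cbn [Nat.even orb]. now rewrite Nat.div2_double.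
Qed.

Lemma spread2_double_S (a : nat -> C) (k : nat) : spread2 a (S (2 * k)) = 0.
Proof.
  unfold spread2. rewrite Nat.even_succ, Nat.odd_mul. reflexivity.
Qed.

Lemma even_odd_dec (n : nat) : {k | n = (2 * k)%nat} + {k | n = S (2 * k)}.
Proof.
  destruct (Nat.even n) eqn:E.
  - left. exists (Nat.div2 n). rewrite (Nat.div2_odd n) at 1.
    rewrite <- Nat.negb_even, E. simpl. lia.
  - right. exists (Nat.div2 n). rewrite (Nat.div2_odd n) at 1.
    rewrite <- Nat.negb_even, E. simpl. lia.
Qed.

Lemma sum_n_double_zero_odd (u : nat -> C) (n : nat) :
  (forall k, u (S (2 * k)) = 0) ->
  @sum_n C_AbelianMonoid u (S (2 * n)) = @sum_n C_AbelianMonoid (fun k => u (2 * k)%nat) n /\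
  @sum_n C_AbelianMonoid u (2 * n) = @sum_n C_AbelianMonoid (fun k => u (2 * k)%nat) n.
Proof.
  intros H. induction n as [|n [IH _]].
  - rewrite !sum_O. split; [|reflexivity]. rewrite sum_Sn, sum_O, (H 0%nat).
    unfold plus; simpl. ring.
  - assert (E : @sum_n C_AbelianMonoid u (2 * S n) =
                @sum_n C_AbelianMonoid (fun k => u (2 * k)%nat) (S n)).
    { replace (2 * S n)%nat with (S (S (2 * n))) by lia.
      rewrite (sum_Sn u (S (2 * n))), (sum_Sn (fun k => u (2 * k)%nat) n), IH.
      replace (2 * S n)%nat with (S (S (2 * n))) by lia. reflexivity. }
    split; [|exact E]. rewrite sum_Sn, E, H. unfold plus; simpl. ring.
Qed.

(** Serves both ways: inserting zeros turns f(q^2) into a power series in q, and deleting them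
    extracts the even part of a series. *)
Lemma is_Cseries_even (u : nat -> C) (l : C) :
  (forall k, u (S (2 * k)) = 0) ->
  (is_Cseries u l <-> is_Cseries (fun k => u (2 * k)%nat) l).
Proof.
  intros H0. split; intros H.
  - apply filterlim_locally. intros eps.
    destruct (proj1 (filterlim_locally _ _) H eps) as [N HN]. exists N. intros n Hn.
    destruct (sum_n_double_zero_odd u n H0) as [_ E].
    generalize (HN (2 * n)%nat ltac:(lia)). intros Hb.
    assert (E' : @sum_n C_AbelianMonoid (fun k => u (2 * k)%nat) n = @sum_n C_AbelianMonoid u (2 * n))
      by now symmetry.
    change (@ball C_UniformSpace l eps (@sum_n C_AbelianMonoid (fun k => u (2 * k)%nat) n)).
    rewrite E'. exact Hb.
  - apply filterlim_locally. intros eps.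
    destruct (proj1 (filterlim_locally _ _) H eps) as [N HN]. exists (2 * N)%nat. intros n Hn.
    change (@ball C_UniformSpace l eps (@sum_n C_AbelianMonoid u n)).
    destruct (even_odd_dec n) as [[k ->]|[k ->]];
      destruct (sum_n_double_zero_odd u k H0) as [E1 E2].
    + rewrite E2. apply HN. lia.
    + rewrite E1. apply HN. lia.
Qed.

Lemma Cmod_sq_lt_1 (z : C) : (Cmod z < 1)%R -> (Cmod (z * z) < 1)%R.
Proof.
  intros Hz. rewrite Cmod_mult. assert (H := Cmod_ge_0 z). nra.
Qed.

Lemma spread2_is_Cseries (a : nat -> C) (z l : C) :
  is_Cseries (fun n => a n * (z * z) ^ n) l -> is_Cseries (fun n => spread2 a n * z ^ n) l.
Proof.
  intros H. apply is_Cseries_even.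
  - intros k. rewrite spread2_double_S. ring.
  - revert H. apply is_Cseries_ext. intros n. rewrite spread2_double, Cpow_mult_r.
    f_equal. f_equal. simpl. ring.
Qed.

Lemma conv_disc_spread2 (a : nat -> C) : conv_disc a 1 -> conv_disc (spread2 a) 1.
Proof.
  intros Ha. apply conv_disc_of_pointwise. intros z Hz. exists (CPS a (z * z)).
  apply spread2_is_Cseries, (CPS_correct _ 1); [exact Ha|now apply Cmod_sq_lt_1].
Qed.

Lemma CPS_spread2 (a : nat -> C) (z : C) : conv_disc a 1 -> (Cmod z < 1)%R ->
  CPS (spread2 a) z = CPS a (z * z).
Proof.
  intros Ha Hz. apply CPS_unique, spread2_is_Cseries, (CPS_correct _ 1);
    [exact Ha|now apply Cmod_sq_lt_1].
Qed.

Lemma Nmul_double (d k : nat) : (1 <= d)%nat -> Nmul (2 * d) (2 * k) = Nmul d k.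
Proof.
  intros Hd. unfold Nmul. rewrite Nat.Div0.mul_mod_distr_l.
  destruct k as [|k]; [reflexivity|].
  replace (1 <=? 2 * S k)%nat with true by (symmetry; apply Nat.leb_le; lia).
  replace (2 * (S k mod d) =? 0)%nat with (S k mod d =? 0)%nat; [reflexivity|].
  destruct (Nat.eqb_spec (S k mod d) 0), (Nat.eqb_spec (2 * (S k mod d)) 0); lia.
Qed.

Lemma Nmul_even_odd (d k : nat) : (1 <= d)%nat -> Nmul (2 * d) (S (2 * k)) = 0.
Proof.
  intros Hd. unfold Nmul.
  replace (S (2 * k) mod (2 * d) =? 0)%nat with false; [now rewrite andb_false_r|].
  symmetry. apply Nat.eqb_neq. intros E. apply Nat.Div0.mod_divides in E. destruct E as [c Hc]. lia.
Qed.

Lemma Nmul_odd_double (d k : nat) : Nmul (S (2 * d)) (2 * k) = Nmul (S (2 * d)) k.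
Proof.
  unfold Nmul. destruct k as [|k]; [reflexivity|].
  replace (1 <=? 2 * S k)%nat with true by (symmetry; apply Nat.leb_le; lia).
  replace (1 <=? S k)%nat with true by reflexivity. cbn [andb]. f_equal.
  destruct (Nat.eqb_spec (2 * S k mod S (2 * d)) 0) as [E|E],
    (Nat.eqb_spec (S k mod S (2 * d)) 0) as [E'|E']; try reflexivity; exfalso.
  - apply E'. apply Nat.Lcm0.mod_divide in E || apply Nat.Div0.mod_divides in E.
    apply Nat.Div0.mod_divides. 
    assert (Hg : Nat.gcd (S (2 * d)) 2 = 1%nat).
    { replace (S (2 * d)) with (1 + d * 2)%nat by lia. rewrite Nat.gcd_comm, Nat.gcd_add_mult_diag_r.
      reflexivity. }
    assert (Hdiv : Nat.divide (S (2 * d)) (S k)).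
    { apply (Nat.gauss _ 2); [|exact Hg]. destruct E as [c Hc]. exists c. lia. }
    destruct Hdiv as [c Hc]. exists c. lia.
  - apply E. apply Nat.Div0.mod_divides in E'. destruct E' as [c Hc].
    apply Nat.Div0.mod_divides. exists (2 * c)%nat. lia.
Qed.

Lemma sum1_double (f : nat -> C) (k : nat) :
  sum1 f (2 * k) = sum1 (fun d => f (2 * d)%nat) k + sum1 (fun d => f (2 * d - 1)%nat) k.
Proof.
  induction k as [|k IH]; [simpl; ring|].
  replace (2 * S k)%nat with (S (S (2 * k))) by lia. cbn [sum1]. rewrite IH.
  replace (2 * S k - 1)%nat with (S (2 * k)) by lia.
  replace (2 * S k)%nat with (S (S (2 * k))) by lia. ring.
Qed.

Lemma m1_pow_double (k : nat) : (-(1)) ^ (2 * k) = 1 :> C.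
Proof. rewrite Cpow_mult_r. replace ((-(1)) ^ 2) with (RtoC 1) by (simpl; ring). apply Cpow_1_l. Qed.

Lemma m1_pow_double_S (k : nat) : (-(1)) ^ S (2 * k) = -(1) :> C.
Proof. rewrite Cpow_S, m1_pow_double. ring. Qed.

Lemma dv_widen (chi : C) (s n B : nat) : (n <= B)%nat ->
  dv chi s n = sum1 (fun d => chi_pow chi s d * Nmul d n) B.
Proof. apply divsum_widen. Qed.

(** (-1)^d = -1 + 2 [d even], and the even divisors d = 2 e of n correspond to the divisors e of n /
    2, with d^s = 2^s e^s. *)
Lemma dv_m1 (s n : nat) :
  dv (-(1)) s n = -(1) * dv 1 s n + 2 ^ S s * spread2 (dv 1 s) n.
Proof.
  (* A range of even length splits exactly into even and odd indices. *)
  rewrite (dv_widen (-(1)) s n (2 * n)), (dv_widen 1 s n (2 * n)) by lia.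
  rewrite !sum1_double.
  replace (sum1 (fun d => chi_pow (-(1)) s (2 * d - 1) * Nmul (2 * d - 1) n) n)
    with (-(1) * sum1 (fun d => chi_pow 1 s (2 * d - 1) * Nmul (2 * d - 1) n) n).
  2:{ rewrite <- sum1_scal. apply sum1_ext. intros d Hd. unfold chi_pow.
      replace (2 * d - 1)%nat with (S (2 * (d - 1))) by lia.
      rewrite m1_pow_double_S, Cpow_1_l. ring. }
  replace (sum1 (fun d => chi_pow (-(1)) s (2 * d) * Nmul (2 * d) n) n)
    with (sum1 (fun d => chi_pow 1 s (2 * d) * Nmul (2 * d) n) n).
  2:{ apply sum1_ext. intros d Hd. unfold chi_pow. now rewrite m1_pow_double, Cpow_1_l. }
  assert (E : 2 * sum1 (fun d => chi_pow 1 s (2 * d) * Nmul (2 * d) n) n =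
              2 ^ S s * spread2 (dv 1 s) n).
  { destruct (even_odd_dec n) as [[k Hk]|[k Hk]].
    - replace (spread2 (dv 1 s) n) with (dv 1 s k) by (rewrite Hk; symmetry; apply spread2_double).
      rewrite (dv_widen 1 s k n), <- !sum1_scal by lia.
      apply sum1_ext. intros d Hd. rewrite Hk, Nmul_double by lia. unfold chi_pow.
      rewrite !Cpow_1_l, mult_INR, RtoC_mult, Cpow_mult_l, Cpow_S.
      replace (INR 2) with 2%R by (simpl; ring). ring.
    - replace (spread2 (dv 1 s) n) with (RtoC 0)
        by (rewrite Hk; symmetry; apply spread2_double_S).
      rewrite sum1_zero; [ring|]. intros d Hd.
      rewrite Hk, Nmul_even_odd by lia. ring. }
  rewrite <- E. ring.
Qed.

(** The difference of [dv 1 s] and [dv (-(1)) s] sees only odd divisors, and 2 k and k have the same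
    odd divisors; [dv_m1] at 2 k and at k does the rest. *)
Lemma dv_double (s k : nat) :
  dv 1 s (2 * k) = (1 + 2 ^ s) * dv 1 s k - 2 ^ s * spread2 (dv 1 s) k.
Proof.
  assert (H1 := dv_m1 s (2 * k)). rewrite spread2_double in H1. assert (H2 := dv_m1 s k).
  assert (H3 : dv 1 s (2 * k) - dv (-(1)) s (2 * k) = dv 1 s k - dv (-(1)) s k).
  { rewrite (dv_widen 1 s k (2 * k)), (dv_widen (-(1)) s k (2 * k)) by lia.
    unfold dv, divsum. rewrite <- !sum1_minus. apply sum1_ext. intros d Hd.
    destruct (even_odd_dec d) as [[e ->]|[e ->]]; unfold chi_pow.
    - rewrite m1_pow_double, Cpow_1_l. ring.
    - now rewrite Nmul_odd_double. }
  rewrite H1, H2 in H3. rewrite Cpow_S in H3.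
  assert (H4 : dv 1 s (2 * k) * 2 = 2 * ((1 + 2 ^ s) * dv 1 s k - 2 ^ s * spread2 (dv 1 s) k)).
  { transitivity (dv 1 s (2 * k) - (-(1) * dv 1 s (2 * k) + 2 * 2 ^ s * dv 1 s k)
      + 2 * 2 ^ s * dv 1 s k); [ring|]. rewrite H3. ring. }
  transitivity (dv 1 s (2 * k) * 2 * / 2); [field|]. rewrite H4. field.
Qed.

(** Keeps the substitution q -> - q inside the span of Phi(q), Phi(q^2), Phi(q^4). For even n it is
    [dv_double]; for odd n both dilated terms vanish. *)
Lemma dv_sign (s n : nat) :
  (-(1)) ^ n * dv 1 s n =
  -(1) * dv 1 s n + (2 * (1 + 2 ^ s) * spread2 (dv 1 s) n
    + -(1) * 2 ^ S s * spread2 (spread2 (dv 1 s)) n).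
Proof.
  destruct (even_odd_dec n) as [[k ->]|[k ->]].
  - rewrite m1_pow_double, !spread2_double, dv_double, Cpow_S. ring.
  - rewrite m1_pow_double_S, !spread2_double_S. ring.
Qed.

(** * Eisenstein series *)

Definition Phi (s : nat) (q : C) : C := CPS (dv 1 s) q.
(** The image of [Phi 1] under q d/dq. *)
Definition Psi (q : C) : C := CPS (fun n => RtoC (INR n) * dv 1 1 n) q.

Lemma conv_disc_dv_1 (s : nat) : conv_disc (dv 1 s) 1.
Proof. apply conv_disc_dv, Cmod_1. Qed.

Lemma conv_disc_dv_m1 (s : nat) : conv_disc (dv (-(1)) s) 1.
Proof. apply conv_disc_dv, Cmod_m1'. Qed.

Lemma CPS_lin2 (c d : C) (a b : nat -> C) (z : C) :
  conv_disc a 1 -> conv_disc b 1 -> (Cmod z < 1)%R ->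
  CPS (fun n => c * a n + d * b n) z = c * CPS a z + d * CPS b z.
Proof.
  intros Ha Hb Hz.
  rewrite (CPS_plus _ _ 1 z (conv_disc_scal c _ _ Ha) (conv_disc_scal d _ _ Hb) Hz).
  now rewrite (CPS_scal c _ 1 z Ha Hz), (CPS_scal d _ 1 z Hb Hz).
Qed.

Lemma CPS_lin3 (c d e : C) (a b f : nat -> C) (z : C) :
  conv_disc a 1 -> conv_disc b 1 -> conv_disc f 1 -> (Cmod z < 1)%R ->
  CPS (fun n => c * a n + (d * b n + e * f n)) z = c * CPS a z + (d * CPS b z + e * CPS f z).
Proof.
  intros Ha Hb Hf Hz.
  rewrite (CPS_plus _ _ 1 z (conv_disc_scal c _ _ Ha)
    (conv_disc_plus _ _ _ (conv_disc_scal d _ _ Hb) (conv_disc_scal e _ _ Hf)) Hz).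
  now rewrite (CPS_scal c _ 1 z Ha Hz), (CPS_lin2 d e b f z Hb Hf Hz).
Qed.

Lemma CPS_neg (a : nat -> C) (z : C) : CPS a (- z) = CPS (fun n => (-(1)) ^ n * a n) z.
Proof.
  unfold CPS.
  assert (E : forall n, a n * (- z) ^ n = (-(1)) ^ n * a n * z ^ n).
  { intros n. replace (- z) with (-(1) * z) by ring. rewrite Cpow_mult_l. ring. }
  unfold Csum. f_equal; apply Series_ext; intros n; now rewrite E.
Qed.

Lemma Phi_neg (s : nat) (q : C) : (Cmod q < 1)%R ->
  Phi s (- q) = -(1) * Phi s q + (2 * (1 + 2 ^ s) * Phi s (q * q)
    + -(1) * 2 ^ S s * Phi s (q * q * (q * q))).
Proof.
  intros Hq. assert (H := conv_disc_dv_1 s). assert (H2 := conv_disc_spread2 _ H).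
  assert (H3 := conv_disc_spread2 _ H2). unfold Phi.
  rewrite CPS_neg, (CPS_ext _ _ q (dv_sign s)), (CPS_lin3 _ _ _ _ _ _ q H H2 H3 Hq).
  rewrite (CPS_spread2 _ q H Hq), (CPS_spread2 _ q H2 Hq).
  now rewrite (CPS_spread2 _ _ H (Cmod_sq_lt_1 q Hq)).
Qed.

Lemma spread2_INR (a : nat -> C) (n : nat) :
  RtoC (INR n) * spread2 a n = 2 * spread2 (fun m => RtoC (INR m) * a m) n.
Proof.
  destruct (even_odd_dec n) as [[k ->]|[k ->]].
  - rewrite !spread2_double, mult_INR, RtoC_mult. replace (INR 2) with 2%R by (simpl; ring). ring.
  - rewrite !spread2_double_S. ring.
Qed.

Lemma spread2_ext (a b : nat -> C) (n : nat) :
  (forall m, a m = b m) -> spread2 a n = spread2 b n.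
Proof. intros H. unfold spread2. now rewrite H. Qed.

Lemma spread2_scal (c : C) (a : nat -> C) (n : nat) :
  spread2 (fun m => c * a m) n = c * spread2 a n.
Proof. unfold spread2. destruct (Nat.even n); ring. Qed.

Lemma Psi_neg (q : C) : (Cmod q < 1)%R ->
  Psi (- q) = -(1) * Psi q + (12 * Psi (q * q) + -(16) * Psi (q * q * (q * q))).
Proof.
  intros Hq. set (a := fun n => RtoC (INR n) * dv 1 1 n).
  assert (H : conv_disc a 1) by apply conv_disc_INR, conv_disc_dv_1.
  assert (H2 := conv_disc_spread2 _ H). assert (H3 := conv_disc_spread2 _ H2).
  assert (E : forall n, (-(1)) ^ n * a n =
    -(1) * a n + (12 * spread2 a n + -(16) * spread2 (spread2 a) n)).
  { intros n. unfold a at 1 2.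
    transitivity (RtoC (INR n) * ((-(1)) ^ n * dv 1 1 n)); [ring|]. rewrite dv_sign.
    transitivity (-(1) * (RtoC (INR n) * dv 1 1 n) + (6 * (RtoC (INR n) * spread2 (dv 1 1) n)
      - 4 * (RtoC (INR n) * spread2 (spread2 (dv 1 1)) n))); [simpl; ring|].
    rewrite (spread2_INR (dv 1 1)), (spread2_INR (spread2 (dv 1 1))).
    rewrite (spread2_ext _ (fun m => 2 * spread2 a m) n (spread2_INR (dv 1 1))), spread2_scal.
    fold a. ring. }
  unfold Psi. fold a.
  rewrite CPS_neg, (CPS_ext _ _ q E), (CPS_lin3 _ _ _ _ _ _ q H H2 H3 Hq).
  rewrite (CPS_spread2 _ q H Hq), (CPS_spread2 _ q H2 Hq).
  now rewrite (CPS_spread2 _ _ H (Cmod_sq_lt_1 q Hq)).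
Qed.

Lemma CPS_dv_m1 (s : nat) (q : C) : (Cmod q < 1)%R ->
  CPS (dv (-(1)) s) q = -(1) * Phi s q + 2 ^ S s * Phi s (q * q).
Proof.
  intros Hq. assert (H := conv_disc_dv_1 s). assert (H2 := conv_disc_spread2 _ H).
  rewrite (CPS_ext _ _ q (dv_m1 s)), (CPS_lin2 _ _ _ _ q H H2 Hq).
  now rewrite (CPS_spread2 _ q H Hq).
Qed.

Lemma CPS_INR_dv_m1 (q : C) : (Cmod q < 1)%R ->
  CPS (fun n => RtoC (INR n) * dv (-(1)) 1 n) q = -(1) * Psi q + 8 * Psi (q * q).
Proof.
  intros Hq. set (a := fun n => RtoC (INR n) * dv 1 1 n).
  assert (H : conv_disc a 1) by apply conv_disc_INR, conv_disc_dv_1.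
  assert (H2 := conv_disc_spread2 _ H).
  assert (E : forall n, RtoC (INR n) * dv (-(1)) 1 n = -(1) * a n + 8 * spread2 a n).
  { intros n. rewrite dv_m1.
    transitivity (-(1) * (RtoC (INR n) * dv 1 1 n) + 4 * (RtoC (INR n) * spread2 (dv 1 1) n));
      [simpl; ring|].
    rewrite (spread2_INR (dv 1 1)). fold a.
    change (a n) with (RtoC (INR n) * dv 1 1 n). ring. }
  rewrite (CPS_ext _ _ q E), (CPS_lin2 _ _ _ _ q H H2 Hq). now rewrite (CPS_spread2 _ q H Hq).
Qed.

Lemma sum1_chi_sq_1 (k : nat) :
  6 * sum1 (chi_sq 1) k = RtoC (INR k) * (RtoC (INR k) + 1) * (2 * RtoC (INR k) + 1).
Proof.
  induction k as [|k IH]; [simpl; ring|]. cbn [sum1]. unfold chi_sq at 2.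
  rewrite Cpow_1_l, S_INR, RtoC_plus.
  transitivity (6 * sum1 (chi_sq 1) k + 6 * (RtoC (INR k) + 1) ^ 2); [ring|]. rewrite IH. ring.
Qed.

Lemma sum1_chi_sq_m1 (k : nat) :
  2 * sum1 (chi_sq (-(1))) k = (-(1)) ^ k * RtoC (INR k) * (RtoC (INR k) + 1).
Proof.
  induction k as [|k IH]; [simpl; ring|]. cbn [sum1]. unfold chi_sq at 2.
  rewrite Cpow_S, S_INR, RtoC_plus.
  transitivity (2 * sum1 (chi_sq (-(1))) k + 2 * (-(1) * (-(1)) ^ k) * (RtoC (INR k) + 1) ^ 2);
    [ring|]. rewrite IH. ring.
Qed.

(** [Cconv_chi] with trivial sign, where the sum of squares is a cubic in m. This is the classical
    evaluation 12 sum sigma(k) sigma(n - k) = 5 sigma_3(n) + (1 - 6 n) sigma(n). *)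
Lemma Cconv_dv_1 (n : nat) :
  4 * Cconv (dv 1 1) (dv 1 1) n =
  5 / 3 * dv 1 3 n + (/ 3 * dv 1 1 n + -(2) * (RtoC (INR n) * dv 1 1 n)).
Proof.
  unfold dv. rewrite (Cconv_chi 1 n) by ring. unfold divsum. rewrite <- !sum1_scal, <- !sum1_plus.
  apply sum1_ext. intros m Hm.
  assert (E : 2 * sum1 (chi_sq 1) (m - 1) = / 3 *
    (RtoC (INR (m - 1)) * (RtoC (INR (m - 1)) + 1) * (2 * RtoC (INR (m - 1)) + 1))).
  { rewrite <- sum1_chi_sq_1. field. }
  rewrite E, minus_INR, RtoC_minus by lia. unfold chi_sq, chi_pow. rewrite Cpow_1_l.
  simpl INR. simpl Cpow. field.
Qed.

(** The alternating sum of squares is only quadratic in m, so here m^3 keeps coefficient 1 and m^2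
    cancels. *)
Lemma Cconv_dv_m1 (n : nat) :
  4 * Cconv (dv (-(1)) 1) (dv (-(1)) 1) n =
  1 * dv (-(1)) 3 n + (1 * dv (-(1)) 1 n + -(2) * (RtoC (INR n) * dv (-(1)) 1 n)).
Proof.
  unfold dv. rewrite (Cconv_chi (-(1)) n) by ring. unfold divsum. rewrite <- !sum1_scal, <- !sum1_plus.
  apply sum1_ext. intros m Hm.
  rewrite sum1_chi_sq_m1. unfold chi_sq, chi_pow.
  destruct m as [|k]; [lia|]. replace (S k - 1)%nat with k by lia.
  rewrite !Cpow_S, S_INR, RtoC_plus. ring.
Qed.

Lemma Phi_sq (q : C) : (Cmod q < 1)%R ->
  4 * Phi 1 q ^ 2 - 5 / 3 * Phi 3 q - / 3 * Phi 1 q + 2 * Psi q = 0.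
Proof.
  intros Hq. assert (H1 := conv_disc_dv_1 1). assert (H3 := conv_disc_dv_1 3).
  assert (Hn := conv_disc_INR _ _ H1).
  assert (E : 4 * (Phi 1 q * Phi 1 q) = 5 / 3 * Phi 3 q + (/ 3 * Phi 1 q + -(2) * Psi q)).
  { unfold Phi, Psi. rewrite <- (CPS_mult _ _ 1 q H1 H1 Hq).
    rewrite <- (CPS_scal 4 _ 1 q (conv_disc_mult _ _ _ H1 H1) Hq), (CPS_ext _ _ q Cconv_dv_1).
    exact (CPS_lin3 _ _ _ _ _ _ q H3 H1 Hn Hq). }
  transitivity (4 * (Phi 1 q * Phi 1 q) - 5 / 3 * Phi 3 q - / 3 * Phi 1 q + 2 * Psi q); [ring|].
  rewrite E. ring.
Qed.

Lemma Phi_alt_sq (q : C) : (Cmod q < 1)%R ->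
  4 * (-(1) * Phi 1 q + 4 * Phi 1 (q * q)) ^ 2 - (-(1) * Phi 3 q + 16 * Phi 3 (q * q))
  - (-(1) * Phi 1 q + 4 * Phi 1 (q * q)) + 2 * (-(1) * Psi q + 8 * Psi (q * q)) = 0.
Proof.
  intros Hq. assert (H1 := conv_disc_dv_m1 1). assert (H3 := conv_disc_dv_m1 3).
  assert (Hn := conv_disc_INR _ _ H1).
  assert (T1 := CPS_dv_m1 1 q Hq). assert (T3 := CPS_dv_m1 3 q Hq).
  assert (TN := CPS_INR_dv_m1 q Hq).
  replace (2 ^ 2) with (4 : C) in T1 by ring. replace (2 ^ 4) with (16 : C) in T3 by ring.
  rewrite <- T1, <- T3, <- TN. set (T := CPS (dv (-(1)) 1)).
  assert (E : 4 * (T q * T q) = 1 * CPS (dv (-(1)) 3) q + (1 * T q +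
    -(2) * CPS (fun n => RtoC (INR n) * dv (-(1)) 1 n) q)).
  { unfold T. rewrite <- (CPS_mult _ _ 1 q H1 H1 Hq).
    rewrite <- (CPS_scal 4 _ 1 q (conv_disc_mult _ _ _ H1 H1) Hq), (CPS_ext _ _ q Cconv_dv_m1).
    exact (CPS_lin3 _ _ _ _ _ _ q H3 H1 Hn Hq). }
  transitivity (4 * (T q * T q) - CPS (dv (-(1)) 3) q - T q +
    2 * CPS (fun n => RtoC (INR n) * dv (-(1)) 1 n) q); [ring|].
  rewrite E. ring.
Qed.

(* In terms of theta functions of nome [q], [eA = theta_2 ^ 4], [eS = theta_3 ^ 4] and
   [eU = 2 q theta_3' / theta_3]. *)
Definition eA (q : C) : C := 16 * (Phi 1 q - 3 * Phi 1 (q * q) + 2 * Phi 1 (q * q * (q * q))).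
Definition eS (q : C) : C := 1 + 8 * Phi 1 q - 32 * Phi 1 (q * q * (q * q)).
Definition eU (q : C) : C := 4 * (Phi 1 q - 5 * Phi 1 (q * q) + 4 * Phi 1 (q * q * (q * q))).
Definition DeA (q : C) : C := 16 * (Psi q - 6 * Psi (q * q) + 8 * Psi (q * q * (q * q))).
Definition DeS (q : C) : C := 8 * Psi q - 128 * Psi (q * q * (q * q)).
Definition DeU (q : C) : C := 4 * (Psi q - 10 * Psi (q * q) + 16 * Psi (q * q * (q * q))).

(** The relations are linear in the values of [Phi 3] and [Psi], with quadratic polynomials in the
    values of [Phi 1] as the remaining terms. Each claim is a fixed linear combination of them. *)
Lemma eisenstein_system (q : C) : (Cmod q < 1)%R ->
  DeA q = eA q * (eS q - eA q) + 2 * eA q * eU q /\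
  DeS q = 2 * eS q * eU q /\
  DeU q = eU q ^ 2 + / 4 * eA q * (eS q - eA q) /\
  Phi 3 q - 9 * Phi 3 (q * q) + 8 * Phi 3 (q * q * (q * q)) = / 32 * eA q * (2 * eS q - eA q) /\
  -(7) * Phi 3 (q * q) - 8 * Phi 3 (q * q * (q * q)) =
    / 32 * (2 - (2 * eS q ^ 2 - 2 * eA q * eS q + eA q ^ 2)).
Proof.
  intros Hq. assert (Hq2 := Cmod_sq_lt_1 q Hq). assert (Hq4 := Cmod_sq_lt_1 _ Hq2).
  assert (Hqn : (Cmod (- q) < 1)%R) by now rewrite Cmod_opp.
  assert (Z1 := Phi_sq q Hq). assert (Z2 := Phi_sq (- q) Hqn).
  assert (Z3 := Phi_sq _ Hq2). assert (Z4 := Phi_sq _ Hq4).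
  assert (Z5 := Phi_alt_sq q Hq). assert (Z6 := Phi_alt_sq (- q) Hqn).
  assert (Z7 := Phi_alt_sq _ Hq2).
  replace (- q * - q) with (q * q) in Z6 by ring.
  (* Only the arguments q, q^2 and q^4 remain after this. *)
  rewrite !Phi_neg, Psi_neg in Z2, Z6 by exact Hq.
  unfold DeA, DeS, DeU, eA, eS, eU.
  set (F1 := Phi 1 q) in *. set (F2 := Phi 1 (q * q)) in *.
  set (F4 := Phi 1 (q * q * (q * q))) in *. set (R1 := Phi 3 q) in *.
  set (R2 := Phi 3 (q * q)) in *. set (R4 := Phi 3 (q * q * (q * q))) in *.
  set (G1 := Psi q) in *. set (G2 := Psi (q * q)) in *. set (G4 := Psi (q * q * (q * q))) in *.
  clearbody F1 F2 F4 R1 R2 R4 G1 G2 G4.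
  (* [L] says that every linear combination of the seven left-hand sides vanishes, so each claim
     becomes a polynomial identity once the multipliers are supplied. *)
  match type of Z1 with ?e1 = RtoC 0 => match type of Z2 with ?e2 = RtoC 0 =>
  match type of Z3 with ?e3 = RtoC 0 => match type of Z4 with ?e4 = RtoC 0 =>
  match type of Z5 with ?e5 = RtoC 0 => match type of Z6 with ?e6 = RtoC 0 =>
  match type of Z7 with ?e7 = RtoC 0 =>
    assert (L : forall c1 c2 c3 c4 c5 c6 c7 : C,
      c1 * e1 + c2 * e2 + c3 * e3 + c4 * e4 + c5 * e5 + c6 * e6 + c7 * e7 = 0)
      by (intros; rewrite Z1, Z2, Z3, Z4, Z5, Z6, Z7; ring)
  end end end end end end end.
  repeat split; apply Ceq_minus.
  (* The multipliers solve the linear equations obtained by matching monomials in [F1], ...,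
     [G4]. *)
  - rewrite <- (L (-(6)) 6 0 0 (-(10)) 10 0). field.
  - rewrite <- (L 4 10 0 256 (-(20)) (-(10)) 0). field.
  - rewrite <- (L (-(2)) 1 (-(12)) (-(32)) 0 5 0). field.
  - rewrite <- (L (-(3 / 4)) (3 / 4) 0 0 (-(3 / 4)) (3 / 4) 0). field.
  - rewrite <- (L (5 / 4) (5 / 4) (-(12)) 32 (-(3 / 4)) (-(3 / 4)) 0). field.
Qed.

(** * Dissection, and the divisor sums of the statement *)

Lemma is_Cseries_even_part (c : nat -> C) (q : C) :
  conv_disc c 1 -> (Cmod q < 1)%R ->
  is_Cseries (fun k => c (2 * k)%nat * q ^ (2 * k)) (/ 2 * (CPS c q + CPS c (- q))).
Proof.
  intros Hc Hq. assert (Hqn : (Cmod (- q) < 1)%R) by now rewrite Cmod_opp.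
  set (u := fun n => / 2 * (c n * q ^ n + c n * (- q) ^ n)).
  assert (Hu : is_Cseries u (/ 2 * (CPS c q + CPS c (- q)))).
  { apply is_Cseries_scal, is_Cseries_plus; now apply (CPS_correct _ 1). }
  assert (E : forall n, (- q) ^ n = (-(1)) ^ n * q ^ n).
  { intros n. rewrite <- Cpow_mult_l. f_equal. ring. }
  apply is_Cseries_even in Hu.
  - revert Hu. apply is_Cseries_ext. intros k. unfold u. rewrite E, m1_pow_double. field.
  - intros k. unfold u. rewrite E, m1_pow_double_S. ring.
Qed.

Lemma is_Cseries_odd_part (c : nat -> C) (q : C) :
  conv_disc c 1 -> (Cmod q < 1)%R ->
  is_Cseries (fun k => c (2 * k + 1)%nat * q ^ (2 * k + 1)) (/ 2 * (CPS c q - CPS c (- q))).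
Proof.
  intros Hc Hq.
  assert (H := is_Cseries_even_part _ q (conv_disc_shift _ _ Hc) Hq).
  apply (is_Cseries_scal q) in H.
  assert (Hqn : (Cmod (- q) < 1)%R) by now rewrite Cmod_opp.
  rewrite (CPS_shift c 1 q Hc Hq), (CPS_shift c 1 (- q) Hc Hqn).
  replace (/ 2 * (c 0%nat + q * CPS (shift_coeff c) q -
    (c 0%nat + - q * CPS (shift_coeff c) (- q))))
    with (q * (/ 2 * (CPS (shift_coeff c) q + CPS (shift_coeff c) (- q)))) by ring.
  revert H. apply is_Cseries_ext. intros k. unfold shift_coeff.
  replace (2 * k + 1)%nat with (S (2 * k)) by lia. rewrite Cpow_S. ring.
Qed.

Lemma Zsum_app (l l' : list Z) : Zsum (l ++ l') = (Zsum l + Zsum l')%Z.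
Proof. induction l as [|z l IH]; simpl; [reflexivity|]. rewrite IH. lia. Qed.

Lemma Zsum_divisors (g : nat -> Z) (n : nat) :
  RtoC (IZR (Zsum (map g (Defs.divisors n)))) = divsum (fun d => RtoC (IZR (g d))) n.
Proof.
  unfold divsum, Defs.divisors. destruct n as [|m]; [reflexivity|].
  set (n := S m). assert (Hn : (1 <=? n)%nat = true) by reflexivity. clearbody n.
  (* Only the two range bounds are generalised; n stays fixed in the divisibility tests. *)
  generalize n at 2 4. intros B. induction B as [|B IH]; [reflexivity|].
  rewrite seq_S, filter_app, map_app, Zsum_app, plus_IZR, RtoC_plus, IH.
  cbn [sum1]. f_equal. cbn [filter]. unfold Nmul. rewrite Hn. cbn [andb].
  change (1 + B)%nat with (S B).
  destruct (n mod S B =? 0)%nat; cbn [map Zsum fold_right ind]; rewrite ?Z.add_0_r; ring.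
Qed.

Lemma RtoC_IZR_pow (z : Z) (k : nat) : RtoC (IZR (z ^ Z.of_nat k)) = RtoC (IZR z) ^ k.
Proof. rewrite <- pow_IZR. apply RtoC_pow. Qed.

Lemma RtoC_IZR_nat (d : nat) : RtoC (IZR (Z.of_nat d)) = RtoC (INR d).
Proof. now rewrite INR_IZR_INZ. Qed.

Lemma RtoC_m1 : RtoC (IZR (-1)) = -(1).
Proof. apply (RtoC_opp 1). Qed.

Lemma sigma_tilde_dv (s n : nat) :
  RtoC (IZR (sigma_tilde s n)) = -(1) * dv (-(1)) s n.
Proof.
  unfold sigma_tilde. rewrite Zsum_divisors. unfold dv, divsum. rewrite <- sum1_scal.
  apply sum1_ext. intros d Hd.
  rewrite mult_IZR, RtoC_mult, !RtoC_IZR_pow, RtoC_IZR_nat, RtoC_m1.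
  unfold chi_pow. replace ((-(1)) ^ d) with (-(1) * (-(1)) ^ (d - 1) : C).
  - ring.
  - rewrite <- Cpow_S. f_equal. lia.
Qed.

Lemma Nmul_mult (d m : nat) : (1 <= d)%nat -> (1 <= m)%nat -> Nmul d (d * m) = 1.
Proof.
  intros Hd Hm. unfold Nmul. rewrite Nat.mul_comm, Nat.Div0.mod_mul.
  replace (1 <=? m * d)%nat with true by (symmetry; apply Nat.leb_le; nia). reflexivity.
Qed.

Lemma Nmul_cases (d n : nat) : (1 <= d)%nat ->
  {m | n = (d * m)%nat /\ (1 <= m)%nat} + {Nmul d n = 0 /\ Nmul (2 * d) n = 0}.
Proof.
  intros Hd. destruct n as [|n]; [right; split; reflexivity|].
  destruct (Nat.eq_dec (S n mod d) 0) as [E|E].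
  - left. exists (S n / d)%nat. assert (H := Nat.div_mod_eq (S n) d).
    split; [lia|]. destruct (S n / d)%nat; lia.
  - right. unfold Nmul. replace (S n mod d =? 0)%nat with false by (symmetry; now apply Nat.eqb_neq).
    rewrite andb_false_r. split; [reflexivity|].
    replace (S n mod (2 * d) =? 0)%nat with false; [now rewrite andb_false_r|].
    symmetry. apply Nat.eqb_neq. intros F. apply E.
    apply Nat.Div0.mod_divides in F. destruct F as [c Hc].
    apply Nat.Div0.mod_divides. exists (2 * c)%nat. lia.
Qed.

(** (-1)^(m - 1) = 1 - 2 [m even], and for a divisor d of n the quotient n / d is even exactly when
    2 d divides n. *)
Lemma sigma_hat_dv (n : nat) :
  RtoC (IZR (sigma_hat 1 n)) = 1 * dv 1 1 n + -(2) * spread2 (dv 1 1) n.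
Proof.
  unfold sigma_hat. rewrite Zsum_divisors.
  assert (E : spread2 (dv 1 1) n = sum1 (fun d => RtoC (INR d) * Nmul (2 * d) n) n).
  { destruct (even_odd_dec n) as [[k Hk]|[k Hk]].
    - replace (spread2 (dv 1 1) n) with (dv 1 1 k) by (rewrite Hk; symmetry; apply spread2_double).
      rewrite (dv_widen 1 1 k n) by lia. apply sum1_ext. intros d Hd.
      rewrite Hk, Nmul_double by lia. unfold chi_pow. rewrite Cpow_1_l. ring.
    - replace (spread2 (dv 1 1) n) with (RtoC 0)
        by (rewrite Hk; symmetry; apply spread2_double_S).
      symmetry. apply sum1_zero. intros d Hd. rewrite Hk, Nmul_even_odd by lia. ring. }
  rewrite E. unfold dv, divsum. rewrite <- !sum1_scal, <- sum1_plus. apply sum1_ext. intros d Hd.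
  rewrite mult_IZR, RtoC_mult, !RtoC_IZR_pow, RtoC_IZR_nat, RtoC_m1.
  unfold chi_pow. rewrite Cpow_1_l.
  destruct (Nmul_cases d n) as [[m [Hn Hm]]|[H1 H2]]; [lia| |rewrite H1, H2; ring].
  replace (n / d)%nat with m by (rewrite Hn, Nat.mul_comm, Nat.div_mul; lia).
  rewrite Hn, Nmul_mult by lia.
  destruct (even_odd_dec m) as [[k Hk]|[k Hk]].
  - replace (Nmul (2 * d) (d * m)) with (RtoC 1).
    + destruct k as [|k]; [lia|]. replace (m - 1)%nat with (S (2 * k)) by lia.
      rewrite m1_pow_double_S. simpl. ring.
    + symmetry. replace (d * m)%nat with ((2 * d) * k)%nat by (rewrite Hk; lia).
      apply Nmul_mult; lia.
  - replace (Nmul (2 * d) (d * m)) with (RtoC 0).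
    + replace (m - 1)%nat with (2 * k)%nat by lia. rewrite m1_pow_double. simpl. ring.
    + unfold Nmul. replace (d * m mod (2 * d) =? 0)%nat with false; [now rewrite andb_false_r|].
      symmetry. apply Nat.eqb_neq. intros F.
      apply Nat.Div0.mod_divides in F. destruct F as [c Hc].
      assert (m = 2 * c)%nat by nia. lia.
Qed.

Lemma CPS_sigma_tilde (s : nat) (q : C) : (Cmod q < 1)%R ->
  CPS (fun n => RtoC (IZR (sigma_tilde s n))) q = Phi s q - 2 ^ S s * Phi s (q * q).
Proof.
  intros Hq. rewrite (CPS_ext _ _ q (sigma_tilde_dv s)).
  rewrite (CPS_scal _ _ 1 q (conv_disc_dv_m1 s) Hq), CPS_dv_m1 by exact Hq. ring.
Qed.

Lemma conv_disc_sigma_tilde (s : nat) : conv_disc (fun n => RtoC (IZR (sigma_tilde s n))) 1.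
Proof.
  apply conv_disc_ext with (fun n => -(1) * dv (-(1)) s n).
  - intros n. symmetry. apply sigma_tilde_dv.
  - apply conv_disc_scal, conv_disc_dv_m1.
Qed.

Lemma CPS_sigma_hat (q : C) : (Cmod q < 1)%R ->
  CPS (fun n => RtoC (IZR (sigma_hat 1 n))) q = Phi 1 q - 2 * Phi 1 (q * q).
Proof.
  intros Hq. assert (H := conv_disc_dv_1 1). assert (H2 := conv_disc_spread2 _ H).
  rewrite (CPS_ext _ _ q sigma_hat_dv), (CPS_lin2 _ _ _ _ q H H2 Hq), (CPS_spread2 _ q H Hq).
  unfold Phi. ring.
Qed.

Lemma conv_disc_sigma_hat : conv_disc (fun n => RtoC (IZR (sigma_hat 1 n))) 1.
Proof.
  apply conv_disc_ext with (fun n => 1 * dv 1 1 n + -(2) * spread2 (dv 1 1) n).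
  - intros n. symmetry. apply sigma_hat_dv.
  - apply conv_disc_plus; apply conv_disc_scal; [|apply conv_disc_spread2]; apply conv_disc_dv_1.
Qed.

Lemma dissected_sum_even (a : nat -> Z) (q l : C) :
  conv_disc (fun n => RtoC (IZR (a n))) 1 -> (Cmod q < 1)%R ->
  l = / 2 * (CPS (fun n => RtoC (IZR (a n))) q + CPS (fun n => RtoC (IZR (a n))) (- q)) ->
  is_dissected_sum a 0 q l.
Proof.
  intros Ha Hq ->. generalize (is_Cseries_even_part _ q Ha Hq).
  apply is_Cseries_ext. intros n. now rewrite Nat.add_0_r.
Qed.

Lemma dissected_sum_odd (a : nat -> Z) (q l : C) :
  conv_disc (fun n => RtoC (IZR (a n))) 1 -> (Cmod q < 1)%R ->
  l = / 2 * (CPS (fun n => RtoC (IZR (a n))) q - CPS (fun n => RtoC (IZR (a n))) (- q)) ->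
  is_dissected_sum a 1 q l.
Proof. intros Ha Hq ->. exact (is_Cseries_odd_part _ q Ha Hq). Qed.

(** Even and odd parts are half sums and half differences of the values at q and - q, reduced by
    [Phi_neg]. The sums with s = 1 stay linear in [Phi 1]; the cubic ones use the last two
    identities of [eisenstein_system]. *)
Lemma dissected_sums (q : C) : (Cmod q < 1)%R ->
  is_P 0 q (- Phi 1 (q * q) - 2 * Phi 1 (q * q * (q * q))) /\
  is_P 1 q (/ 16 * eA q) /\
  is_E 0 q (Phi 1 (q * q) - 2 * Phi 1 (q * q * (q * q))) /\
  is_E 1 q (/ 16 * eA q) /\
  is_Q 0 q (/ 32 * (2 - (2 * eS q ^ 2 - 2 * eA q * eS q + eA q ^ 2))) /\
  is_Q 1 q (/ 32 * eA q * (2 * eS q - eA q)).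
Proof.
  intros Hq. assert (Hqn : (Cmod (- q) < 1)%R) by now rewrite Cmod_opp.
  destruct (eisenstein_system q Hq) as (_ & _ & _ & Q1 & Q0).
  assert (Hsq : - q * - q = q * q) by ring.
  assert (HT := conv_disc_sigma_tilde). assert (HH := conv_disc_sigma_hat).
  assert (ET := fun s => CPS_sigma_tilde s q Hq). assert (EH := CPS_sigma_hat q Hq).
  assert (ET' := fun s => CPS_sigma_tilde s (- q) Hqn). assert (EH' := CPS_sigma_hat (- q) Hqn).
  assert (N := fun s => Phi_neg s q Hq). rewrite Hsq in EH'.
  split; [|split; [|split; [|split; [|split]]]].
  - apply (dissected_sum_even _ q _ (HT 1%nat) Hq). rewrite ET, ET', Hsq, N. simpl. field.
  - apply (dissected_sum_odd _ q _ (HT 1%nat) Hq). rewrite ET, ET', Hsq, N. unfold eA. simpl. field.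
  - apply (dissected_sum_even _ q _ HH Hq). rewrite EH, EH', N. simpl. field.
  - apply (dissected_sum_odd _ q _ HH Hq). rewrite EH, EH', N. unfold eA. simpl. field.
  - apply (dissected_sum_even _ q _ (HT 3%nat) Hq). rewrite ET, ET', Hsq, N, <- Q0. simpl. field.
  - apply (dissected_sum_odd _ q _ (HT 3%nat) Hq). rewrite ET, ET', Hsq, N, <- Q1. simpl. field.
Qed.

(** * Singular linear systems *)

(** A first-order jet with O(h^2) remainder: stable under products and composition, and exactly the
    initial data that the singular system consumes. *)
Definition expands (f : C -> C) (c0 c1 : C) : Prop :=
  exists K d : R, (0 <= K)%R /\ (0 < d <= 1)%R /\
    forall h : C, (Cmod h < d)%R -> (Cmod (f h - c0 - c1 * h) <= K * Cmod h ^ 2)%R.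

Lemma expands_eq (f : C -> C) (c0 c1 d0 d1 : C) :
  expands f c0 c1 -> c0 = d0 -> c1 = d1 -> expands f d0 d1.
Proof. now intros H <- <-. Qed.

Lemma expands_ext (f g : C -> C) (c0 c1 : C) :
  (forall h, (Cmod h < 1)%R -> f h = g h) -> expands f c0 c1 -> expands g c0 c1.
Proof.
  intros E [K [d [HK [Hd H]]]]. exists K, d. repeat split; try tauto; try lra.
  intros h Hh. rewrite <- E by lra. now apply H.
Qed.

Lemma expands_const (c : C) : expands (fun _ => c) c 0.
Proof.
  exists 0%R, 1%R. repeat split; try lra. intros h _.
  replace (c - c - 0 * h) with (RtoC 0) by ring. rewrite Cmod_0. lra.
Qed.

Lemma expands_id : expands (fun h => h) 0 1.
Proof.
  exists 0%R, 1%R. repeat split; try lra. intros h _.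
  replace (h - 0 - 1 * h) with (RtoC 0) by ring. rewrite Cmod_0. lra.
Qed.

Lemma expands_plus (f g : C -> C) (a0 a1 b0 b1 : C) :
  expands f a0 a1 -> expands g b0 b1 -> expands (fun h => f h + g h) (a0 + b0) (a1 + b1).
Proof.
  intros [K [d [HK [Hd H]]]] [L [e [HL [He H']]]].
  exists (K + L)%R, (Rmin d e). split; [lra|]. split.
  { split; [now apply Rmin_glb_lt|]. eapply Rle_trans; [apply Rmin_l|]. lra. }
  intros h Hh. assert (H1 := Rmin_l d e). assert (H2 := Rmin_r d e).
  specialize (H h ltac:(lra)). specialize (H' h ltac:(lra)).
  replace (f h + g h - (a0 + b0) - (a1 + b1) * h)
    with ((f h - a0 - a1 * h) + (g h - b0 - b1 * h)) by ring.
  eapply Rle_trans; [apply Cmod_triangle|]. lra.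
Qed.

Lemma expands_mult (f g : C -> C) (a0 a1 b0 b1 : C) :
  expands f a0 a1 -> expands g b0 b1 ->
  expands (fun h => f h * g h) (a0 * b0) (a0 * b1 + a1 * b0).
Proof.
  intros [K [d [HK [Hd H]]]] [L [e [HL [He H']]]].
  assert (Ha0 := Cmod_ge_0 a0). assert (Ha1 := Cmod_ge_0 a1).
  assert (Hb0 := Cmod_ge_0 b0). assert (Hb1 := Cmod_ge_0 b1).
  set (G := (Cmod b0 + Cmod b1 + L)%R).
  exists (K * G + (Cmod a0 + Cmod a1) * L + Cmod a1 * Cmod b1)%R, (Rmin d e).
  assert (HG : (0 <= G)%R) by (unfold G; lra).
  split; [|split].
  { apply Rplus_le_le_0_compat; [apply Rplus_le_le_0_compat|]; apply Rmult_le_pos; lra. }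
  { split; [now apply Rmin_glb_lt|]. eapply Rle_trans; [apply Rmin_l|]. lra. }
  intros h Hh. assert (H1 := Rmin_l d e). assert (H2 := Rmin_r d e).
  specialize (H h ltac:(lra)). specialize (H' h ltac:(lra)).
  assert (Hh0 := Cmod_ge_0 h). set (m := Cmod h) in *.
  assert (Hm1 : (m <= 1)%R) by lra.
  assert (Hm2 : (0 <= m ^ 2 <= m)%R) by (simpl; nra).
  set (rf := f h - a0 - a1 * h) in *. set (rg := g h - b0 - b1 * h) in *.
  assert (Hg : (Cmod (g h) <= G)%R).
  { replace (g h) with (b0 + (b1 * h + rg)) by (unfold rg; ring).
    eapply Rle_trans; [apply Cmod_triangle|]. unfold G. rewrite Rplus_assoc.
    apply Rplus_le_compat_l. eapply Rle_trans; [apply Cmod_triangle|]. rewrite Cmod_mult.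
    fold m. apply Rplus_le_compat.
    - rewrite <- (Rmult_1_r (Cmod b1)) at 2. apply Rmult_le_compat_l; lra.
    - eapply Rle_trans; [exact H'|]. rewrite <- (Rmult_1_r L) at 2.
      apply Rmult_le_compat_l; lra. }
  replace (f h * g h - a0 * b0 - (a0 * b1 + a1 * b0) * h)
    with (rf * g h + ((a0 + a1 * h) * rg + a1 * b1 * (h * h))) by (unfold rf, rg; ring).
  eapply Rle_trans; [apply Cmod_triangle|].
  eapply Rle_trans; [apply Rplus_le_compat_l, Cmod_triangle|].
  rewrite !Cmod_mult. fold m.
  assert (T1 : (Cmod rf * Cmod (g h) <= K * m ^ 2 * G)%R)
    by (apply Rmult_le_compat; try apply Cmod_ge_0; assumption).
  assert (Hl : (Cmod (a0 + a1 * h) <= Cmod a0 + Cmod a1)%R).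
  { eapply Rle_trans; [apply Cmod_triangle|]. rewrite Cmod_mult. fold m.
    apply Rplus_le_compat_l. rewrite <- (Rmult_1_r (Cmod a1)) at 2.
    apply Rmult_le_compat_l; lra. }
  assert (T2 : (Cmod (a0 + a1 * h) * Cmod rg <= (Cmod a0 + Cmod a1) * (L * m ^ 2))%R)
    by (apply Rmult_le_compat; try apply Cmod_ge_0; assumption).
  simpl pow in *. lra.
Qed.

Lemma expands_scal (c : C) (f : C -> C) (a0 a1 : C) :
  expands f a0 a1 -> expands (fun h => c * f h) (c * a0) (c * a1).
Proof.
  intros H. eapply expands_eq; [apply (expands_mult _ _ _ _ _ _ (expands_const c) H)| |]; ring.
Qed.

Lemma expands_mult_id (f : C -> C) (l : C) :
  is_Cderive f 0 l -> expands (fun h => h * f h) 0 (f 0).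
Proof.
  intros H. destruct (is_Cderive_lipschitz f 0 l H) as [d [Hd Hf]].
  assert (Hl := Cmod_ge_0 l).
  exists (Cmod l + 1)%R, (Rmin d 1). split; [lra|]. split.
  { split; [apply Rmin_glb_lt; lra|apply Rmin_r]. }
  intros h Hh. assert (H1 := Rmin_l d 1). specialize (Hf h ltac:(lra)).
  rewrite Cplus_0_l in Hf.
  replace (h * f h - 0 - f 0 * h) with (h * (f h - f 0)) by ring.
  rewrite Cmod_mult. assert (Hh0 := Cmod_ge_0 h).
  replace ((Cmod l + 1) * Cmod h ^ 2)%R with (Cmod h * ((Cmod l + 1) * Cmod h))%R by (simpl; ring).
  now apply Rmult_le_compat_l.
Qed.

Lemma expands_CPS (a : nat -> C) : conv_disc a 1 -> expands (CPS a) (a 0%nat) (a 1%nat).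
Proof.
  intros Ha. assert (Hs := conv_disc_shift _ _ Ha).
  apply (expands_ext (fun h => a 0%nat + h * CPS (shift_coeff a) h)).
  { intros h Hh. symmetry. now apply (CPS_shift a 1). }
  eapply expands_eq.
  - apply (expands_plus (fun _ => a 0%nat) _ (a 0%nat) 0); [apply expands_const|].
    apply expands_mult_id with (CPS (deriv_coeff (shift_coeff a)) 0).
    apply (CPS_derive _ 1); [exact Hs|rewrite Cmod_0; lra].
  - ring.
  - rewrite CPS_at_0. unfold shift_coeff. ring.
Qed.

Lemma expands_comp (f g : C -> C) (a0 a1 b1 : C) :
  expands f a0 a1 -> expands g 0 b1 -> expands (fun h => f (g h)) a0 (a1 * b1).
Proof.
  intros [K [d [HK [Hd H]]]] [L [e [HL [He H']]]].
  assert (Ha1 := Cmod_ge_0 a1). assert (Hb1 := Cmod_ge_0 b1).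
  (* |g h| <= G |h|, whence the radius d / G below. *)
  set (G := (Cmod b1 + L + 1)%R). assert (HG : (1 <= G)%R) by (unfold G; lra).
  exists (K * G ^ 2 + Cmod a1 * L)%R, (Rmin e (d / G)).
  assert (HdG : (0 < d / G)%R) by (apply Rdiv_lt_0_compat; lra).
  split; [|split].
  { apply Rplus_le_le_0_compat; apply Rmult_le_pos; try lra. apply pow_le; lra. }
  { split; [apply Rmin_glb_lt; lra|]. eapply Rle_trans; [apply Rmin_l|]. lra. }
  intros h Hh. assert (H1 := Rmin_l e (d / G)). assert (H2 := Rmin_r e (d / G)).
  specialize (H' h ltac:(lra)). assert (Hh0 := Cmod_ge_0 h). set (m := Cmod h) in *.
  assert (Hm2 : (0 <= m ^ 2 <= m)%R) by (simpl; nra).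
  replace (g h - 0 - b1 * h) with (g h - b1 * h) in H' by ring.
  assert (Hg : (Cmod (g h) <= G * m)%R).
  { replace (g h) with (b1 * h + (g h - b1 * h)) by ring.
    eapply Rle_trans; [apply Cmod_triangle|]. rewrite Cmod_mult. fold m.
    assert (L * m ^ 2 <= L * m)%R by (apply Rmult_le_compat_l; lra). unfold G. lra. }
  assert (Hgd : (Cmod (g h) < d)%R).
  { eapply Rle_lt_trans; [exact Hg|]. replace d with (G * (d / G))%R by (field; lra).
    apply Rmult_lt_compat_l; lra. }
  specialize (H (g h) Hgd).
  replace (f (g h) - a0 - a1 * b1 * h)
    with ((f (g h) - a0 - a1 * g h) + a1 * (g h - b1 * h)) by ring.
  eapply Rle_trans; [apply Cmod_triangle|]. rewrite Cmod_mult.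
  assert (T1 : (Cmod a1 * Cmod (g h - b1 * h) <= Cmod a1 * (L * m ^ 2))%R)
    by now apply Rmult_le_compat_l.
  assert (T2 : (K * Cmod (g h) ^ 2 <= K * (G * m) ^ 2)%R).
  { apply Rmult_le_compat_l; [exact HK|]. apply pow_incr. split; [apply Cmod_ge_0|exact Hg]. }
  rewrite Rpow_mult_distr in T2. lra.
Qed.

(** * Gronwall estimates at a singular point *)

Lemma gronwall_step (N N' : R -> R) (n : nat) (s t : R) :
  (0 < s <= t)%R ->
  (forall r, s <= r <= t -> is_derive N r (N' r) /\ r * N' r <= INR n * N r)%R ->
  (N t / t ^ n <= N s / s ^ n)%R.
Proof.
  intros Hst H.
  destruct (Rle_lt_or_eq_dec s t (proj2 Hst)) as [Hlt|<-]; [|lra].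
  set (D := fun r => ((N' r * r ^ n - N r * (INR n * r ^ pred n)) / (r ^ n) ^ 2)%R).
  destruct (MVT_cor2 (fun r => N r / r ^ n)%R D s t Hlt) as [c [Hc Hcst]].
  { intros r Hr. apply is_derive_Reals. apply is_derive_div.
    - now apply H.
    - auto_derive; [exact I|]. simpl. ring.
    - apply pow_nonzero. lra. }
  assert (HD : (D c <= 0)%R).
  { unfold D. destruct (H c ltac:(lra)) as [_ Hn].
    assert (Hcn : (0 < c ^ n)%R) by (apply pow_lt; lra).
    assert (Hp : (0 < (c ^ n) ^ 2)%R) by now apply pow_lt.
    apply Rmult_le_reg_r with (c * (c ^ n) ^ 2 / c ^ n)%R.
    { apply Rdiv_lt_0_compat; [|exact Hcn]. apply Rmult_lt_0_compat; lra. }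
    assert (Hcp : (INR n * (c * c ^ pred n) = INR n * c ^ n)%R).
    { destruct n as [|n]; [simpl; ring|reflexivity]. }
    replace ((N' c * c ^ n - N c * (INR n * c ^ pred n)) / (c ^ n) ^ 2 * (c * (c ^ n) ^ 2 / c ^ n))%R
      with ((c * N' c * c ^ n - N c * (INR n * (c * c ^ pred n))) / c ^ n)%R by (field; lra).
    rewrite Hcp, Rmult_0_l.
    replace ((c * N' c * c ^ n - N c * (INR n * c ^ n)) / c ^ n)%R
      with (c * N' c - INR n * N c)%R by (field; lra). lra. }
  assert (D c * (t - s) <= 0 * (t - s))%R by (apply Rmult_le_compat_r; lra). lra.
Qed.

(** On (0, t0], N / t^3 is nonincreasing in t yet at most B t, so N t0 = 0; from [t0] to 1 any
    finite rate preserves zero. What matters is that the rate 3 is below the order 4 of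
    vanishing. *)
Lemma gronwall (N N' : R -> R) (C0 B t0 : R) :
  (forall t, 0 < t <= 1 -> 0 <= N t)%R ->
  (forall t, 0 < t <= 1 -> is_derive N t (N' t) /\ t * N' t <= C0 * N t)%R ->
  (0 < t0 <= 1)%R ->
  (forall t, 0 < t <= t0 -> t * N' t <= 3 * N t)%R ->
  (forall t, 0 < t <= t0 -> N t <= B * t ^ 4)%R ->
  N 1%R = 0%R.
Proof.
  intros Hpos HD Ht0 H3 HB.
  assert (E0 : N t0 = 0%R).
  { apply Rle_antisym; [|apply Hpos; lra]. apply Rnot_lt_le; intros Hlt.
    assert (Ht3 : (0 < t0 ^ 3)%R) by (apply pow_lt; lra).
    assert (Hv : (0 < N t0 / t0 ^ 3)%R) by now apply Rdiv_lt_0_compat.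
    assert (HB0 := Rabs_pos B).
    (* Makes |B| s at most half of N t0 / t0^3, against monotonicity. *)
    set (s := Rmin t0 (N t0 / t0 ^ 3 / (2 * (Rabs B + 1)))%R).
    assert (Hs : (0 < s)%R).
    { apply Rmin_glb_lt; [lra|]. apply Rdiv_lt_0_compat; lra. }
    assert (Hs1 : (s <= t0)%R) by apply Rmin_l.
    assert (Hs2 : (s <= N t0 / t0 ^ 3 / (2 * (Rabs B + 1)))%R) by apply Rmin_r.
    assert (G := gronwall_step N N' 3 s t0 ltac:(lra)).
    assert (G' : (N t0 / t0 ^ 3 <= N s / s ^ 3)%R).
    { apply G. intros r Hr. split; [apply HD; lra|]. replace (INR 3) with 3%R by (simpl; ring).
      apply H3; lra. }
    assert (Hs3 : (0 < s ^ 3)%R) by now apply pow_lt.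
    assert (HBs : (N s / s ^ 3 <= B * s)%R).
    { apply Rmult_le_reg_r with (s ^ 3)%R; [exact Hs3|].
      unfold Rdiv. rewrite Rmult_assoc, Rinv_l, Rmult_1_r by lra.
      replace (B * s * s ^ 3)%R with (B * s ^ 4)%R by ring. apply HB; lra. }
    assert (HBa : (B * s <= Rabs B * s)%R)
      by (apply Rmult_le_compat_r; [lra|apply Rle_abs]).
    assert (Hf : ((Rabs B + 1) * s <= (Rabs B + 1) * (N t0 / t0 ^ 3 / (2 * (Rabs B + 1))))%R)
      by (apply Rmult_le_compat_l; lra).
    replace ((Rabs B + 1) * (N t0 / t0 ^ 3 / (2 * (Rabs B + 1))))%R with (N t0 / t0 ^ 3 / 2)%R
      in Hf by (field; lra).
    lra. }
  destruct (nfloor_ex (Rmax C0 0)) as [n [_ Hn]]; [apply Rmax_r|].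
  assert (Hn' : (C0 <= INR (S n))%R) by (rewrite S_INR; generalize (Rmax_l C0 0); lra).
  assert (G : (N 1 / 1 ^ S n <= N t0 / t0 ^ S n)%R).
  { apply (gronwall_step N N'); [exact Ht0|]. intros r Hr. destruct (HD r ltac:(lra)) as [D1 D2].
    split; [exact D1|]. eapply Rle_trans; [exact D2|].
    apply Rmult_le_compat_r; [apply Hpos; lra|exact Hn']. }
  rewrite E0, pow1 in G. unfold Rdiv in G. rewrite Rmult_0_l, Rinv_1, Rmult_1_r in G.
  apply Rle_antisym; [exact G|apply Hpos; lra].
Qed.

(** Extreme values of the real and imaginary parts on the compact segment. *)
Lemma Cderivable_bounded (f : C -> C) (x : C) :
  (forall t, (0 <= t <= 1)%R -> exists l, is_Cderive f (0 + RtoC t * x) l) ->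
  exists K : R, forall t, (0 <= t <= 1)%R -> (Cmod (f (0 + RtoC t * x)%C) <= K)%R.
Proof.
  intros H.
  assert (B : forall g : R -> R, (forall t, (0 <= t <= 1)%R -> ex_derive g t) ->
    exists K, forall t, (0 <= t <= 1)%R -> (Rabs (g t) <= K)%R).
  { intros g Hg.
    assert (Hc : forall t, (0 <= t <= 1)%R -> continuity_pt g t).
    { intros t Ht. destruct (Hg t Ht) as [l Hl]. apply derivable_continuous_pt.
      exists l. now apply is_derive_Reals. }
    destruct (continuity_ab_maj g 0 1) as [M [HM _]]; [lra|exact Hc|].
    destruct (continuity_ab_min g 0 1) as [m [Hm _]]; [lra|exact Hc|].
    exists (Rmax (Rabs (g M)) (Rabs (g m))). intros t Ht. specialize (HM t Ht). specialize (Hm t Ht).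
    generalize (Rmax_l (Rabs (g M)) (Rabs (g m))) (Rmax_r (Rabs (g M)) (Rabs (g m))).
    unfold Rabs. repeat destruct Rcase_abs; lra. }
  destruct (B (fun s => Re (f (0 + RtoC s * x)))) as [K1 H1].
  { intros t Ht. destruct (H t Ht) as [l Hl]. exists (Re (l * x)). now apply is_derive_Re_line. }
  destruct (B (fun s => Im (f (0 + RtoC s * x)))) as [K2 H2].
  { intros t Ht. destruct (H t Ht) as [l Hl]. exists (Im (l * x)). now apply is_derive_Re_line. }
  exists (K1 + K2)%R. intros t Ht. eapply Rle_trans; [apply Cmod_le_Re_Im|].
  specialize (H1 t Ht). specialize (H2 t Ht). simpl in *. lra.
Qed.

(** The slack 1/16 is tuned to the eight coefficients of the system: it raises the rate 9/4 by at
    most 3/8, still below 3. *)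
Lemma coeff_radius (c : nat -> C -> C) (n : nat) :
  (forall i, exists m, is_Cderive (c i) 0 m) ->
  exists d : R, (0 < d)%R /\ forall i h, (i < n)%nat -> (Cmod h < d)%R ->
    (Cmod (c i h) <= Cmod (c i 0%C) + / 16)%R.
Proof.
  intros H. induction n as [|n [d [Hd IH]]].
  - exists 1%R. split; [lra|]. intros; lia.
  - destruct (H n) as [m Hm]. destruct (is_Cderive_lipschitz _ _ _ Hm) as [e [He Hl]].
    assert (Hm0 := Cmod_ge_0 m).
    assert (Hr : (0 < / 16 / (Cmod m + 1))%R) by (apply Rdiv_lt_0_compat; lra).
    exists (Rmin d (Rmin e (/ 16 / (Cmod m + 1)))). split.
    { repeat apply Rmin_glb_lt; lra. }
    intros i h Hi Hh.
    assert (M1 := Rmin_l d (Rmin e (/ 16 / (Cmod m + 1)))).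
    assert (M2 := Rmin_r d (Rmin e (/ 16 / (Cmod m + 1)))).
    assert (M3 := Rmin_l e (/ 16 / (Cmod m + 1))). assert (M4 := Rmin_r e (/ 16 / (Cmod m + 1))).
    destruct (Nat.eq_dec i n) as [->|Hne]; [|apply IH; [lia|lra]].
    specialize (Hl h ltac:(lra)). rewrite Cplus_0_l in Hl.
    replace (c n h) with (c n 0 + (c n h - c n 0)) by ring.
    eapply Rle_trans; [apply Cmod_triangle|]. apply Rplus_le_compat_l.
    eapply Rle_trans; [exact Hl|].
    replace (/ 16)%R with ((Cmod m + 1) * (/ 16 / (Cmod m + 1)))%R by (field; lra).
    apply Rmult_le_compat_l; lra.
Qed.

Lemma coeff_bound (c : nat -> C -> C) (x : C) (n : nat) :
  (forall i t, (0 <= t <= 1)%R -> exists m, is_Cderive (c i) (0 + RtoC t * x) m) ->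
  exists K : R, (0 <= K)%R /\ forall i t, (i < n)%nat -> (0 <= t <= 1)%R ->
    (Cmod (c i (0 + RtoC t * x)%C) <= K)%R.
Proof.
  intros H. induction n as [|n [K [HK IH]]].
  - exists 0%R. split; [lra|]. intros; lia.
  - destruct (Cderivable_bounded (c n) x (H n)) as [L HL].
    exists (Rmax K L). split; [eapply Rle_trans; [exact HK|apply Rmax_l]|].
    intros i t Hi Ht. destruct (Nat.eq_dec i n) as [->|Hne].
    + eapply Rle_trans; [now apply HL|apply Rmax_r].
    + eapply Rle_trans; [apply IH; [lia|exact Ht]|apply Rmax_l].
Qed.

(** Polynomial in the coordinates, hence differentiable along a line even where the function
    vanishes, unlike the modulus. *)
Definition sqmod (z : C) : R := (Re z ^ 2 + Im z ^ 2)%R.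

Lemma sqmod_Cmod (z : C) : sqmod z = (Cmod z ^ 2)%R.
Proof. symmetry. apply Cmod2_alt. Qed.

(** Cauchy-Schwarz, read off from z times the conjugate of w. *)
Lemma Re_prod_le (z w : C) : (Re z * Re w + Im z * Im w <= Cmod z * Cmod w)%R.
Proof.
  assert (H : (Re z * Re w + Im z * Im w)%R = Re (z * Cconj w)) by (destruct z, w; simpl; ring).
  rewrite H, <- (Cmod_conj w), <- Cmod_mult.
  eapply Rle_trans; [apply Rle_abs|apply re_le_Cmod].
Qed.

(* At the origin the system is [x f' = J f] with [J] = ((1,0,0),(0,0,2),(1/4,0,0)), and
   [2 Re <J f, f> <= (9/4) |f|^2], so that solutions of size [O(x^2)] vanish. *)
Lemma singular_system_zero (c f l : nat -> C -> C) (x : C) :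
  (Cmod x < 1)%R ->
  (forall i y, (Cmod y < 1)%R -> exists m, is_Cderive (c i) y m) ->
  c 0%nat 0 = 1 -> c 1%nat 0 = 0 -> c 2%nat 0 = 0 -> c 3%nat 0 = 0 -> c 4%nat 0 = 2 ->
  c 5%nat 0 = / 4 -> c 6%nat 0 = 0 -> c 7%nat 0 = 0 ->
  (forall i y, (Cmod y < 1)%R -> is_Cderive (f i) y (l i y)) ->
  (forall y, (Cmod y < 1)%R ->
     y * l 0%nat y = c 0%nat y * f 0%nat y + c 1%nat y * f 1%nat y + c 2%nat y * f 2%nat y /\
     y * l 1%nat y = c 3%nat y * f 1%nat y + c 4%nat y * f 2%nat y /\
     y * l 2%nat y = c 5%nat y * f 0%nat y + c 6%nat y * f 1%nat y + c 7%nat y * f 2%nat y) ->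
  (forall i, (i < 3)%nat -> expands (f i) 0 0) ->
  forall i, (i < 3)%nat -> f i x = 0.
Proof.
  intros Hx Hc E0 E1 E2 E3 E4 E5 E6 E7 Hf Heq Hexp.
  assert (Hseg : forall t, (0 <= t <= 1)%R -> (Cmod (0 + RtoC t * x) < 1)%R)
    by (intros; now apply Cmod_scal_lt_1).
  set (N := fun t : R => (sqmod (f 0%nat (0 + RtoC t * x)%C) + sqmod (f 1%nat (0 + RtoC t * x)%C)
    + sqmod (f 2%nat (0 + RtoC t * x)%C))%R).
  set (n' := fun i (t : R) =>
    (2 * (Re (f i (0 + RtoC t * x)%C) * Re (l i (0 + RtoC t * x)%C * x) +
          Im (f i (0 + RtoC t * x)%C) * Im (l i (0 + RtoC t * x)%C * x)))%R).
  set (N' := fun t : R => (n' 0%nat t + n' 1%nat t + n' 2%nat t)%R).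
  assert (Dn : forall i t, (0 <= t <= 1)%R ->
    is_derive (fun t => sqmod (f i (0 + RtoC t * x)%C)) t (n' i t)).
  { intros i t Ht. destruct (is_derive_Re_line _ _ x _ t (Hf i _ (Hseg t Ht))) as [D1 D2].
    unfold sqmod.
    apply (is_derive_ext (fun s => plus
      (Re (f i (0 + RtoC s * x)%C) * Re (f i (0 + RtoC s * x)%C))%R
      (Im (f i (0 + RtoC s * x)%C) * Im (f i (0 + RtoC s * x)%C))%R)).
    { intros s. unfold plus; simpl. match goal with |- ?a = ?b => change (@eq R a b) end. ring. }
    replace (n' i t) with (plus
      (Re (l i (0 + RtoC t * x)%C * x) * Re (f i (0 + RtoC t * x)%C) +
       Re (f i (0 + RtoC t * x)%C) * Re (l i (0 + RtoC t * x)%C * x))%R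
      (Im (l i (0 + RtoC t * x)%C * x) * Im (f i (0 + RtoC t * x)%C) +
       Im (f i (0 + RtoC t * x)%C) * Im (l i (0 + RtoC t * x)%C * x))%R)
      by (unfold n', plus; simpl; ring).
    apply (@is_derive_plus R_AbsRing R_NormedModule
      (fun s => Re (f i (0 + RtoC s * x)%C) * Re (f i (0 + RtoC s * x)%C))%R
      (fun s => Im (f i (0 + RtoC s * x)%C) * Im (f i (0 + RtoC s * x)%C))%R).
    - apply (is_derive_mult_R (fun s => Re (f i (0 + RtoC s * x)%C))
               (fun s => Re (f i (0 + RtoC s * x)%C))); exact D1.
    - apply (is_derive_mult_R (fun s => Im (f i (0 + RtoC s * x)%C))
               (fun s => Im (f i (0 + RtoC s * x)%C))); exact D2. }
  assert (DN : forall t, (0 <= t <= 1)%R -> is_derive N t (N' t)).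
  { intros t Ht.
    apply (@is_derive_plus R_AbsRing R_NormedModule
      (fun t => sqmod (f 0%nat (0 + RtoC t * x)%C) + sqmod (f 1%nat (0 + RtoC t * x)%C))%R
      (fun t => sqmod (f 2%nat (0 + RtoC t * x)%C))); [|now apply Dn].
    apply (@is_derive_plus R_AbsRing R_NormedModule
      (fun t => sqmod (f 0%nat (0 + RtoC t * x)%C))
      (fun t => sqmod (f 1%nat (0 + RtoC t * x)%C))); now apply Dn. }
  assert (Bn : forall i t, (t * n' i t <= 2 * (Cmod (f i (0 + RtoC t * x)%C) *
     Cmod ((0 + RtoC t * x) * l i (0 + RtoC t * x)%C)))%R).
  { intros i t. unfold n'. set (z := f i (0 + RtoC t * x)%C). set (w := l i (0 + RtoC t * x)%C).
    eapply Rle_trans; [|apply Rmult_le_compat_l; [lra|apply Re_prod_le]].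
    right. replace ((0 + RtoC t * x) * w) with (RtoC t * (w * x)) by ring.
    rewrite re_scal_l, im_scal_l. ring. }
  (* One estimate for two regimes: with k constant it gives a finite rate on the whole segment, with
     k close to the values at 0 it gives the rate 3 near the origin. *)
  assert (Core : forall (k : nat -> R) t, (0 <= t <= 1)%R ->
    (forall i, (i < 8)%nat -> Cmod (c i (0 + RtoC t * x)%C) <= k i)%R ->
    let a := Cmod (f 0%nat (0 + RtoC t * x)%C) in let s := Cmod (f 1%nat (0 + RtoC t * x)%C) in
    let u := Cmod (f 2%nat (0 + RtoC t * x)%C) in
    (t * N' t <= 2 * a * (k 0%nat * a + k 1%nat * s + k 2%nat * u) +
       2 * s * (k 3%nat * s + k 4%nat * u) +
       2 * u * (k 5%nat * a + k 6%nat * s + k 7%nat * u))%R).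
  { intros k t Ht Hk a s u. destruct (Heq _ (Hseg t Ht)) as (Q0 & Q1 & Q2).
    assert (B0 := Bn 0%nat t). assert (B1 := Bn 1%nat t). assert (B2 := Bn 2%nat t).
    rewrite Q0 in B0. rewrite Q1 in B1. rewrite Q2 in B2. fold a in B0. fold s in B1. fold u in B2.
    assert (Ha : (0 <= a)%R) by apply Cmod_ge_0. assert (Hs : (0 <= s)%R) by apply Cmod_ge_0.
    assert (Hu : (0 <= u)%R) by apply Cmod_ge_0.
    assert (P : forall i z, (i < 8)%nat ->
      (Cmod (c i (0 + RtoC t * x)%C * z) <= k i * Cmod z)%R).
    { intros i z Hi. rewrite Cmod_mult. apply Rmult_le_compat_r; [apply Cmod_ge_0|now apply Hk]. }
    unfold N'. rewrite !Rmult_plus_distr_l.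
    assert (X0 : (Cmod (c 0%nat (0 + RtoC t * x)%C * f 0%nat (0 + RtoC t * x)%C +
      c 1%nat (0 + RtoC t * x)%C * f 1%nat (0 + RtoC t * x)%C +
      c 2%nat (0 + RtoC t * x)%C * f 2%nat (0 + RtoC t * x)%C) <=
      k 0%nat * a + k 1%nat * s + k 2%nat * u)%R).
    { eapply Rle_trans; [apply Cmod_triangle|]. apply Rplus_le_compat; [|apply P; lia].
      eapply Rle_trans; [apply Cmod_triangle|]. apply Rplus_le_compat; apply P; lia. }
    assert (X1 : (Cmod (c 3%nat (0 + RtoC t * x)%C * f 1%nat (0 + RtoC t * x)%C +
      c 4%nat (0 + RtoC t * x)%C * f 2%nat (0 + RtoC t * x)%C) <=
      k 3%nat * s + k 4%nat * u)%R).
    { eapply Rle_trans; [apply Cmod_triangle|]. apply Rplus_le_compat; apply P; lia. }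
    assert (X2 : (Cmod (c 5%nat (0 + RtoC t * x)%C * f 0%nat (0 + RtoC t * x)%C +
      c 6%nat (0 + RtoC t * x)%C * f 1%nat (0 + RtoC t * x)%C +
      c 7%nat (0 + RtoC t * x)%C * f 2%nat (0 + RtoC t * x)%C) <=
      k 5%nat * a + k 6%nat * s + k 7%nat * u)%R).
    { eapply Rle_trans; [apply Cmod_triangle|]. apply Rplus_le_compat; [|apply P; lia].
      eapply Rle_trans; [apply Cmod_triangle|]. apply Rplus_le_compat; apply P; lia. }
    apply Rmult_le_compat_l with (r := a) in X0; [|exact Ha].
    apply Rmult_le_compat_l with (r := s) in X1; [|exact Hs].
    apply Rmult_le_compat_l with (r := u) in X2; [|exact Hu].
    lra. }
  assert (NE : forall t, N t = (Cmod (f 0%nat (0 + RtoC t * x)%C) ^ 2 +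
    Cmod (f 1%nat (0 + RtoC t * x)%C) ^ 2 + Cmod (f 2%nat (0 + RtoC t * x)%C) ^ 2)%R).
  { intros t. unfold N. now rewrite !sqmod_Cmod. }
  destruct (coeff_bound c x 8) as [K [HK0 HK]].
  { intros i t Ht. now apply Hc, Hseg. }
  destruct (coeff_radius c 8) as [d [Hd Hcr]].
  { intros i. apply Hc. rewrite Cmod_0. lra. }
  assert (Hsm : exists B r : R, (0 < r)%R /\ forall i h, (i < 3)%nat -> (Cmod h < r)%R ->
    (Cmod (f i h) <= B * Cmod h ^ 2)%R).
  { destruct (Hexp 0%nat ltac:(lia)) as [K0 [d0 [HK0' [Hd0 H0]]]].
    destruct (Hexp 1%nat ltac:(lia)) as [K1 [d1 [HK1 [Hd1 H1]]]].
    destruct (Hexp 2%nat ltac:(lia)) as [K2 [d2 [HK2 [Hd2 H2]]]].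
    exists (K0 + K1 + K2)%R, (Rmin d0 (Rmin d1 d2)). split; [repeat apply Rmin_glb_lt; lra|].
    intros i h Hi Hh.
    assert (M1 := Rmin_l d0 (Rmin d1 d2)). assert (M2 := Rmin_r d0 (Rmin d1 d2)).
    assert (M3 := Rmin_l d1 d2). assert (M4 := Rmin_r d1 d2).
    assert (Hh2 : (0 <= Cmod h ^ 2)%R) by (apply pow_le, Cmod_ge_0).
    assert (S0 : forall z, z - 0 - 0 * h = z) by (intros; ring).
    destruct i as [|[|[|i]]]; [| | |lia].
    - eapply Rle_trans; [rewrite <- (S0 (f 0%nat h)); apply H0; lra|].
      apply Rmult_le_compat_r; lra.
    - eapply Rle_trans; [rewrite <- (S0 (f 1%nat h)); apply H1; lra|].
      apply Rmult_le_compat_r; lra.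
    - eapply Rle_trans; [rewrite <- (S0 (f 2%nat h)); apply H2; lra|].
      apply Rmult_le_compat_r; lra. }
  destruct Hsm as [B [r [Hr HB]]].
  set (t0 := Rmin 1 (Rmin (d / 2) (r / 2))).
  assert (Ht0 : (0 < t0)%R) by (repeat apply Rmin_glb_lt; lra).
  assert (Ht1 : (t0 <= 1)%R) by apply Rmin_l.
  assert (Ht2 : (t0 <= d / 2)%R) by (eapply Rle_trans; [apply Rmin_r|apply Rmin_l]).
  assert (Ht3 : (t0 <= r / 2)%R) by (eapply Rle_trans; [apply Rmin_r|apply Rmin_r]).
  assert (Hmod : forall t, (0 <= t)%R -> (Cmod (0 + RtoC t * x) <= t)%R).
  { intros t Ht. rewrite Cplus_0_l, Cmod_mult, Cmod_R, Rabs_right by lra.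
    rewrite <- (Rmult_1_r t) at 2. apply Rmult_le_compat_l; lra. }
  assert (HN1 : N 1%R = 0%R).
  { apply (gronwall N N' (6 * K) (3 * B ^ 2) t0).
    - intros t _. rewrite NE. assert (S := fun z : C => pow_le (Cmod z) 2 (Cmod_ge_0 z)).
      repeat apply Rplus_le_le_0_compat; apply S.
    - intros t Ht. split; [apply DN; lra|].
      eapply Rle_trans; [apply (Core (fun _ => K)); [lra|intros i Hi; apply HK; [exact Hi|lra]]|].
      rewrite NE. set (a := Cmod (f 0%nat _)). set (s := Cmod (f 1%nat _)).
      set (u := Cmod (f 2%nat _)).
      assert (Ha : (0 <= a)%R) by apply Cmod_ge_0. assert (Hs : (0 <= s)%R) by apply Cmod_ge_0.
      assert (Hu : (0 <= u)%R) by apply Cmod_ge_0. clearbody a s u.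
      assert (Q1 : (0 <= K * (a - s) ^ 2)%R) by (apply Rmult_le_pos; [lra|apply pow2_ge_0]).
      assert (Q2 : (0 <= K * (a - u) ^ 2)%R) by (apply Rmult_le_pos; [lra|apply pow2_ge_0]).
      assert (Q3 : (0 <= K * (s - u) ^ 2)%R) by (apply Rmult_le_pos; [lra|apply pow2_ge_0]).
      assert (Q4 : (0 <= K * (a * s))%R) by (apply Rmult_le_pos; [|apply Rmult_le_pos]; lra).
      assert (Q5 : (0 <= K * s ^ 2)%R) by (apply Rmult_le_pos; [lra|apply pow2_ge_0]).
      simpl pow in *. lra.
    - lra.
    - intros t Ht.
      eapply Rle_trans.
      { apply (Core (fun i => Cmod (c i 0%C) + / 16)%R); [lra|].
        intros i Hi. apply Hcr; [exact Hi|]. eapply Rle_lt_trans; [apply Hmod; lra|lra]. }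
      cbv beta. rewrite NE, E0, E1, E2, E3, E4, E5, E6, E7, Cmod_0, Cmod_1.
      rewrite <- RtoC_inv, !Cmod_R, !Rabs_right by lra.
      set (a := Cmod (f 0%nat _)). set (s := Cmod (f 1%nat _)). set (u := Cmod (f 2%nat _)).
      assert (Ha : (0 <= a)%R) by apply Cmod_ge_0. assert (Hs : (0 <= s)%R) by apply Cmod_ge_0.
      assert (Hu : (0 <= u)%R) by apply Cmod_ge_0. clearbody a s u.
      assert (Q1 := pow2_ge_0 (a - s)). assert (Q2 := pow2_ge_0 (a - u)).
      assert (Q3 := pow2_ge_0 (s - u)). assert (Q4 := pow2_ge_0 a). assert (Q5 := pow2_ge_0 s).
      assert (Q6 := pow2_ge_0 u). assert (Q7 : (0 <= a * s)%R) by now apply Rmult_le_pos.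
      simpl pow in *. lra.
    - intros t Ht. rewrite NE.
      assert (Hmt := Hmod t ltac:(lra)). assert (Hmt0 := Cmod_ge_0 (0 + RtoC t * x)).
      assert (P : forall i, (i < 3)%nat -> (Cmod (f i (0 + RtoC t * x)%C) ^ 2 <= B ^ 2 * t ^ 4)%R).
      { intros i Hi. assert (Hb := HB i (0 + RtoC t * x) Hi ltac:(lra)).
        assert (Hf0 := Cmod_ge_0 (f i (0 + RtoC t * x)%C)).
        eapply Rle_trans; [apply pow_incr; split; [exact Hf0|exact Hb]|].
        rewrite Rpow_mult_distr. apply Rmult_le_compat_l; [apply pow2_ge_0|].
        rewrite <- pow_mult. apply pow_incr. lra. }
      generalize (P 0%nat ltac:(lia)) (P 1%nat ltac:(lia)) (P 2%nat ltac:(lia)). lra. }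
  rewrite NE, Cplus_0_l, Cmult_1_l in HN1.
  assert (S := fun z : C => pow_le (Cmod z) 2 (Cmod_ge_0 z)).
  assert (S0 := S (f 0%nat x)). assert (S1 := S (f 1%nat x)). assert (S2 := S (f 2%nat x)).
  assert (Z : forall z, (Cmod z ^ 2 = 0)%R -> z = 0).
  { intros z Hz. apply Cmod_eq_0. simpl in Hz. rewrite Rmult_1_r in Hz.
    destruct (Rmult_integral _ _ Hz); assumption. }
  intros i Hi. apply Z. destruct i as [|[|[|i]]]; [| | |lia]; lra.
Qed.

(** * Comparison of the two systems *)

Lemma CPS_euler (a : nat -> C) (z : C) : conv_disc a 1 -> (Cmod z < 1)%R ->
  z * CPS (deriv_coeff a) z = CPS (fun n => RtoC (INR n) * a n) z.
Proof.
  intros Ha Hz. rewrite <- (CPS_incr _ 1 z (conv_disc_deriv _ _ Ha) Hz).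
  apply CPS_ext. intros [|n]; [simpl; ring|reflexivity].
Qed.

Definition dPhi (q : C) : C := CPS (deriv_coeff (dv 1 1)) q.

Lemma Phi_derive (q : C) : (Cmod q < 1)%R -> is_Cderive (Phi 1) q (dPhi q).
Proof. apply CPS_derive, conv_disc_dv_1. Qed.

Lemma dPhi_Psi (q : C) : (Cmod q < 1)%R -> q * dPhi q = Psi q.
Proof. apply CPS_euler, conv_disc_dv_1. Qed.

Lemma Phi_sq_derive (q : C) : (Cmod q < 1)%R ->
  is_Cderive (fun q => Phi 1 (q * q)) q (dPhi (q * q) * (1 * q + q * 1)).
Proof.
  intros Hq. apply (is_Cderive_comp (Phi 1) (fun q => q * q)).
  - now apply Phi_derive, Cmod_sq_lt_1.
  - apply is_Cderive_mult; apply is_Cderive_id.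
Qed.

Lemma Phi_4_derive (q : C) : (Cmod q < 1)%R ->
  is_Cderive (fun q => Phi 1 (q * q * (q * q))) q
    (dPhi (q * q * (q * q)) * (1 * (q * q) + q * q * 1) * (1 * q + q * 1)).
Proof.
  intros Hq. apply (is_Cderive_comp (fun p => Phi 1 (p * p)) (fun q => q * q)).
  - now apply Phi_sq_derive, Cmod_sq_lt_1.
  - apply is_Cderive_mult; apply is_Cderive_id.
Qed.

(** Derivatives are recorded through q d, since [Psi] is q times the derivative of [Phi 1]; the
    chain rule supplies the factors 2 and 4. *)
Lemma Phi_lin_derive (k c0 c1 c2 c4 q : C) : (Cmod q < 1)%R ->
  exists d, is_Cderive (fun q => k + (c1 * Phi 1 q + c2 * Phi 1 (q * q)
    + c4 * Phi 1 (q * q * (q * q)))) q d /\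
    q * d = c1 * Psi q + 2 * c2 * Psi (q * q) + 4 * c4 * Psi (q * q * (q * q)).
Proof.
  intros Hq. assert (Hq2 := Cmod_sq_lt_1 q Hq). assert (Hq4 := Cmod_sq_lt_1 _ Hq2).
  assert (D1 := Phi_derive q Hq). assert (D2 := Phi_sq_derive q Hq).
  assert (D4 := Phi_4_derive q Hq). eexists. split; [Cderive_rules|].
  cbv beta. rewrite <- (dPhi_Psi q Hq), <- (dPhi_Psi _ Hq2), <- (dPhi_Psi _ Hq4). ring.
Qed.

Lemma eA_derive (q : C) : (Cmod q < 1)%R -> exists d, is_Cderive eA q d /\ q * d = DeA q.
Proof.
  intros Hq. destruct (Phi_lin_derive 0 0 16 (-(48)) 32 q Hq) as [d [D E]]. exists d. split.
  - apply (is_Cderive_local _ eA q d 1 Rlt_0_1) with (2 := D).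
    intros h _. unfold eA. ring.
  - rewrite E. unfold DeA. ring.
Qed.

Lemma eS_derive (q : C) : (Cmod q < 1)%R -> exists d, is_Cderive eS q d /\ q * d = DeS q.
Proof.
  intros Hq. destruct (Phi_lin_derive 1 0 8 0 (-(32)) q Hq) as [d [D E]]. exists d. split.
  - apply (is_Cderive_local _ eS q d 1 Rlt_0_1) with (2 := D).
    intros h _. unfold eS. ring.
  - rewrite E. unfold DeS. ring.
Qed.

Lemma eU_derive (q : C) : (Cmod q < 1)%R -> exists d, is_Cderive eU q d /\ q * d = DeU q.
Proof.
  intros Hq. destruct (Phi_lin_derive 0 0 4 (-(20)) 16 q Hq) as [d [D E]]. exists d. split.
  - apply (is_Cderive_local _ eU q d 1 Rlt_0_1) with (2 := D).
    intros h _. unfold eU. ring.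
  - rewrite E. unfold DeU. ring.
Qed.

(** On functions of q, x d/dx acts as [nome_ratio] times q d/dq, because [nome_ratio] is x q' /
    q. *)
Lemma comp_nome_derive (e De : C -> C) (x : C) :
  (forall q, (Cmod q < 1)%R -> exists d, is_Cderive e q d /\ q * d = De q) ->
  (Cmod x < 1)%R ->
  exists d, is_Cderive (fun y => e (nome y)) x d /\ x * d = nome_ratio x * De (nome x).
Proof.
  intros He Hx. destruct (He _ (Cmod_nome_lt_1 x Hx)) as [d [D E]]. eexists. split.
  - apply is_Cderive_comp; [exact D|now apply nome_derive].
  - rewrite <- E. unfold nome, Cdiv. ring.
Qed.

(** * The hypergeometric solution of the system *)

Definition hA (x : C) : C := x * (hypF x * hypF x).
Definition hS (x : C) : C := hypF x * hypF x.
Definition hU (x : C) : C := x * (1 - x) * (hypF x * hypF' x).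

Lemma hA_derive (x : C) : (Cmod x < 1)%R -> exists d, is_Cderive hA x d /\
  x * d = nome_ratio x * (hA x * (hS x - hA x) + 2 * hA x * hU x).
Proof.
  intros Hx. assert (D := hypF_derive x Hx). eexists. split.
  - unfold hA. Cderive_rules.
  - unfold nome_ratio, hA, hS, hU. field.
    split; [now apply hypF_neq_0|now apply one_minus_neq_0].
Qed.

Lemma hS_derive (x : C) : (Cmod x < 1)%R -> exists d, is_Cderive hS x d /\
  x * d = nome_ratio x * (2 * hS x * hU x).
Proof.
  intros Hx. assert (D := hypF_derive x Hx). eexists. split.
  - unfold hS. Cderive_rules.
  - unfold nome_ratio, hS, hU. field.
    split; [now apply hypF_neq_0|now apply one_minus_neq_0].
Qed.

Lemma hU_derive (x : C) : (Cmod x < 1)%R -> exists d, is_Cderive hU x d /\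
  x * d = nome_ratio x * (hU x ^ 2 + / 4 * hA x * (hS x - hA x)).
Proof.
  intros Hx. assert (D := hypF_derive x Hx). assert (D' := hypF'_derive x Hx).
  assert (O := hypF_ode x Hx). eexists. split.
  - unfold hU. Cderive_rules.
  (* The hypergeometric equation eliminates [hypF'']. *)
  - cbv beta. transitivity (x * hypF x * (x * (1 - x) * hypF'' x + (1 - 2 * x) * hypF' x
      - / 4 * hypF x) + x * (x * (1 - x) * hypF' x ^ 2 + / 4 * hypF x ^ 2)); [ring|].
    rewrite O. unfold nome_ratio, hA, hS, hU. field.
    split; [now apply hypF_neq_0|now apply one_minus_neq_0].
Qed.

(** * First-order expansions at the origin *)

Lemma expands_Phi : expands (Phi 1) 0 1.
Proof.
  eapply expands_eq; [apply expands_CPS, conv_disc_dv_1|reflexivity|].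
  unfold dv, divsum, chi_pow, Nmul. simpl. ring.
Qed.

Lemma expands_Phi_sq : expands (fun q => Phi 1 (q * q)) 0 0.
Proof.
  eapply expands_eq.
  - apply (expands_comp (Phi 1) (fun q => q * q) 0 1); [apply expands_Phi|].
    eapply expands_eq; [apply (expands_mult _ _ _ _ _ _ expands_id expands_id)| |reflexivity].
    ring.
  - reflexivity.
  - ring.
Qed.

Lemma expands_Phi_4 : expands (fun q => Phi 1 (q * q * (q * q))) 0 0.
Proof.
  eapply expands_eq.
  - apply (expands_comp (fun q => Phi 1 (q * q)) (fun q => q * q) 0 0); [apply expands_Phi_sq|].
    eapply expands_eq; [apply (expands_mult _ _ _ _ _ _ expands_id expands_id)| |reflexivity].
    ring.
  - reflexivity.
  - ring.
Qed.

(** Phi(q^2) and Phi(q^4) are O(q^2), so only the coefficient of Phi(q) reaches first order. *)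
Lemma expands_Phi_lin (k c1 c2 c4 : C) :
  expands (fun q => k + (c1 * Phi 1 q + c2 * Phi 1 (q * q) + c4 * Phi 1 (q * q * (q * q)))) k c1.
Proof.
  eapply expands_eq.
  - exact (expands_plus _ _ _ _ _ _ (expands_const k)
      (expands_plus _ _ _ _ _ _
        (expands_plus _ _ _ _ _ _ (expands_scal c1 _ _ _ expands_Phi)
          (expands_scal c2 _ _ _ expands_Phi_sq))
        (expands_scal c4 _ _ _ expands_Phi_4))).
  - ring.
  - ring.
Qed.

Lemma expands_nome : expands nome 0 (/ 16).
Proof.
  apply (expands_ext (fun h => h * (/ 16 * Cexp (hypH h)))).
  { intros h _. unfold nome, Cdiv. ring. }
  eapply expands_eq.
  - apply (expands_mult_id (fun h => / 16 * Cexp (hypH h))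
      (0 * Cexp (hypH 0) + / 16 * (Cexp (hypH 0) * hypH' 0))).
    assert (D := hypH_derive 0 ltac:(rewrite Cmod_0; lra)). Cderive_rules.
  - reflexivity.
  - cbv beta. rewrite hypH_0, Cexp_0. ring.
Qed.

Lemma expands_eA_nome : expands (fun x => eA (nome x)) 0 1.
Proof.
  eapply expands_eq; [apply (expands_comp eA nome 0 16); [|exact expands_nome]|reflexivity|field].
  apply (expands_ext _ _ _ _) with (2 := expands_Phi_lin 0 16 (-(48)) 32).
  intros h _. unfold eA. ring.
Qed.

Lemma expands_eS_nome : expands (fun x => eS (nome x)) 1 (/ 2).
Proof.
  eapply expands_eq; [apply (expands_comp eS nome 1 8); [|exact expands_nome]|reflexivity|field].
  apply (expands_ext _ _ _ _) with (2 := expands_Phi_lin 1 8 0 (-(32))).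
  intros h _. unfold eS. ring.
Qed.

Lemma expands_eU_nome : expands (fun x => eU (nome x)) 0 (/ 4).
Proof.
  eapply expands_eq; [apply (expands_comp eU nome 0 4); [|exact expands_nome]|reflexivity|field].
  apply (expands_ext _ _ _ _) with (2 := expands_Phi_lin 0 4 (-(20)) 16).
  intros h _. unfold eU. ring.
Qed.

Lemma hyp_coeff_0 : hyp_coeff 0 = 1.
Proof. unfold hyp_coeff. simpl. f_equal. ring. Qed.

Lemma hyp_coeff_1 : hyp_coeff 1 = / 4.
Proof. unfold hyp_coeff. simpl. rewrite <- RtoC_inv by lra. f_equal. field. Qed.

Lemma expands_hypF : expands hypF 1 (/ 4).
Proof.
  eapply expands_eq; [apply expands_CPS, conv_disc_hyp|apply hyp_coeff_0|apply hyp_coeff_1].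
Qed.

Lemma expands_hS : expands hS 1 (/ 2).
Proof.
  eapply expands_eq; [exact (expands_mult _ _ _ _ _ _ expands_hypF expands_hypF)|ring|field].
Qed.

Lemma expands_hA : expands hA 0 1.
Proof.
  eapply expands_eq; [exact (expands_mult _ _ _ _ _ _ expands_id expands_hS)|ring|ring].
Qed.

Lemma expands_hU : expands hU 0 (/ 4).
Proof.
  assert (E : expands hypF' (/ 4) (deriv_coeff hyp_coeff 1)).
  { eapply expands_eq; [apply expands_CPS, conv_disc_deriv, conv_disc_hyp| |reflexivity].
    unfold deriv_coeff. rewrite hyp_coeff_1. simpl. ring. }
  apply (expands_ext (fun x => x * (1 + -(1) * x) * (hypF x * hypF' x))).
  { intros h _. unfold hU. ring. }
  eapply expands_eq.
  - exact (expands_mult _ _ _ _ _ _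
      (expands_mult _ _ _ _ _ _ expands_id
        (expands_plus _ _ _ _ _ _ (expands_const 1) (expands_scal (-(1)) _ _ _ expands_id)))
      (expands_mult _ _ _ _ _ _ expands_hypF E)).
  - ring.
  - ring.
Qed.

Lemma expands_diff (f g : C -> C) (a0 a1 : C) :
  expands f a0 a1 -> expands g a0 a1 -> expands (fun x => f x - g x) 0 0.
Proof.
  intros Hf Hg. apply (expands_ext (fun x => f x + -(1) * g x)); [intros h _; ring|].
  eapply expands_eq; [exact (expands_plus _ _ _ _ _ _ Hf (expands_scal (-(1)) _ _ _ Hg))|ring|ring].
Qed.

(** * The linear system satisfied by the differences *)

Definition Cdiff (f : C -> C) (x : C) : Prop := exists d, is_Cderive f x d.

Lemma Cdiff_plus (f g : C -> C) (x : C) : Cdiff f x -> Cdiff g x -> Cdiff (fun y => f y + g y) x.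
Proof. intros [a Ha] [b Hb]. eexists. now apply is_Cderive_plus; [exact Ha|exact Hb]. Qed.

Lemma Cdiff_minus (f g : C -> C) (x : C) : Cdiff f x -> Cdiff g x -> Cdiff (fun y => f y - g y) x.
Proof. intros [a Ha] [b Hb]. eexists. now apply is_Cderive_minus; [exact Ha|exact Hb]. Qed.

Lemma Cdiff_mult (f g : C -> C) (x : C) : Cdiff f x -> Cdiff g x -> Cdiff (fun y => f y * g y) x.
Proof. intros [a Ha] [b Hb]. eexists. now apply is_Cderive_mult; [exact Ha|exact Hb]. Qed.

Lemma Cdiff_scal (c : C) (f : C -> C) (x : C) : Cdiff f x -> Cdiff (fun y => c * f y) x.
Proof. apply Cdiff_mult. exists 0. apply is_Cderive_const. Qed.

Lemma Cdiff_nome_ratio (x : C) : (Cmod x < 1)%R -> Cdiff nome_ratio x.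
Proof.
  intros Hx. assert (D := hypF_derive x Hx).
  assert (Dd : Cdiff (fun y => (1 - y) * (hypF y * hypF y)) x).
  { apply (Cdiff_mult (fun y => 1 - y)).
    - apply Cdiff_minus; [exists 0; apply is_Cderive_const|exists 1; apply is_Cderive_id].
    - apply Cdiff_mult; eexists; exact D. }
  destruct Dd as [d Hd]. eexists.
  apply (is_Cderive_local (fun y => / ((1 - y) * (hypF y * hypF y))) nome_ratio x _ 1 Rlt_0_1).
  - intros h _. unfold nome_ratio. f_equal. ring.
  - apply (is_Cderive_comp Cinv (fun y => (1 - y) * (hypF y * hypF y))); [|exact Hd].
    apply is_Cderive_Cinv. apply Cmult_neq_0; [now apply one_minus_neq_0|].
    apply Cmult_neq_0; now apply hypF_neq_0.
Qed.

Lemma nome_0 : nome 0 = 0.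
Proof. unfold nome, Cdiv. ring. Qed.

Lemma Phi_0 : Phi 1 0 = 0.
Proof. unfold Phi. rewrite CPS_at_0. reflexivity. Qed.

Lemma hypF_0 : hypF 0 = 1.
Proof. unfold hypF. rewrite CPS_at_0. apply hyp_coeff_0. Qed.

(** Products differ by P Q - p q = (P - p) Q + p (Q - q), so each quadratic right-hand side becomes
    linear in the differences. Indices 0-2, 3-4 and 5-7 are the rows of A, S and U; the S row has no
    A entry. *)
Definition transfer_coeff (i : nat) (y : C) : C :=
  match i with
  | 0%nat => nome_ratio y * (eS (nome y) - eA (nome y) - hA y + 2 * eU (nome y))
  | 1%nat => nome_ratio y * hA y
  | 2%nat => 2 * (nome_ratio y * hA y)
  | 3%nat => 2 * (nome_ratio y * eU (nome y))
  | 4%nat => 2 * (nome_ratio y * hS y)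
  | 5%nat => / 4 * (nome_ratio y * (eS (nome y) - eA (nome y) - hA y))
  | 6%nat => / 4 * (nome_ratio y * hA y)
  | _ => nome_ratio y * (eU (nome y) + hU y)
  end.

Definition transfer_diff (i : nat) (y : C) : C :=
  match i with
  | 0%nat => eA (nome y) - hA y
  | 1%nat => eS (nome y) - hS y
  | _ => eU (nome y) - hU y
  end.

Lemma transfer_diff_derive (x : C) : (Cmod x < 1)%R ->
  exists d0 d1 d2, is_Cderive (transfer_diff 0) x d0 /\ is_Cderive (transfer_diff 1) x d1 /\
    (forall i, is_Cderive (transfer_diff (S (S i))) x d2) /\
    x * d0 = nome_ratio x * (DeA (nome x) - (hA x * (hS x - hA x) + 2 * hA x * hU x)) /\
    x * d1 = nome_ratio x * (DeS (nome x) - 2 * hS x * hU x) /\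
    x * d2 = nome_ratio x * (DeU (nome x) - (hU x ^ 2 + / 4 * hA x * (hS x - hA x))).
Proof.
  intros Hx.
  destruct (comp_nome_derive eA DeA x eA_derive Hx) as [a [Da Ea]].
  destruct (comp_nome_derive eS DeS x eS_derive Hx) as [s [Ds Es]].
  destruct (comp_nome_derive eU DeU x eU_derive Hx) as [u [Du Eu]].
  destruct (hA_derive x Hx) as [a' [Da' Ea']]. destruct (hS_derive x Hx) as [s' [Ds' Es']].
  destruct (hU_derive x Hx) as [u' [Du' Eu']].
  exists (a - a'), (s - s'), (u - u').
  split; [|split; [|split; [|split; [|split]]]].
  - exact (is_Cderive_minus _ _ _ _ _ Da Da').
  - exact (is_Cderive_minus _ _ _ _ _ Ds Ds').
  - intros i. exact (is_Cderive_minus _ _ _ _ _ Du Du').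
  - transitivity (x * a - x * a'); [ring|]. rewrite Ea, Ea'. ring.
  - transitivity (x * s - x * s'); [ring|]. rewrite Es, Es'. ring.
  - transitivity (x * u - x * u'); [ring|]. rewrite Eu, Eu'. ring.
Qed.

Lemma eisenstein_hypergeometric (x : C) : (Cmod x < 1)%R ->
  eA (nome x) = hA x /\ eS (nome x) = hS x /\ eU (nome x) = hU x.
Proof.
  intros Hx.
  assert (Z : forall i, (i < 3)%nat -> transfer_diff i x = 0).
  (* Values at 0, which turn the coefficients into the constant matrix assumed by
     [singular_system_zero]. *)
  { assert (V : eA 0 = 0 /\ eS 0 = 1 /\ eU 0 = 0 /\ nome_ratio 0 = 1 /\ hA 0 = 0 /\ hS 0 = 1
      /\ hU 0 = 0).
    { unfold eA, eS, eU, nome_ratio, hA, hS, hU.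
      replace (0 * 0 * (0 * 0)) with (RtoC 0) by ring. replace (0 * 0) with (RtoC 0) by ring.
      rewrite Phi_0, hypF_0. repeat split; try ring. field. }
    destruct V as (VA & VS & VU & VR & VhA & VhS & VhU).
    apply (singular_system_zero transfer_coeff transfer_diff
      (fun i => C_derive (transfer_diff i))); [exact Hx| | | | | | | | | | | |];
      try (cbn [transfer_coeff]; rewrite ?nome_0, ?VA, ?VS, ?VU, ?VR, ?VhA, ?VhS, ?VhU; ring).
    - intros i y Hy.
      assert (R := Cdiff_nome_ratio y Hy).
      assert (CA : Cdiff (fun y => eA (nome y)) y).
      { destruct (comp_nome_derive eA DeA y eA_derive Hy) as [d [D _]]. now exists d. }
      assert (CS : Cdiff (fun y => eS (nome y)) y).
      { destruct (comp_nome_derive eS DeS y eS_derive Hy) as [d [D _]]. now exists d. }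
      assert (CU : Cdiff (fun y => eU (nome y)) y).
      { destruct (comp_nome_derive eU DeU y eU_derive Hy) as [d [D _]]. now exists d. }
      assert (HA : Cdiff hA y) by (destruct (hA_derive y Hy) as [d [D _]]; now exists d).
      assert (HS : Cdiff hS y) by (destruct (hS_derive y Hy) as [d [D _]]; now exists d).
      assert (HU : Cdiff hU y) by (destruct (hU_derive y Hy) as [d [D _]]; now exists d).
      assert (CSA := Cdiff_minus _ _ _ (Cdiff_minus _ _ _ CS CA) HA).
      destruct i as [|[|[|[|[|[|[|i]]]]]]].
      + exact (Cdiff_mult _ _ _ R (Cdiff_plus _ _ _ CSA (Cdiff_scal 2 _ _ CU))).
      + exact (Cdiff_mult _ _ _ R HA).
      + exact (Cdiff_scal 2 _ _ (Cdiff_mult _ _ _ R HA)).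
      + exact (Cdiff_scal 2 _ _ (Cdiff_mult _ _ _ R CU)).
      + exact (Cdiff_scal 2 _ _ (Cdiff_mult _ _ _ R HS)).
      + exact (Cdiff_scal (/ 4) _ _ (Cdiff_mult _ _ _ R CSA)).
      + exact (Cdiff_scal (/ 4) _ _ (Cdiff_mult _ _ _ R HA)).
      + exact (Cdiff_mult _ _ _ R (Cdiff_plus _ _ _ CU HU)).
    - intros i y Hy.
      destruct (transfer_diff_derive y Hy) as (d0 & d1 & d2 & D0 & D1 & D2 & _).
      destruct i as [|[|i]].
      + rewrite (is_C_derive_unique _ _ _ D0). exact D0.
      + rewrite (is_C_derive_unique _ _ _ D1). exact D1.
      + rewrite (is_C_derive_unique _ _ _ (D2 i)). exact (D2 i).
    - intros y Hy.
      destruct (transfer_diff_derive y Hy) as (d0 & d1 & d2 & D0 & D1 & D2 & X0 & X1 & X2).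
      rewrite (is_C_derive_unique _ _ _ D0), (is_C_derive_unique _ _ _ D1),
        (is_C_derive_unique _ _ _ (D2 0%nat)), X0, X1, X2.
      destruct (eisenstein_system (nome y) (Cmod_nome_lt_1 y Hy)) as (S1 & S2 & S3 & _).
      rewrite S1, S2, S3. cbn [transfer_coeff transfer_diff].
      repeat split; ring.
    - intros i Hi. destruct i as [|[|[|i]]]; [| | |lia].
      + exact (expands_diff _ _ _ _ expands_eA_nome expands_hA).
      + exact (expands_diff _ _ _ _ expands_eS_nome expands_hS).
      + exact (expands_diff _ _ _ _ expands_eU_nome expands_hU). }
  repeat split; apply Ceq_minus; [exact (Z 0%nat ltac:(lia))|exact (Z 1%nat ltac:(lia))|
    exact (Z 2%nat ltac:(lia))].
Qed.

Theorem theorem2p3 (F : C -> C) (hF : is_hyp2F1 (1 / 2) (1 / 2) 1 F)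
    (x : C) (hx0 : (0 < Cmod x)%R) (hx1 : (Cmod x < 1)%R)
    (w : C) (hw : is_branch_value F (1 - x) w)
    (dz : C) (hdz : @is_derive C_AbsRing C_NormedModule F x dz) :
  let z := F x in
  let y := (RtoC PI * (w / z))%C in
  let q := Cexp (- y)%C in
  is_P 0 q (1 / 16 * (- 2 + (2 - 3 * x) * z ^ 2 + 8 * x * (1 - x) * z * dz))%C /\
  is_P 1 q (1 / 16 * x * z ^ 2)%C /\
  is_E 0 q (1 / 48 * (- 2 + (2 - x) * z ^ 2))%C /\
  is_E 1 q (1 / 16 * x * z ^ 2)%C /\
  is_Q 0 q (1 / 32 * (2 - (2 - 2 * x + x ^ 2) * z ^ 4))%C /\
  is_Q 1 q (1 / 32 * x * (2 - x) * z ^ 4)%C.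
Proof.
  intros z y q.
  assert (Hq : q = nome x) by exact (nome_eq_branch F hF x w hx1 hw).
  assert (Hz : z = hypF x) by exact (hyp_ext_disc F hF x hx1).
  assert (Hdz : dz = hypF' x)
    by exact (is_Cderive_unique F x _ _ hdz (hyp_ext_derive_disc F hF x hx1)).
  destruct (eisenstein_hypergeometric x hx1) as (EA & ES & EU).
  destruct (dissected_sums (nome x) (Cmod_nome_lt_1 x hx1)) as (P0 & P1 & E0 & E1 & Q0 & Q1).
  rewrite Hq, Hz, Hdz. clearbody z y q.
  (* The literal - 2 of the statement is read as the coercion of the real number -2. *)
  assert (m2 : RtoC (-2) = -(2)) by apply (RtoC_opp 2).
  rewrite m2.
  replace (1 / 16 * (-(2) + (2 - 3 * x) * hypF x ^ 2 + 8 * x * (1 - x) * hypF x * hypF' x))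
    with (- Phi 1 (nome x * nome x) - 2 * Phi 1 (nome x * nome x * (nome x * nome x))).
  replace (1 / 16 * x * hypF x ^ 2) with (/ 16 * eA (nome x)).
  replace (1 / 48 * (-(2) + (2 - x) * hypF x ^ 2))
    with (Phi 1 (nome x * nome x) - 2 * Phi 1 (nome x * nome x * (nome x * nome x))).
  replace (1 / 32 * (2 - (2 - 2 * x + x ^ 2) * hypF x ^ 4))
    with (/ 32 * (2 - (2 * eS (nome x) ^ 2 - 2 * eA (nome x) * eS (nome x) + eA (nome x) ^ 2))).
  replace (1 / 32 * x * (2 - x) * hypF x ^ 4)
    with (/ 32 * eA (nome x) * (2 * eS (nome x) - eA (nome x))).
  - repeat split; assumption.
  - rewrite EA, ES. unfold hA, hS. field.
  - rewrite EA, ES. unfold hA, hS. field.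
  (* Phi(q) cancels: 2 eS - eA - 2 = 48 (Phi(q^2) - 2 Phi(q^4)). *)
  - transitivity (/ 48 * (-(2) + 2 * hS x - hA x)).
    + rewrite <- EA, <- ES. unfold eA, eS. field.
    + unfold hA, hS. field.
  - rewrite EA. unfold hA. field.
  (* Here U is needed to cancel Phi(q): 2 eS - 3 eA + 8 eU - 2 = - 16 (Phi(q^2) + 2 Phi(q^4)). This
     is where dz/dx enters. *)
  - transitivity (/ 16 * (-(2) + 2 * hS x - 3 * hA x + 8 * hU x)).
    + rewrite <- EA, <- ES, <- EU. unfold eA, eS, eU. field.
    + unfold hA, hS, hU. field.
Qed.
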